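(* Let $\nu>0$ be real and let $z\neq0$ be complex with $|\arg z|\le\pi$. Then $$\frac{\partial I_\nu(z)}{\partial\nu}=-2\nu\left[I_\nu(z)\int_z^\infty\frac{K_\nu(t)I_\nu(t)}{t}\,dt+K_\nu(z)\int_0^z\frac{I_\nu^2(t)}{t}\,dt\right].$$
   Context: $I_\nu(z)=(z/2)^\nu\sum_{k\ge0}\frac{(z/2)^{2k}}{k!\,\Gamma(\nu+k+1)}$ is the modified Bessel function and $K_\nu(z)=\frac\pi2\frac{I_{-\nu}(z)-I_\nu(z)}{\sin\pi\nu}$ for $\nu\notin\mathbb{Z}$ (defined by the limit in $\nu$ for integral $\nu$) is the Macdonald function. Multivalued functions take their principal values, with $\arg z=\pm\pi$ understood as the continuous boundary values from above/below the cut $(-\infty,0]$. Integrals are along paths in $|\arg t|\le\pi$ not meeting $0$ except possibly at an endpoint (for $\int_0^z$, the straight segment may be used); $\int_z^\infty$ ends at $+\infty$ along the positive real direction. $\partial/\partial\nu$ is the derivative with respect to the order at fixed $z$. *)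

(* Defs.v *)
(* Stdlib / Coquelicot world. *)
From Stdlib Require Import Reals ZArith.
From Coquelicot Require Import Coquelicot.

Open Scope R_scope.

(** * The reciprocal Gamma function on the real line *)

(* Meaningful for x > 0 only. *)
Definition EulerGamma (x : R) : R :=
  RInt_gen (fun t => Rpower t (x - 1) * exp (- t))
           (at_right 0) (Rbar_locally p_infty).

Fixpoint rising (x : R) (n : nat) : R :=
  match n with
  | O => 1
  | S m => rising x m * (x + INR m)
  end.

(* Gamma is continued to x <= 0 by Gamma (x + n) = x (x+1) ... (x+n-1) Gamma x,
   with n = 0 for x > 0 and otherwise the least n such that x + n > 0.
   At the poles 0, -1, -2, ... of Gamma this gives the usual value 0. *)
Definition rGamma (x : R) : R :=
  let n := Z.to_nat (up (- x)) in rising x n / EulerGamma (x + INR n).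

(** * Points of the cut plane *)

(* A nonzero complex number together with a choice of its argument.  A point of
   the cut (-oo, 0) occurs twice, with argument PI (upper side) and - PI (lower
   side); principal values and their boundary values on the cut are obtained by
   using the recorded argument in the logarithm. *)
Record point := Point { modulus : R ; argument : R }.

Definition in_cut_plane (z : point) : Prop :=
  0 < modulus z /\ - PI <= argument z <= PI.

Definition to_C (z : point) : C :=
  (modulus z * cos (argument z), modulus z * sin (argument z)).

Definition half (z : point) : point := Point (modulus z / 2) (argument z).

(* z ^ nu = exp (nu * (ln |z| + i arg z)) *)
Definition power (z : point) (nu : R) : C :=
  (Rpower (modulus z) nu * cos (nu * argument z),
   Rpower (modulus z) nu * sin (nu * argument z)).

(** * Modified Bessel functions of real order *)

Definition CSeries (a : nat -> C) : C :=
  (Series (fun k => Re (a k)), Series (fun k => Im (a k))).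

Definition BesselI (nu : R) (z : point) : C :=
  Cmult (power (half z) nu)
    (CSeries (fun k =>
       Cmult (Cpow (to_C (half z)) (2 * k))
             (RtoC (rGamma (nu + INR k + 1) / INR (fact k))))).

Definition BesselK_quotient (nu : R) (z : point) : C :=
  Cmult (RtoC (PI / 2))
    (Cdiv (Cminus (BesselI (- nu) z) (BesselI nu z)) (RtoC (sin (PI * nu)))).

(* [Lim] is a limit over mu <> nu. *)
Definition BesselK (nu : R) (z : point) : C :=
  if Req_EM_T (frac_part nu) 0 then
    (real (Lim (fun mu => Re (BesselK_quotient mu z)) nu),
     real (Lim (fun mu => Im (BesselK_quotient mu z)) nu))
  else BesselK_quotient nu z.

(** * Contour integrals *)

(* C^1 on the closed interval [a, b], with one-sided derivatives at the ends. *)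
Definition C1_on (f : R -> R) (a b : R) : Prop :=
  exists g : R -> R,
    (forall s, ex_derive g s /\ continuous (Derive g) s) /\
    (forall s, a <= s <= b -> f s = g s).

Inductive piecewise_C1 (f : R -> R) : R -> R -> Prop :=
| piecewise_C1_piece a b : a <= b -> C1_on f a b -> piecewise_C1 f a b
| piecewise_C1_concat a b c :
    piecewise_C1 f a b -> piecewise_C1 f b c -> piecewise_C1 f a c.

(* The modulus being positive, this amounts to s |-> to_C (gamma s) being
   piecewise C^1 with a continuous choice of argument. *)
Definition piecewise_C1_path (gamma : R -> point) (a b : R) : Prop :=
  (forall s, a <= s <= b -> in_cut_plane (gamma s)) /\
  piecewise_C1 (fun s => modulus (gamma s)) a b /\
  piecewise_C1 (fun s => argument (gamma s)) a b.

(* Parametrised by [0, +oo); the path finally runs along the positive reals. *)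
Definition path_to_infinity (z : point) (gamma : R -> point) : Prop :=
  gamma 0 = z /\
  (forall b, 0 < b -> piecewise_C1_path gamma 0 b) /\
  (exists b, forall s, b <= s -> argument (gamma s) = 0) /\
  is_lim (fun s => modulus (gamma s)) p_infty p_infty.

(* Parametrised by (0, 1]; the straight segment is
   s |-> Point (s * modulus z) (argument z). *)
Definition path_from_zero (z : point) (gamma : R -> point) : Prop :=
  gamma 1 = z /\
  (forall a, 0 < a < 1 -> piecewise_C1_path gamma a 1) /\
  filterlim (fun s => modulus (gamma s)) (at_right 0) (locally 0).

Definition velocity (gamma : R -> point) (s : R) : C :=
  (Derive (fun s => Re (to_C (gamma s))) s,
   Derive (fun s => Im (to_C (gamma s))) s).

Definition pullback (f : point -> C) (gamma : R -> point) (s : R) : C :=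
  Cmult (f (gamma s)) (velocity gamma s).

Definition is_integral_to_infinity
    (f : point -> C) (gamma : R -> point) (l : C) : Prop :=
  is_RInt_gen (V := C_R_NormedModule) (pullback f gamma)
    (at_point 0) (Rbar_locally p_infty) l.

Definition is_integral_from_zero
    (f : point -> C) (gamma : R -> point) (l : C) : Prop :=
  is_RInt_gen (V := C_R_NormedModule) (pullback f gamma)
    (at_right 0) (at_point 1) l.

(* Main.v *)
(* With D = dI_nu/dnu, theta = z d/dz and L = theta^2 - z^2 - nu^2 one has L I = L K = 0 and
   L D = 2 nu I, so the Wronskians w1 = I theta D - D theta I and w2 = K theta D - D theta K
   satisfy theta w1 = 2 nu I^2 and theta w2 = 2 nu K I: both integrands of the theorem have explicit
   primitives, entire functions of zeta = ln (z / 2).  Now w1 vanishes at 0, w2 vanishes at +oo, and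
   K theta I - I theta K = 1, so the right-hand side is I w2 - K w1 = D (K theta I - I theta K) = D.

   The decay of w2 = D / I + (K I) (w1 / I^2) on the positive reals follows from 0 <= w1 <= I^2,
   from K I <= 1 / (2 (z - 1)), which uses I_{-nu} ~ I_nu, and from D / I = O(1 / z), obtained by
   comparing the digamma function with the logarithm in the series for D.  The normalisation of the
   Wronskian of I and K is Euler's reflection formula: psi (x) - psi (1 - x) + pi cot (pi x)
   reproduces itself under halving of the argument and is Lipschitz, hence vanishes. *)
Require Import Defs.
From Stdlib Require Import Reals Lra Lia Psatz ZArith.
From Coquelicot Require Import Coquelicot.

(* [auto_derive] may leave equations typed in a Coquelicot structure over [R]. *)
Ltac Rfield := match goal with |- ?a = ?b => change (@eq R a b) end; field.
Ltac Rring := match goal with |- ?a = ?b => change (@eq R a b) end; ring.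

Ltac unfold_ball H :=
  unfold ball in H; simpl in H; unfold AbsRing_ball, abs, minus, plus, opp in H; simpl in H.
Ltac unfold_ball_goal :=
  unfold ball; simpl; unfold AbsRing_ball, abs, minus, plus, opp; simpl.

(** Complex differentiability never appears: each function of [zeta] is differentiated along an
    arbitrary differentiable curve with real parameter. This suits the contour integrals, because
    dt/t = d zeta turns each of them into a difference of values of a primitive, so no contour has
    to be deformed; and with points given by modulus and argument both sides of the cut are ordinary
    values of [zeta]. Two obstacles shape the rest. Differentiating the series of I_nu in the order
    requires 1/Gamma to be differentiable on the whole line, with bounds that are summable after
    division by k!. Gamma being an integral, its derivative is extracted from log-convexity and the
    functional equation, without differentiating under the integral sign. Secondly, K is a limit at
    integral orders, so the estimate of K I is arranged to be uniform in the order and passes to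
    that limit. The inequalities for I, theta I, w1 and K on the real axis come from the sign of a
    derivative together with the behaviour at one end of the axis, not from asymptotic
    expansions. *)

Lemma is_derive_value (f : R -> R) (x l l' : R) :
  is_derive f x l -> l = l' -> is_derive f x l'.
Proof. now intros H <-. Qed.

Lemma is_derive_continuity_pt (f : R -> R) (x l : R) :
  is_derive f x l -> continuity_pt f x.
Proof.
  intros H. apply continuity_pt_filterlim.
  apply (ex_derive_continuous f). now exists l.
Qed.

Lemma nondecreasing_of_derive (f df : R -> R) (a b : R) :
  a <= b ->
  (forall x, a <= x <= b -> is_derive f x (df x)) ->
  (forall x, a <= x <= b -> 0 <= df x) -> f a <= f b.
Proof.
  intros Hab Hd Hp.
  destruct (MVT_gen f a b df) as [c [Hc E]].
  - intros x Hx. rewrite Rmin_left, Rmax_right in Hx by lra. apply Hd; lra.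
  - intros x Hx. rewrite Rmin_left, Rmax_right in Hx by lra.
    apply (is_derive_continuity_pt f x (df x)), Hd; lra.
  - rewrite Rmin_left, Rmax_right in Hc by lra.
    specialize (Hp c Hc). nra.
Qed.

(** * Elementary bounds for the logarithm and the exponential *)

Lemma ln_le_sub1 (u : R) : 0 < u -> ln u <= u - 1.
Proof.
  intros Hu. generalize (exp_ineq1_le (ln u)). rewrite exp_ln by lra. lra.
Qed.

Lemma ln_ge_1_sub_inv (u : R) : 0 < u -> 1 - / u <= ln u.
Proof.
  intros Hu. generalize (ln_le_sub1 (/ u) (Rinv_0_lt_compat _ Hu)).
  rewrite ln_Rinv by lra. lra.
Qed.

(** The exponential lies above its tangent at the mean point [m]; the weighted sum of the two
    tangent values is [exp m]. *)
Lemma exp_convex (p q l : R) :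
  0 <= l <= 1 -> exp (l * p + (1 - l) * q) <= l * exp p + (1 - l) * exp q.
Proof.
  intros Hl. set (m := l * p + (1 - l) * q).
  assert (H : forall r, exp m * (1 + (r - m)) <= exp r).
  { intros r. replace (exp r) with (exp m * exp (r - m)).
    - apply Rmult_le_compat_l. left; apply exp_pos. apply exp_ineq1_le.
    - rewrite <- exp_plus. f_equal. ring. }
  generalize (H p) (H q). intros Hp Hq.
  assert (l * (exp m * (1 + (p - m))) <= l * exp p) by (apply Rmult_le_compat_l; lra).
  assert ((1 - l) * (exp m * (1 + (q - m))) <= (1 - l) * exp q)
    by (apply Rmult_le_compat_l; lra).
  replace (exp m) with (l * (exp m * (1 + (p - m))) + (1 - l) * (exp m * (1 + (q - m)))).
  lra. unfold m; ring.
Qed.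

Lemma exp_minus (p q : R) : exp (p - q) = exp p / exp q.
Proof. unfold Rminus. now rewrite exp_plus, exp_Ropp. Qed.

(** * The Gamma integral *)

Lemma ex_RInt_of_continuous (f : R -> R) (a b : R) :
  0 < a -> a <= b -> (forall t, 0 < t -> continuous f t) -> ex_RInt f a b.
Proof.
  intros Ha Hab Hc. apply (ex_RInt_continuous (V := R_CompleteNormedModule)).
  intros t Ht. rewrite Rmin_left in Ht by lra. apply Hc; lra.
Qed.

Lemma RInt_monotone_domain (f : R -> R) (a a' b' b : R) :
  0 < a -> a <= a' -> a' <= b' -> b' <= b ->
  (forall t, 0 < t -> continuous f t) -> (forall t, 0 < t -> 0 <= f t) ->
  RInt f a' b' <= RInt f a b.
Proof.
  intros H0 H1 H2 H3 Hc Hp.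
  rewrite <- (RInt_Chasles f a a' b) by (apply ex_RInt_of_continuous; auto; lra).
  rewrite <- (RInt_Chasles f a' b' b) by (apply ex_RInt_of_continuous; auto; lra).
  unfold plus; simpl.
  assert (0 <= RInt f a a').
  { apply RInt_ge_0; auto. apply ex_RInt_of_continuous; auto; lra.
    intros; apply Hp; lra. }
  assert (0 <= RInt f b' b).
  { apply RInt_ge_0; auto. apply ex_RInt_of_continuous; auto; lra.
    intros; apply Hp; lra. }
  lra.
Qed.

(** For a nonnegative integrand the integrals over growing intervals increase, so their supremum is
    the improper integral. The second conclusion records that it dominates every proper integral,
    which later makes Gamma positive. *)
Lemma is_RInt_gen_of_bounded (f : R -> R) (M : R) :
  (forall t, 0 < t -> continuous f t) -> (forall t, 0 < t -> 0 <= f t) ->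
  (forall a b, 0 < a <= 1 -> 1 <= b -> RInt f a b <= M) ->
  exists l, is_RInt_gen f (at_right 0) (Rbar_locally p_infty) l /\
    forall a b, 0 < a -> a <= b -> RInt f a b <= l.
Proof.
  intros Hc Hp HM.
  set (E := fun y => exists a b, 0 < a <= 1 /\ 1 <= b /\ y = RInt f a b).
  destruct (completeness E) as [l [Hub Hlub]].
  - exists M. intros y (a & b & Ha & Hb & ->). auto.
  - exists (RInt f 1 1), 1, 1. repeat split; lra.
  - assert (Hl : forall a b, 0 < a -> a <= b -> RInt f a b <= l).
    { intros a b Ha Hab.
      apply Rle_trans with (RInt f (Rmin a 1) (Rmax b 1)).
      - apply RInt_monotone_domain; auto using Rmin_l, Rmax_l.
        apply Rmin_pos; lra.
      - apply Hub. exists (Rmin a 1), (Rmax b 1).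
        split; [split|split]; auto using Rmin_r, Rmax_r. apply Rmin_pos; lra. }
    exists l. split; auto.
    intros P [eps HP].
    assert (exists a0 b0, 0 < a0 <= 1 /\ 1 <= b0 /\ l - eps < RInt f a0 b0)
      as (a0 & b0 & Ha0 & Hb0 & He).
    { apply Classical_Prop.NNPP. intros Hn.
      assert (l <= l - eps).
      { apply Hlub. intros y (a & b & Ha & Hb & ->).
        apply Rnot_lt_le. intros Hlt. apply Hn. now exists a, b. }
      generalize (cond_pos eps). lra. }
    apply (Filter_prod _ _ _ (fun a => 0 < a <= a0) (fun b => b0 < b)).
    + exists (mkposreal a0 (proj1 Ha0)). intros a Hba Ha.
      unfold_ball Hba.
      rewrite Rabs_pos_eq in Hba by lra. lra.
    + exists b0. auto.
    + intros a b Ha Hb. simpl. exists (RInt f a b). split.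
      * apply (RInt_correct (V := R_CompleteNormedModule)), ex_RInt_of_continuous; auto; lra.
      * apply HP. unfold_ball_goal.
        assert (RInt f a0 b0 <= RInt f a b) by (apply RInt_monotone_domain; auto; lra).
        assert (RInt f a b <= l) by (apply Hl; lra).
        apply Rabs_def1; lra.
Qed.

Lemma RInt_le_antiderivative (f F dF : R -> R) (a b : R) :
  0 < a -> a <= b ->
  (forall t, a <= t <= b -> is_derive F t (dF t)) ->
  (forall t, a <= t <= b -> continuous dF t) ->
  (forall t, 0 < t -> continuous f t) ->
  (forall t, a <= t <= b -> f t <= dF t) ->
  RInt f a b <= F b - F a.
Proof.
  intros Ha Hab HF Hc Hf Hle.
  assert (HI : is_RInt dF a b (F b - F a)).
  { apply (is_RInt_derive (V := R_CompleteNormedModule));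
      intros t Ht; rewrite Rmin_left, Rmax_right in Ht by lra; auto. }
  rewrite <- (is_RInt_unique _ _ _ _ HI).
  apply RInt_le; auto.
  - apply ex_RInt_of_continuous; auto.
  - eexists; apply HI.
  - intros t Ht; apply Hle; lra.
Qed.

Definition gamma_integrand (x t : R) : R := Rpower t (x - 1) * exp (- t).

Lemma gamma_integrand_pos (x t : R) : 0 < gamma_integrand x t.
Proof. apply Rmult_lt_0_compat; apply exp_pos. Qed.

Lemma gamma_integrand_continuous (x t : R) :
  0 < t -> continuous (gamma_integrand x) t.
Proof.
  intros Ht. apply (ex_derive_continuous (gamma_integrand x)).
  unfold gamma_integrand, Rpower. auto_derive. lra.
Qed.

(** From ln v <= v - 1 at v = t / (2 y). Half of the exponent is kept, so the bound remains
    integrable at infinity. *)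
Lemma Rpower_exp_decay (y t : R) :
  0 < y -> 0 < t ->
  Rpower t y * exp (- t) <= exp (y * ln (2 * y) - y) * exp (- t / 2).
Proof.
  intros Hy Ht. unfold Rpower. rewrite <- !exp_plus.
  assert (E : ln t = ln (t / (2 * y)) + ln (2 * y)).
  { rewrite <- ln_mult.
    - f_equal. field; lra.
    - apply Rdiv_lt_0_compat; lra.
    - lra. }
  assert (L : ln (t / (2 * y)) <= t / (2 * y) - 1).
  { apply ln_le_sub1. apply Rdiv_lt_0_compat; lra. }
  assert (y * ln (t / (2 * y)) <= y * (t / (2 * y) - 1)) by (apply Rmult_le_compat_l; lra).
  replace (y * (t / (2 * y) - 1)) with (t / 2 - y) in H by (field; lra).
  assert (K : y * ln t + - t <= y * ln (2 * y) - y + - t / 2) by (rewrite E; lra).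
  destruct K as [K|K].
  - left. now apply exp_increasing.
  - right. now rewrite K.
Qed.

(** Split at 1. On (0, 1] the factor [exp (- t)] is dropped and t^x / x is a primitive; beyond 1 the
    exponent is raised from x - 1 to x, so that [Rpower_exp_decay] applies also when x <= 1. *)
Lemma gamma_integrand_RInt_bound (x : R) :
  0 < x -> exists M, forall a b, 0 < a <= 1 -> 1 <= b ->
    RInt (gamma_integrand x) a b <= M.
Proof.
  intros Hx. set (c := exp (x * ln (2 * x) - x)).
  exists (/ x + 2 * c). intros a b Ha Hb.
  assert (C : forall t, 0 < t -> continuous (gamma_integrand x) t)
    by (intros; now apply gamma_integrand_continuous).
  rewrite <- (RInt_Chasles (gamma_integrand x) a 1 b)
    by (apply ex_RInt_of_continuous; auto; lra).
  unfold plus; simpl.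
  assert (H1 : RInt (gamma_integrand x) a 1 <= Rpower 1 x / x - Rpower a x / x).
  { apply (RInt_le_antiderivative _ (fun t => Rpower t x / x) (fun t => Rpower t (x - 1)));
      auto; try lra.
    - intros t Ht. unfold Rpower. auto_derive. lra.
      replace ((x - 1) * ln t) with (x * ln t - ln t) by ring.
      unfold Rminus. rewrite exp_plus, exp_Ropp, exp_ln by lra. Rfield. lra.
    - intros t Ht. apply (ex_derive_continuous (fun t => Rpower t (x - 1))).
      unfold Rpower. auto_derive. lra.
    - intros t Ht. unfold gamma_integrand.
      rewrite <- (Rmult_1_r (Rpower t (x - 1))) at 2.
      apply Rmult_le_compat_l. left; apply exp_pos.
      rewrite <- exp_0. destruct (Rle_lt_or_eq_dec (- t) 0); [lra| |lra].
      left; now apply exp_increasing. }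
  assert (H2 : RInt (gamma_integrand x) 1 b
               <= - 2 * c * exp (- b / 2) - (- 2 * c * exp (- 1 / 2))).
  { apply (RInt_le_antiderivative _ (fun t => - 2 * c * exp (- t / 2))
             (fun t => c * exp (- t / 2))); auto; try lra.
    - intros t Ht. auto_derive; auto. unfold Rdiv. Rfield.
    - intros t Ht. apply (ex_derive_continuous (fun t => c * exp (- t / 2))).
      auto_derive. auto.
    - intros t Ht.
      apply Rle_trans with (Rpower t x * exp (- t)).
      + unfold gamma_integrand. apply Rmult_le_compat_r. left; apply exp_pos.
        destruct (Req_dec t 1) as [->|Hn].
        * unfold Rpower. rewrite ln_1, !Rmult_0_r. lra.
        * left. apply Rpower_lt; lra.
      + apply Rpower_exp_decay; lra. }
  assert (Rpower 1 x = 1) by (unfold Rpower; rewrite ln_1, Rmult_0_r; apply exp_0).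
  assert (0 < Rpower a x / x) by (apply Rdiv_lt_0_compat; auto; apply exp_pos).
  assert (0 < c) by apply exp_pos.
  assert (0 < exp (- b / 2)) by apply exp_pos.
  assert (exp (- 1 / 2) < 1) by (rewrite <- exp_0; apply exp_increasing; lra).
  assert (Rpower 1 x / x = / x) by (rewrite H; field; lra).
  assert (0 < c * exp (- b / 2)) by (apply Rmult_lt_0_compat; auto).
  assert (c * exp (- 1 / 2) < c * 1) by (apply Rmult_lt_compat_l; auto).
  lra.
Qed.

Lemma is_RInt_gen_EulerGamma (x : R) :
  0 < x ->
  is_RInt_gen (gamma_integrand x) (at_right 0) (Rbar_locally p_infty) (EulerGamma x)
  /\ forall a b, 0 < a -> a <= b -> RInt (gamma_integrand x) a b <= EulerGamma x.
Proof.
  intros Hx. destruct (gamma_integrand_RInt_bound x Hx) as [M HM].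
  destruct (is_RInt_gen_of_bounded (gamma_integrand x) M) as (l & Hl & Hb); auto.
  - intros; now apply gamma_integrand_continuous.
  - intros; left; apply gamma_integrand_pos.
  - assert (E : EulerGamma x = l).
    { unfold EulerGamma.
      apply (is_RInt_gen_unique (V := R_CompleteNormedModule)). exact Hl. }
    rewrite E. auto.
Qed.

Lemma EulerGamma_pos (x : R) : 0 < x -> 0 < EulerGamma x.
Proof.
  intros Hx. destruct (is_RInt_gen_EulerGamma x Hx) as [_ H].
  apply Rlt_le_trans with (RInt (gamma_integrand x) 1 2); [|apply H; lra].
  apply RInt_gt_0. lra.
  - intros; apply gamma_integrand_pos.
  - intros. apply gamma_integrand_continuous. lra.
Qed.

Lemma is_RInt_gen_half_line_derive (F f : R -> R) (la lb : R) :
  (forall t, 0 < t -> is_derive F t (f t)) ->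
  (forall t, 0 < t -> continuous f t) ->
  filterlim F (at_right 0) (locally la) ->
  filterlim F (Rbar_locally p_infty) (locally lb) ->
  is_RInt_gen f (at_right 0) (Rbar_locally p_infty) (lb - la).
Proof.
  intros HF Hc Ha Hb P HP.
  assert (HL : filterlim (fun ab : R * R => F (snd ab) - F (fst ab))
     (filter_prod (at_right 0) (Rbar_locally p_infty)) (locally (lb - la))).
  { apply (filterlim_comp_2 (G := locally lb) (H := locally (opp la))
      (fun ab : R * R => F (snd ab)) (fun ab => opp (F (fst ab))) plus).
    - eapply filterlim_comp; [apply filterlim_snd | exact Hb].
    - eapply filterlim_comp; [|apply (filterlim_opp (V := R_NormedModule))].
      eapply filterlim_comp; [apply filterlim_fst | exact Ha].
    - apply (filterlim_plus (V := R_NormedModule)). }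
  specialize (HL P HP). unfold filtermap in HL.
  assert (HQ : filter_prod (at_right 0) (Rbar_locally p_infty)
      (fun ab : R * R => 0 < fst ab /\ 0 < snd ab)).
  { apply (Filter_prod _ _ _ (fun a => 0 < a) (fun b => 0 < b)); auto.
    - exists (mkposreal 1 Rlt_0_1). intros; lra.
    - exists 0. auto. }
  unfold filtermapi.
  generalize (filter_and _ _ HL HQ). apply filter_imp.
  intros [a b] [H1 H2]; simpl in *.
  exists (F b - F a). split; auto.
  apply (is_RInt_derive (V := R_CompleteNormedModule) F f).
  - intros t Ht. apply HF. generalize (Rmin_pos a b). lra.
  - intros t Ht. apply Hc. generalize (Rmin_pos a b). lra.
Qed.

Lemma Rpower_exp_at_0 (x : R) :
  0 < x -> filterlim (fun t => - (Rpower t x * exp (- t))) (at_right 0) (locally 0).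
Proof.
  intros Hx. apply filterlim_locally. intros eps.
  set (d := Rpower eps (/ x)).
  exists (mkposreal d (exp_pos _)). intros t Hb Ht. simpl in Hb.
  unfold_ball Hb; unfold_ball_goal.
  rewrite Rabs_pos_eq in Hb by lra.
  rewrite Ropp_0, Rplus_0_r, Rabs_Ropp, Rabs_pos_eq.
  2: left; apply Rmult_lt_0_compat; apply exp_pos.
  assert (Rpower t x < eps).
  { replace (pos eps) with (Rpower d x).
    - apply Rlt_Rpower_l; lra.
    - unfold d. rewrite Rpower_mult, Rinv_l, Rpower_1; try lra. apply cond_pos. }
  assert (exp (- t) < 1) by (rewrite <- exp_0; apply exp_increasing; lra).
  assert (0 < Rpower t x) by apply exp_pos.
  assert (0 < exp (- t)) by apply exp_pos.
  nra.
Qed.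

Lemma exp_neg_lt (eps t : R) : 0 < eps -> - ln eps < t -> exp (- t) < eps.
Proof.
  intros He Ht. rewrite <- (exp_ln eps He). apply exp_increasing. lra.
Qed.

Lemma Rpower_exp_at_infinity (x : R) :
  0 < x -> filterlim (fun t => - (Rpower t x * exp (- t))) (Rbar_locally p_infty) (locally 0).
Proof.
  intros Hx. apply filterlim_locally. intros eps.
  set (c := exp (x * ln (2 * x) - x)).
  assert (Hc : 0 < c) by apply exp_pos.
  assert (Hec : 0 < eps / c) by (apply Rdiv_lt_0_compat; auto; apply cond_pos).
  exists (Rmax 0 (- 2 * ln (eps / c))). intros t Ht.
  assert (0 < t) by (generalize (Rmax_l 0 (- 2 * ln (eps / c))); lra).
  assert (- ln (eps / c) < t / 2) by (generalize (Rmax_r 0 (- 2 * ln (eps / c))); lra).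
  unfold_ball_goal.
  rewrite Ropp_0, Rplus_0_r, Rabs_Ropp, Rabs_pos_eq.
  2: left; apply Rmult_lt_0_compat; apply exp_pos.
  apply Rle_lt_trans with (c * exp (- t / 2)).
  - apply Rpower_exp_decay; auto.
  - replace (- t / 2) with (- (t / 2)) by field.
    generalize (exp_neg_lt _ _ Hec H0). intros HH.
    apply (Rmult_lt_compat_l c) in HH; auto.
    replace (c * (eps / c)) with (pos eps) in HH by (field; lra). auto.
Qed.

Lemma EulerGamma_1 : EulerGamma 1 = 1.
Proof.
  destruct (is_RInt_gen_EulerGamma 1 Rlt_0_1) as [H _].
  rewrite <- (is_RInt_gen_unique (V := R_CompleteNormedModule) _ _ H).
  apply (is_RInt_gen_unique (V := R_CompleteNormedModule)).
  replace 1 with (0 - (-1)) at 2 by ring.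
  apply (is_RInt_gen_half_line_derive (fun t => - exp (- t))).
  - intros t Ht. unfold gamma_integrand, Rpower. auto_derive; auto.
    replace ((1 - 1) * ln t) with 0 by ring. rewrite exp_0. ring.
  - intros; now apply gamma_integrand_continuous.
  - eapply filterlim_filter_le_1; [apply filter_le_within|].
    replace (-1) with (- exp (- 0)) by (rewrite Ropp_0, exp_0; ring).
    apply (ex_derive_continuous (fun t => - exp (- t))). auto_derive. auto.
  - apply filterlim_locally. intros eps.
    exists (- ln eps). intros t Ht.
    unfold_ball_goal.
    rewrite Ropp_0, Rplus_0_r, Rabs_Ropp, Rabs_pos_eq by (left; apply exp_pos).
    apply exp_neg_lt; auto. apply cond_pos.
Qed.

(** Integration by parts: - t^x exp(-t) is a primitive of the combined integrand and vanishes at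
    both ends. *)
Lemma EulerGamma_succ (x : R) : 0 < x -> EulerGamma (x + 1) = x * EulerGamma x.
Proof.
  intros Hx.
  destruct (is_RInt_gen_EulerGamma x Hx) as [H _].
  destruct (is_RInt_gen_EulerGamma (x + 1)) as [H' _]. lra.
  assert (K : is_RInt_gen (fun t => minus (gamma_integrand (x + 1) t) (scal x (gamma_integrand x t)))
     (at_right 0) (Rbar_locally p_infty) (0 - 0)).
  { apply (is_RInt_gen_half_line_derive (fun t => - (Rpower t x * exp (- t)))).
    - intros t Ht. unfold gamma_integrand, Rpower. auto_derive; auto.
      unfold minus, plus, opp, scal; simpl. unfold mult; simpl.
      replace ((x + 1 - 1) * ln t) with (x * ln t) by ring.
      replace ((x - 1) * ln t) with (x * ln t - ln t) by ring.
      unfold Rminus. rewrite (exp_plus (x * ln t)), (exp_Ropp (ln t)), exp_ln by lra. field. lra.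
    - intros t Ht. apply (continuous_minus (V := R_NormedModule)).
      + now apply gamma_integrand_continuous.
      + apply (continuous_scal_r (V := R_NormedModule)). now apply gamma_integrand_continuous.
    - now apply Rpower_exp_at_0.
    - now apply Rpower_exp_at_infinity. }
  apply (is_RInt_gen_unique (V := R_CompleteNormedModule)) in K.
  assert (K2 := is_RInt_gen_minus _ _ _ _ H' (is_RInt_gen_scal _ x _ H)).
  apply (is_RInt_gen_unique (V := R_CompleteNormedModule)) in K2.
  assert (E := eq_trans (eq_sym K) K2). unfold minus, plus, opp, scal in E; simpl in E. unfold mult in E; simpl in E.
  lra.
Qed.

(** * Log-convexity of Gamma *)

Definition lnGamma (x : R) : R := ln (EulerGamma x).

Lemma lnGamma_convex (x y l : R) :
  0 < x -> 0 < y -> 0 <= l <= 1 ->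
  lnGamma (l * x + (1 - l) * y) <= l * lnGamma x + (1 - l) * lnGamma y.
Proof.
  intros Hx Hy Hl.
  set (m := l * x + (1 - l) * y).
  assert (Hm : 0 < m).
  { unfold m. destruct (Req_dec l 0) as [->|]; [lra|].
    assert (0 < l * x) by (apply Rmult_lt_0_compat; lra).
    assert (0 <= (1 - l) * y) by (apply Rmult_le_pos; lra). lra. }
  destruct (is_RInt_gen_EulerGamma x Hx) as [Ix _].
  destruct (is_RInt_gen_EulerGamma y Hy) as [Iy _].
  destruct (is_RInt_gen_EulerGamma m Hm) as [Im _].
  assert (Gx := EulerGamma_pos x Hx). assert (Gy := EulerGamma_pos y Hy).
  assert (Gm := EulerGamma_pos m Hm).
  (* The majorant is the combination of the two integrands with weights chosen so that its integral
     is exactly [c]; [RInt_gen_norm] then serves as monotonicity of the improper integral. *)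
  set (c := exp (l * lnGamma x + (1 - l) * lnGamma y)).
  assert (Hc : 0 < c) by apply exp_pos.
  assert (B : EulerGamma m <= c).
  { assert (K := is_RInt_gen_plus _ _ _ _
       (is_RInt_gen_scal _ (c * l / EulerGamma x) _ Ix)
       (is_RInt_gen_scal _ (c * (1 - l) / EulerGamma y) _ Iy)).
    replace c with (plus (scal (c * l / EulerGamma x) (EulerGamma x))
                      (scal (c * (1 - l) / EulerGamma y) (EulerGamma y))).
    2:{ unfold plus, scal; simpl; unfold mult; simpl. field. lra. }
    apply Rle_trans with (norm (EulerGamma m)).
    { apply Rle_abs. }
    refine (RInt_gen_norm (V := R_CompleteNormedModule) _ _ _ _ _ _ Im K).
    - apply (Filter_prod _ _ _ (fun a => a < 1) (fun b => 1 < b)).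
      + exists (mkposreal 1 Rlt_0_1). intros t Hb Ht. simpl in Hb.
        unfold_ball Hb.
        apply Rabs_def2 in Hb. lra.
      + exists 1. auto.
      + intros a b; simpl; lra.
    - apply (Filter_prod _ _ _ (fun a => 0 < a) (fun b => True)).
      + exists (mkposreal 1 Rlt_0_1). auto.
      + exists 1. auto.
      + intros a b Ha _ t Ht; simpl in Ht.
        unfold norm, plus, scal; simpl; unfold abs, mult; simpl.
        rewrite Rabs_pos_eq by (left; apply gamma_integrand_pos).
        (* Weighted AM-GM for the two integrands normalised to have integral 1. *)
        assert (A := exp_convex ((x - 1) * ln t - lnGamma x) ((y - 1) * ln t - lnGamma y) l Hl).
        replace (l * ((x - 1) * ln t - lnGamma x) + (1 - l) * ((y - 1) * ln t - lnGamma y))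
          with ((m - 1) * ln t - (l * lnGamma x + (1 - l) * lnGamma y)) in A
          by (unfold m; ring).
        rewrite !exp_minus in A.
        fold c in A. unfold lnGamma in A. rewrite !exp_ln in A by auto.
        unfold gamma_integrand, Rpower.
        assert (He := exp_pos (- t)).
        apply (Rmult_le_compat_r (c * exp (- t))) in A.
        2: left; now apply Rmult_lt_0_compat.
        eapply Rle_trans; [|eapply Rle_trans; [exact A|]]; right; field; lra. }
  unfold lnGamma at 1. rewrite <- (ln_exp (l * lnGamma x + (1 - l) * lnGamma y)).
  apply ln_le; auto.
Qed.

(** The division-free form admits h = 0 and lets errors of finite sums and series tails simply be
    added. *)
Lemma is_derive_of_small_o (f : R -> R) (x l : R) :
  (forall eps, 0 < eps -> exists d, 0 < d /\
     forall h, Rabs h < d -> Rabs (f (x + h) - f x - h * l) <= eps * Rabs h) ->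
  is_derive f x l.
Proof.
  intros H. apply is_derive_Reals. intros eps He.
  destruct (H (eps / 2)) as (d & Hd & Hh). lra.
  exists (mkposreal d Hd). intros h Hn Hlt. simpl in Hlt.
  specialize (Hh h Hlt).
  replace ((f (x + h) - f x) / h - l) with ((f (x + h) - f x - h * l) / h) by (field; auto).
  rewrite Rabs_div by auto.
  assert (0 < Rabs h) by now apply Rabs_pos_lt.
  apply Rle_lt_trans with (eps / 2); [|lra].
  apply Rmult_le_reg_r with (Rabs h); auto.
  unfold Rdiv at 1. rewrite Rmult_assoc, Rinv_l by lra. lra.
Qed.

Lemma small_o_of_is_derive (f : R -> R) (x l : R) :
  is_derive f x l ->
  forall eps, 0 < eps -> exists d, 0 < d /\
     forall h, Rabs h < d -> Rabs (f (x + h) - f x - h * l) <= eps * Rabs h.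
Proof.
  intros H eps He. apply is_derive_Reals in H. destruct (H eps He) as [d Hd].
  exists d. split. apply cond_pos. intros h Hh.
  destruct (Req_dec h 0) as [->|Hn].
  - rewrite Rplus_0_r, Rabs_R0, Rmult_0_r.
    replace (f x - f x - 0 * l) with 0 by ring. rewrite Rabs_R0. lra.
  - specialize (Hd h Hn Hh).
    replace (f (x + h) - f x - h * l) with (((f (x + h) - f x) / h - l) * h) by (field; auto).
    rewrite Rabs_mult. apply Rmult_le_compat_r. apply Rabs_pos. lra.
Qed.

Lemma lnGamma_succ (x : R) : 0 < x -> lnGamma (x + 1) = lnGamma x + ln x.
Proof.
  intros Hx. unfold lnGamma. rewrite EulerGamma_succ, ln_mult; auto. ring.
  now apply EulerGamma_pos.
Qed.

Lemma lnGamma_three_points (x y z : R) :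
  0 < x -> x < z -> x <= y <= z ->
  lnGamma y * (z - x) <= lnGamma x * (z - y) + lnGamma z * (y - x).
Proof.
  intros Hx Hxz Hy.
  assert (0 < / (z - x)) by (apply Rinv_0_lt_compat; lra).
  assert (Hl : 0 <= (z - y) / (z - x) <= 1).
  { split. apply Rmult_le_pos; lra.
    apply Rmult_le_reg_r with (z - x). lra.
    unfold Rdiv. rewrite Rmult_assoc, Rinv_l; lra. }
  assert (C := lnGamma_convex x z ((z - y) / (z - x)) Hx ltac:(lra) Hl).
  replace ((z - y) / (z - x) * x + (1 - (z - y) / (z - x)) * z) with y in C by (field; lra).
  apply (Rmult_le_compat_r (z - x)) in C; [|lra].
  eapply Rle_trans; [exact C|]. right. field. lra.
Qed.

(** Chords of a convex function: the one between y and y + h is squeezed between the unit chords on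
    [y - 1, y] and [y, y + 1], whose slopes the functional equation gives as ln (y - 1) and ln y. *)
Lemma lnGamma_slope (y h : R) :
  1 < y -> Rabs h <= 1 ->
  exists s, ln (y - 1) <= s <= ln y /\ lnGamma (y + h) - lnGamma y = h * s.
Proof.
  intros Hy Hh.
  assert (S0 := lnGamma_succ y ltac:(lra)).
  assert (S1 := lnGamma_succ (y - 1) ltac:(lra)).
  replace (y - 1 + 1) with y in S1 by ring.
  destruct (Rtotal_order h 0) as [Hn|[->|Hp]].
  - rewrite Rabs_left in Hh by auto.
    assert (A := lnGamma_three_points (y - 1) (y + h) y ltac:(lra) ltac:(lra) ltac:(lra)).
    assert (0 <= y + h - (y - 1)) by lra.
    assert (B := lnGamma_three_points (y + h) y (y + 1) ltac:(lra) ltac:(lra) ltac:(lra)).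
    exists ((lnGamma (y + h) - lnGamma y) / h). split; [|field; lra].
    assert (Hi : 0 < - h) by lra.
    replace ((lnGamma (y + h) - lnGamma y) / h) with ((lnGamma y - lnGamma (y + h)) / - h)
      by (field; lra).
    split; apply Rmult_le_reg_r with (- h); auto; unfold Rdiv;
      rewrite ?Rmult_assoc, ?Rinv_l by lra; nra.
  - exists (ln y). rewrite Rplus_0_r. split; [|ring]. split; [|lra]. apply ln_le; lra.
  - rewrite Rabs_pos_eq in Hh by lra.
    assert (A := lnGamma_three_points y (y + h) (y + 1) ltac:(lra) ltac:(lra) ltac:(lra)).
    assert (B := lnGamma_three_points (y - 1) y (y + h) ltac:(lra) ltac:(lra) ltac:(lra)).
    exists ((lnGamma (y + h) - lnGamma y) / h). split; [|field; lra].
    split; apply Rmult_le_reg_r with h; auto; unfold Rdiv;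
      rewrite ?Rmult_assoc, ?Rinv_l by lra; nra.
Qed.

(** * The digamma function *)

Fixpoint sum_ln (x : R) (n : nat) : R :=
  match n with O => 0 | S m => sum_ln x m + ln (x + INR m) end.

Fixpoint sum_inv (x : R) (n : nat) : R :=
  match n with O => 0 | S m => sum_inv x m + / (x + INR m) end.

Lemma sum_inv_S (x : R) (n : nat) : sum_inv x (S n) = sum_inv x n + / (x + INR n).
Proof. reflexivity. Qed.

Lemma is_derive_sum_ln (x : R) (n : nat) :
  0 < x -> is_derive (fun y => sum_ln y n) x (sum_inv x n).
Proof.
  intros Hx. induction n as [|n IH]; simpl.
  - apply (is_derive_const (V := R_NormedModule)).
  - apply (is_derive_plus (V := R_NormedModule) (fun y => sum_ln y n) (fun y => ln (y + INR n))); auto.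
    assert (0 <= INR n) by apply pos_INR.
    auto_derive. lra. Rfield. lra.
Qed.

Lemma lnGamma_add_nat (x : R) (n : nat) :
  0 < x -> lnGamma (x + INR n) = lnGamma x + sum_ln x n.
Proof.
  intros Hx. induction n as [|n IH]; [simpl; rewrite !Rplus_0_r; auto|].
  rewrite S_INR, <- Rplus_assoc, lnGamma_succ, IH. simpl. ring.
  generalize (pos_INR n). lra.
Qed.

(** Both sequences approximate the logarithmic derivative of Gamma; this one decreases, the next
    increases, and their gap is at most 1 / (x + n). Hence every single n yields a two-sided
    estimate of [digamma]. *)
Definition digamma_upper (x : R) (n : nat) : R := ln (x + INR n + 1) - sum_inv x (S n).
Definition digamma_lower (x : R) (n : nat) : R := ln (x + INR n) - sum_inv x (S n).
Definition digamma (x : R) : R := real (Lim_seq (digamma_upper x)).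

Lemma ln_quotient_bounds (a b : R) :
  0 < a -> 0 < b -> 1 - b / a <= ln a - ln b <= a / b - 1.
Proof.
  intros Ha Hb.
  rewrite <- ln_div by auto.
  assert (H : 0 < a / b) by now apply Rdiv_lt_0_compat.
  generalize (ln_le_sub1 _ H) (ln_ge_1_sub_inv _ H).
  replace (/ (a / b)) with (b / a) by (field; lra). lra.
Qed.

Lemma digamma_gap (x : R) (n : nat) :
  0 < x -> 0 <= digamma_upper x n - digamma_lower x n <= / (x + INR n).
Proof.
  intros Hx. assert (0 <= INR n) by apply pos_INR.
  unfold digamma_upper, digamma_lower.
  generalize (ln_quotient_bounds (x + INR n + 1) (x + INR n) ltac:(lra) ltac:(lra)).
  replace ((x + INR n + 1) / (x + INR n) - 1) with (/ (x + INR n)) by (field; lra).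
  replace (1 - (x + INR n) / (x + INR n + 1)) with (/ (x + INR n + 1)) by (field; lra).
  assert (0 < / (x + INR n + 1)) by (apply Rinv_0_lt_compat; lra).
  lra.
Qed.

Lemma inv_shift_small (x eps : R) :
  0 < x -> 0 < eps -> exists N, forall n, (N <= n)%nat -> / (x + INR n) < eps.
Proof.
  intros Hx He. destruct (nfloor_ex (/ eps)) as [N HN].
  { left. now apply Rinv_0_lt_compat. }
  exists (S N). intros n Hn. apply le_INR in Hn. rewrite S_INR in Hn.
  rewrite <- (Rinv_inv eps). apply Rinv_lt_contravar; [|lra].
  apply Rmult_lt_0_compat. now apply Rinv_0_lt_compat. generalize (pos_INR n); lra.
Qed.

Lemma digamma_bounds (x : R) (n : nat) :
  0 < x -> digamma_lower x n <= digamma x <= digamma_upper x n.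
Proof.
  intros Hx.
  assert (Hu : forall n, digamma_upper x (S n) <= digamma_upper x n).
  { intros k. assert (0 <= INR k) by apply pos_INR.
    unfold digamma_upper. rewrite (sum_inv_S x (S k)), S_INR.
    generalize (ln_quotient_bounds (x + (INR k + 1) + 1) (x + INR k + 1) ltac:(lra) ltac:(lra)).
    rewrite <- Rplus_assoc.
    replace ((x + INR k + 1 + 1) / (x + INR k + 1) - 1) with (/ (x + INR k + 1)) by (field; lra).
    lra. }
  assert (Hl : forall n, digamma_lower x n <= digamma_lower x (S n)).
  { intros k. assert (0 <= INR k) by apply pos_INR.
    unfold digamma_lower. rewrite (sum_inv_S x (S k)), S_INR.
    generalize (ln_quotient_bounds (x + (INR k + 1)) (x + INR k) ltac:(lra) ltac:(lra)).
    rewrite <- Rplus_assoc.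
    replace (1 - (x + INR k) / (x + INR k + 1)) with (/ (x + INR k + 1)) by (field; lra).
    lra. }
  assert (Hg : is_lim_seq (fun n => digamma_upper x n - digamma_lower x n) 0).
  { apply is_lim_seq_spec. intros eps.
    destruct (inv_shift_small x eps Hx (cond_pos eps)) as [N HN].
    exists N. intros k Hk. rewrite Rminus_0_r.
    generalize (digamma_gap x k Hx) (HN k Hk). intros.
    rewrite Rabs_pos_eq; lra. }
  destruct (ex_lim_seq_adj _ _ Hl Hu Hg) as ([l Il] & [l' Iu] & E).
  rewrite (is_lim_seq_unique _ _ Il), (is_lim_seq_unique _ _ Iu) in E.
  unfold digamma. rewrite (is_lim_seq_unique _ _ Iu). simpl.
  injection E as <-. split.
  - exact (is_lim_seq_incr_compare _ _ Il Hl n).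
  - exact (is_lim_seq_decr_compare _ _ Iu Hu n).
Qed.

(** After a shift by n + 1 the difference quotient of [lnGamma] lies between ln (x + n) and ln (x +
    n + 1) uniformly in h, and [digamma x + sum_inv x (S n)] lies in the same interval. What the
    shift adds is a finite sum of logarithms with known derivative. *)
Lemma is_derive_lnGamma (x : R) : 0 < x -> is_derive lnGamma x (digamma x).
Proof.
  intros Hx. apply is_derive_of_small_o. intros eps He.
  destruct (inv_shift_small x (eps / 2) Hx ltac:(lra)) as [N HN].
  set (n := S N).
  assert (Hn1 : 1 <= INR n) by (unfold n; rewrite S_INR; generalize (pos_INR N); lra).
  destruct (small_o_of_is_derive _ _ _ (is_derive_sum_ln x (S n) Hx) (eps / 2) ltac:(lra))
    as (d & Hd & Hh).
  exists (Rmin (Rmin d x) 1). split.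
  { repeat apply Rmin_pos; lra. }
  intros h Hlt.
  assert (Rabs h < d /\ Rabs h < x /\ Rabs h < 1) as (H1 & H2 & H3).
  { generalize (Rmin_l (Rmin d x) 1) (Rmin_r (Rmin d x) 1) (Rmin_l d x) (Rmin_r d x). lra. }
  specialize (Hh h H1). apply Rabs_def2 in H2.
  destruct (lnGamma_slope (x + INR (S n)) h) as (s & Hs & E).
  { rewrite S_INR. lra. } { lra. }
  replace (x + INR (S n) + h) with (x + h + INR (S n)) in E by ring.
  rewrite !lnGamma_add_nat in E by lra.
  replace (lnGamma (x + h) - lnGamma x - h * digamma x) with
    (h * (s - (digamma x + sum_inv x (S n)))
     + - (sum_ln (x + h) (S n) - sum_ln x (S n) - h * sum_inv x (S n))) by lra.
  eapply Rle_trans; [apply Rabs_triang|]. rewrite Rabs_Ropp, Rabs_mult.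
  assert (Rabs (s - (digamma x + sum_inv x (S n))) <= eps / 2).
  { generalize (digamma_bounds x n Hx) (digamma_gap x n Hx) (HN n ltac:(unfold n; lia)).
    unfold digamma_lower, digamma_upper. rewrite S_INR in Hs.
    replace (x + (INR n + 1) - 1) with (x + INR n) in Hs by ring.
    rewrite <- Rplus_assoc in Hs.
    intros. apply Rabs_le. lra. }
  assert (0 <= Rabs h) by apply Rabs_pos. nra.
Qed.

Lemma digamma_le_ln (x : R) : 0 < x -> digamma x <= ln x.
Proof.
  intros Hx. generalize (digamma_bounds x 0 Hx). unfold digamma_upper. simpl.
  rewrite !Rplus_0_r, Rplus_0_l.
  generalize (ln_quotient_bounds (x + 1) x ltac:(lra) ltac:(lra)).
  replace ((x + 1) / x - 1) with (/ x) by (field; lra). lra.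
Qed.

Lemma digamma_ge_ln (x : R) : 0 < x -> ln x - / x <= digamma x.
Proof.
  intros Hx. generalize (digamma_bounds x 0 Hx). unfold digamma_lower. simpl.
  rewrite !Rplus_0_r, Rplus_0_l. lra.
Qed.

Lemma digamma_succ (x : R) : 0 < x -> digamma (x + 1) = digamma x + / x.
Proof.
  intros Hx.
  assert (A : is_derive (fun y => lnGamma (y + 1)) x (digamma (x + 1))).
  { eapply is_derive_value.
    apply (is_derive_comp (V := R_NormedModule) lnGamma (fun y => y + 1)).
    apply is_derive_lnGamma; lra. auto_derive; auto. apply Rmult_1_l. }
  assert (B : is_derive (fun y => lnGamma (y + 1)) x (digamma x + / x)).
  { apply (is_derive_ext_loc (fun y => lnGamma y + ln y)).
    - exists (mkposreal x Hx). intros y Hy. simpl in Hy.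
      unfold_ball Hy.
      apply Rabs_def2 in Hy. symmetry. apply lnGamma_succ. lra.
    - apply (is_derive_plus (V := R_NormedModule)). now apply is_derive_lnGamma.
      now apply is_derive_ln. }
  apply is_derive_unique in A. apply is_derive_unique in B. congruence.
Qed.

(** Each term is at most (y - x) / (j + 1)^2. The bound 2 - 1 / (n + 1) is the telescoping form of
    sum 1 / (j + 1)^2 <= 2 that goes through the induction. *)
Lemma sum_inv_diff (x y : R) (n : nat) :
  1 <= x <= y -> 0 <= sum_inv x (S n) - sum_inv y (S n) <= (y - x) * (2 - / (INR n + 1)).
Proof.
  intros Hxy.
  assert (T : forall j, 0 <= / (x + INR j) - / (y + INR j) <= (y - x) * (/ (INR j + 1) * / (INR j + 1))).
  { intros j. assert (0 <= INR j) by apply pos_INR.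
    replace (/ (x + INR j) - / (y + INR j)) with ((y - x) * (/ (x + INR j) * / (y + INR j)))
      by (field; lra).
    assert (0 < / (x + INR j)) by (apply Rinv_0_lt_compat; lra).
    assert (0 < / (y + INR j)) by (apply Rinv_0_lt_compat; lra).
    assert (/ (x + INR j) <= / (INR j + 1)) by (apply Rinv_le_contravar; lra).
    assert (/ (y + INR j) <= / (INR j + 1)) by (apply Rinv_le_contravar; lra).
    split.
    - apply Rmult_le_pos; [lra|]. apply Rmult_le_pos; lra.
    - apply Rmult_le_compat_l; [lra|]. apply Rmult_le_compat; lra. }
  induction n as [|n IH].
  - generalize (T O). simpl. rewrite !Rplus_0_r, !Rplus_0_l, Rinv_1. lra.
  - generalize (T (S n)). rewrite (sum_inv_S x (S n)), (sum_inv_S y (S n)), S_INR.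
    assert (0 <= INR n) by apply pos_INR.
    assert (/ (INR n + 1 + 1) * / (INR n + 1 + 1) <= / (INR n + 1) - / (INR n + 1 + 1)).
    { replace (/ (INR n + 1) - / (INR n + 1 + 1)) with (/ (INR n + 1) * / (INR n + 1 + 1))
        by (field; lra).
      apply Rmult_le_compat_r. left; apply Rinv_0_lt_compat; lra.
      apply Rinv_le_contravar; lra. }
    intros. nra.
Qed.

Lemma Rle_of_vanishing_error (a b c : R) :
  (forall n, a <= b + c * / (1 + INR n)) -> a <= b.
Proof.
  intros H. apply Rnot_lt_le. intros Hlt.
  assert (0 < Rabs c + 1) by (generalize (Rabs_pos c); lra).
  destruct (inv_shift_small 1 ((a - b) / (Rabs c + 1)) Rlt_0_1) as [N HN].
  { apply Rdiv_lt_0_compat; lra. }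
  specialize (H N). specialize (HN N (le_n _)).
  assert (0 < / (1 + INR N)) by (apply Rinv_0_lt_compat; generalize (pos_INR N); lra).
  assert (c * / (1 + INR N) <= (Rabs c + 1) * / (1 + INR N)).
  { apply Rmult_le_compat_r. lra. generalize (Rle_abs c). lra. }
  apply (Rmult_lt_compat_l (Rabs c + 1)) in HN; [|lra].
  replace ((Rabs c + 1) * ((a - b) / (Rabs c + 1))) with (a - b) in HN by (field; lra).
  lra.
Qed.

(** Compare the approximating sequences of x and y at the same n: the logarithms contribute only O(1
    / n), and the difference of the harmonic sums supplies the constant 2. *)
Lemma digamma_lipschitz_le (x y : R) :
  1 <= x <= y -> 0 <= digamma y - digamma x <= 2 * (y - x).
Proof.
  intros Hxy.
  assert (P : forall n, 0 <= INR n /\ 0 < / (1 + INR n) /\ / (x + INR n) <= / (1 + INR n) /\ / (y + INR n) <= / (1 + INR n)).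
  { intros n. assert (0 <= INR n) by apply pos_INR.
    split; auto. split. apply Rinv_0_lt_compat; lra. split; apply Rinv_le_contravar; lra. }
  split.
  - apply (Rle_of_vanishing_error _ _ 1). intros n. destruct (P n) as (Hn & Hi & Hx & Hy).
    generalize (digamma_bounds x n ltac:(lra)) (digamma_bounds y n ltac:(lra))
      (sum_inv_diff x y n Hxy).
    unfold digamma_lower, digamma_upper.
    generalize (ln_quotient_bounds (y + INR n) (x + INR n + 1) ltac:(lra) ltac:(lra)).
    assert ((x + INR n + 1) / (y + INR n) <= 1 + / (y + INR n)).
    { replace (1 + / (y + INR n)) with ((y + INR n + 1) / (y + INR n)) by (field; lra).
      apply Rmult_le_compat_r; [|lra]. left; apply Rinv_0_lt_compat; lra. }
    lra.
  - apply (Rle_of_vanishing_error _ _ (y - x + 1)). intros n. destruct (P n) as (Hn & Hi & Hx & Hy).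
    generalize (digamma_bounds x n ltac:(lra)) (digamma_bounds y n ltac:(lra))
      (sum_inv_diff x y n Hxy).
    unfold digamma_lower, digamma_upper.
    generalize (ln_quotient_bounds (y + INR n + 1) (x + INR n) ltac:(lra) ltac:(lra)).
    replace ((y + INR n + 1) / (x + INR n) - 1) with ((y - x + 1) * / (x + INR n)) by (field; lra).
    rewrite (Rplus_comm (INR n) 1). nra.
Qed.

Lemma digamma_lipschitz (x y : R) :
  1 <= x -> 1 <= y -> Rabs (digamma x - digamma y) <= 2 * Rabs (x - y).
Proof.
  intros Hx Hy. destruct (Rle_dec x y).
  - generalize (digamma_lipschitz_le x y ltac:(lra)). intros.
    rewrite Rabs_left1, (Rabs_left1 (x - y)); lra.
  - generalize (digamma_lipschitz_le y x ltac:(lra)). intros.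
    rewrite !Rabs_pos_eq; lra.
Qed.

(* The difference of both sides has period 1 and tends to 0 at infinity. *)
Lemma digamma_duplication (x : R) :
  0 < x -> digamma (x / 2) + digamma ((x + 1) / 2) = 2 * digamma x - 2 * ln 2.
Proof.
  intros Hx.
  set (r := fun y => digamma (y / 2) + digamma ((y + 1) / 2) - 2 * digamma y + 2 * ln 2).
  assert (Hr : forall y, 0 < y -> Rabs (r y) <= 4 * / y).
  { intros y Hy. unfold r.
    generalize (digamma_le_ln (y / 2) ltac:(lra)) (digamma_ge_ln (y / 2) ltac:(lra))
      (digamma_le_ln ((y + 1) / 2) ltac:(lra)) (digamma_ge_ln ((y + 1) / 2) ltac:(lra))
      (digamma_le_ln y Hy) (digamma_ge_ln y Hy)
      (ln_quotient_bounds (y + 1) y ltac:(lra) Hy).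
    rewrite !ln_div by lra.
    replace ((y + 1) / y - 1) with (/ y) by (field; lra).
    replace (/ (y / 2)) with (2 * / y) by (field; lra).
    replace (/ ((y + 1) / 2)) with (2 * / (y + 1)) by (field; lra).
    replace (1 - y / (y + 1)) with (/ (y + 1)) by (field; lra).
    assert (0 < / y) by now apply Rinv_0_lt_compat.
    assert (0 < / (y + 1)) by (apply Rinv_0_lt_compat; lra).
    assert (/ (y + 1) <= / y) by (apply Rinv_le_contravar; lra).
    intros. apply Rabs_le. lra. }
  assert (Hp : forall n, r (x + INR n) = r x).
  { induction n as [|n IH]. simpl. now rewrite Rplus_0_r.
    rewrite <- IH, S_INR. assert (0 <= INR n) by apply pos_INR. unfold r.
    replace ((x + (INR n + 1) + 1) / 2) with ((x + INR n) / 2 + 1) by field.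
    replace (x + (INR n + 1)) with (x + INR n + 1) by ring.
    rewrite !digamma_succ by lra.
    replace (/ ((x + INR n) / 2)) with (2 * / (x + INR n)) by (field; lra). ring. }
  assert (E : r x = 0).
  { apply Rabs_eq_0. apply Rle_antisym; [|apply Rabs_pos].
    apply Rnot_lt_le. intros Hlt.
    destruct (inv_shift_small x (Rabs (r x) / 4) Hx ltac:(lra)) as [N HN].
    specialize (HN N (le_n _)).
    generalize (Hr (x + INR N) ltac:(generalize (pos_INR N); lra)).
    rewrite Hp. lra. }
  unfold r in E. lra.
Qed.

(** * Euler's reflection formula *)

Lemma sin_lower_cubic (s : R) : 0 <= s <= PI / 2 -> s - s ^ 3 / 6 <= sin s.
Proof.
  intros Hs.
  assert (Hc : forall t, 0 <= t -> 0 <= cos t - 1 + t ^ 2 / 2).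
  { intros t Ht. replace t with (2 * (t / 2)) at 1 by field.
    rewrite cos_2a_sin.
    assert (- (t / 2) <= sin (t / 2) <= t / 2).
    { destruct (Req_dec t 0) as [->|Hn].
      - replace (0 / 2) with 0 by field. rewrite sin_0. lra.
      - assert (sin (t / 2) < t / 2) by (apply sin_lt_x; lra).
        destruct (Rle_dec (t / 2) PI).
        + assert (0 <= sin (t / 2)) by (apply sin_ge_0; lra). lra.
        + generalize (SIN_bound (t / 2)) PI2_1. lra. }
    nra. }
  generalize (nondecreasing_of_derive (fun t => sin t - (t - t ^ 3 / 6))
    (fun t => cos t - 1 + t ^ 2 / 2) 0 s ltac:(lra)).
  simpl. rewrite sin_0. intros H.
  cut (0 <= sin s - (s - s ^ 3 / 6)). lra.
  eapply Rle_trans; [|apply H].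
  - right. field.
  - intros x Hx. auto_derive; auto. Rfield.
  - intros x Hx. apply Hc. lra.
Qed.

(** The double poles cancel. As s^2 <= 4, the cubic bound gives sin s >= s / 3; the numerator is at
    most s^4 / 3 and the denominator at least s^4 / 9, whence 3. *)
Lemma inv_sin_sqr_bound (s : R) :
  0 < s <= PI / 2 -> 0 <= / (sin s) ^ 2 - / s ^ 2 <= 3.
Proof.
  intros Hs.
  assert (H1 := sin_lower_cubic s ltac:(lra)).
  assert (H2 : sin s < s) by (apply sin_lt_x; lra).
  assert (HP := PI_4).
  assert (Hs4 : s ^ 2 <= 4) by nra.
  assert (H3 : s * (1 / 3) <= sin s) by nra.
  assert (0 < sin s) by lra.
  replace (/ sin s ^ 2 - / s ^ 2) with ((s - sin s) * (s + sin s) / (s ^ 2 * sin s ^ 2)) by (field; lra).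
  assert (0 < s ^ 2 * sin s ^ 2) by (apply Rmult_lt_0_compat; apply pow_lt; lra).
  split.
  - apply Rmult_le_pos. apply Rmult_le_pos; lra. left; now apply Rinv_0_lt_compat.
  - apply Rmult_le_reg_r with (s ^ 2 * sin s ^ 2); auto.
    unfold Rdiv. rewrite Rmult_assoc, Rinv_l by lra.
    assert (s - sin s <= s ^ 3 / 6) by lra.
    assert ((s - sin s) * (s + sin s) <= s ^ 3 / 6 * (2 * s)) by (apply Rmult_le_compat; lra).
    assert ((s * (1 / 3)) ^ 2 <= sin s ^ 2) by (apply pow_incr; lra).
    assert (s ^ 2 * (s * (1 / 3)) ^ 2 <= s ^ 2 * sin s ^ 2)
      by (apply Rmult_le_compat_l; [apply pow_le; lra|auto]).
    replace (s ^ 2 * (s * (1 / 3)) ^ 2) with (s ^ 3 / 6 * (2 * s) / 3) in H6 by field.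
    lra.
Qed.

Definition reflection_defect (x : R) : R :=
  digamma x - digamma (1 - x) + PI * (cos (PI * x) / sin (PI * x)).

Lemma sin_PI_pos (x : R) : 0 < x < 1 -> 0 < sin (PI * x).
Proof. intros Hx. generalize PI_RGT_0. intros. apply sin_gt_0; nra. Qed.

(** Subtract the duplication formulas at x and 1 - x, so that the terms in ln 2 cancel; the
    cotangents match by 2 cot (2 a) = cot a - tan a. *)
Lemma reflection_defect_halving (x : R) :
  0 < x <= 1 / 2 ->
  2 * reflection_defect x = reflection_defect (x / 2) - reflection_defect ((1 - x) / 2).
Proof.
  intros Hx. unfold reflection_defect.
  replace (1 - x / 2) with ((1 - x + 1) / 2) by field.
  replace (1 - (1 - x) / 2) with ((x + 1) / 2) by field.
  assert (A := digamma_duplication x ltac:(lra)).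
  assert (B := digamma_duplication (1 - x) ltac:(lra)).
  assert (P1 := sin_PI_pos (x / 2) ltac:(lra)).
  assert (P2 : 0 < cos (PI * (x / 2))) by (generalize PI_RGT_0; intros; apply cos_gt_0; nra).
  assert (P3 := sin_PI_pos x ltac:(lra)).
  replace (PI * ((1 - x) / 2)) with (PI / 2 - PI * (x / 2)) by field.
  rewrite cos_shift, sin_shift.
  replace (PI * x) with (2 * (PI * (x / 2))) by field.
  rewrite cos_2a, sin_2a.
  set (c := cos (PI * (x / 2))) in *. set (s := sin (PI * (x / 2))) in *.
  replace (2 * (digamma x - digamma (1 - x) + PI * ((c * c - s * s) / (2 * s * c))))
    with (2 * digamma x - 2 * digamma (1 - x) + PI * (c / s) - PI * (s / c)) by (field; lra).
  lra.
Qed.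

(** At 0 the pole -1/x of digamma cancels the pole 1/x of pi cot (pi x); shifting both digamma
    arguments above 1 makes this visible. The interval (0, 1/2] is mapped into itself by x / 2 and
    (1 - x) / 2. *)
Lemma reflection_defect_lipschitz :
  exists L, 0 <= L /\ forall x y, 0 < x <= 1 / 2 -> 0 < y <= 1 / 2 ->
    Rabs (reflection_defect x - reflection_defect y) <= L * Rabs (x - y).
Proof.
  set (phi := fun x => PI * (cos (PI * x) / sin (PI * x)) - / x).
  assert (HP := PI_RGT_0).
  assert (Hphi : forall x y, 0 < x <= 1 / 2 -> 0 < y <= 1 / 2 ->
    Rabs (phi x - phi y) <= (3 * PI ^ 2) * Rabs (x - y)).
  { intros x y Hx Hy.
    destruct (MVT_gen phi y x (fun t => - PI ^ 2 * (/ (sin (PI * t)) ^ 2 - / (PI * t) ^ 2))) as (c & Hc & E).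
    - intros t Ht.
      assert (0 < t <= 1 / 2) by (generalize (Rmin_pos y x) (Rmax_lub y x (1/2)); lra).
      assert (0 < sin (PI * t)) by (apply sin_PI_pos; lra).
      unfold phi. auto_derive. lra.
      assert (E2 : cos (PI * t) * cos (PI * t) = 1 - sin (PI * t) * sin (PI * t)).
      { generalize (sin2_cos2 (PI * t)). unfold Rsqr. lra. }
      replace (- PI ^ 2 * (/ sin (PI * t) ^ 2 - / (PI * t) ^ 2)) with
        (- PI ^ 2 / sin (PI * t) ^ 2 + / t ^ 2) by (field; lra).
      replace (- PI ^ 2 / sin (PI * t) ^ 2)
        with (- PI ^ 2 * (sin (PI * t) * sin (PI * t) + cos (PI * t) * cos (PI * t)) / sin (PI * t) ^ 2)
        by (rewrite E2; field; lra).
      Rfield. lra.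
    - intros t Ht.
      assert (0 < t <= 1 / 2) by (generalize (Rmin_pos y x) (Rmax_lub y x (1/2)); lra).
      assert (0 < sin (PI * t)) by (apply sin_PI_pos; lra).
      apply continuity_pt_filterlim. apply (ex_derive_continuous phi).
      unfold phi. auto_derive. lra.
    - rewrite E, Rabs_mult. apply Rmult_le_compat_r. apply Rabs_pos.
      assert (0 < c <= 1 / 2) by (generalize (Rmin_pos y x) (Rmax_lub y x (1/2)); lra).
      assert (B := inv_sin_sqr_bound (PI * c) ltac:(split; nra)).
      assert (0 < PI ^ 2) by (apply pow_lt; auto).
      apply Rabs_le. split; nra. }
  (* The first 4 is 2 for each digamma, 3 PI^2 belongs to the regularised cotangent [phi], and the
     last 4 to 1 / (1 - x), where 1 - x >= 1/2. *)
  exists (4 + 3 * PI ^ 2 + 4). split. nra. intros x y Hx Hy.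
  assert (Hq : forall t, 0 < t <= 1 / 2 ->
    reflection_defect t = digamma (t + 1) - digamma (1 - t + 1) + phi t + / (1 - t)).
  { intros t Ht. unfold reflection_defect, phi. rewrite !digamma_succ by lra. ring. }
  rewrite !Hq by auto.
  assert (D1 := digamma_lipschitz (x + 1) (y + 1) ltac:(lra) ltac:(lra)).
  assert (D2 := digamma_lipschitz (1 - y + 1) (1 - x + 1) ltac:(lra) ltac:(lra)).
  replace (x + 1 - (y + 1)) with (x - y) in D1 by ring.
  replace (1 - y + 1 - (1 - x + 1)) with (x - y) in D2 by ring.
  assert (D3 : Rabs (/ (1 - x) - / (1 - y)) <= 4 * Rabs (x - y)).
  { replace (/ (1 - x) - / (1 - y)) with ((/ (1 - x) * / (1 - y)) * (x - y)) by (field; lra).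
    rewrite Rabs_mult. apply Rmult_le_compat_r. apply Rabs_pos.
    assert (0 < / (1 - x)) by (apply Rinv_0_lt_compat; lra).
    assert (0 < / (1 - y)) by (apply Rinv_0_lt_compat; lra).
    assert (/ (1 - x) <= / (1 / 2)) by (apply Rinv_le_contravar; lra).
    assert (/ (1 - y) <= / (1 / 2)) by (apply Rinv_le_contravar; lra).
    rewrite Rabs_pos_eq by (apply Rmult_le_pos; lra).
    replace 4 with (/ (1 / 2) * / (1 / 2)) by field. apply Rmult_le_compat; lra. }
  assert (D4 := Hphi x y Hx Hy).
  match goal with |- Rabs ?e <= _ =>
    replace e with ((digamma (x + 1) - digamma (y + 1)) + (digamma (1 - y + 1) - digamma (1 - x + 1))
      + (phi x - phi y) + (/ (1 - x) - / (1 - y))) by ring end.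
  eapply Rle_trans; [apply Rabs_triang|].
  eapply Rle_trans; [apply Rplus_le_compat_r, Rabs_triang|].
  eapply Rle_trans; [apply Rplus_le_compat_r, Rplus_le_compat_r, Rabs_triang|].
  lra.
Qed.

(* By the halving relation a Lipschitz constant L may be replaced by L / 2. *)
Lemma reflection_defect_0 (x : R) : 0 < x <= 1 / 2 -> reflection_defect x = 0.
Proof.
  destruct reflection_defect_lipschitz as (L & HL & H).
  assert (Hn : forall n x y, 0 < x <= 1 / 2 -> 0 < y <= 1 / 2 ->
    Rabs (reflection_defect x - reflection_defect y) <= L * (/ 2) ^ n * Rabs (x - y)).
  { induction n as [|n IH]; intros u v Hu Hv.
    - simpl. rewrite Rmult_1_r. auto.
    - replace (reflection_defect u - reflection_defect v) with
        (/ 2 * ((reflection_defect (u / 2) - reflection_defect (v / 2))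
          + (reflection_defect ((1 - v) / 2) - reflection_defect ((1 - u) / 2)))).
      2:{ generalize (reflection_defect_halving u Hu) (reflection_defect_halving v Hv). lra. }
      rewrite Rabs_mult, Rabs_pos_eq by lra.
      assert (A := IH (u / 2) (v / 2) ltac:(lra) ltac:(lra)).
      assert (B := IH ((1 - v) / 2) ((1 - u) / 2) ltac:(lra) ltac:(lra)).
      replace (u / 2 - v / 2) with (/ 2 * (u - v)) in A by field.
      replace ((1 - v) / 2 - (1 - u) / 2) with (/ 2 * (u - v)) in B by field.
      rewrite Rabs_mult, (Rabs_pos_eq (/ 2)) in A, B by lra.
      simpl pow.
      eapply Rle_trans; [apply Rmult_le_compat_l; [lra|apply Rabs_triang]|]. lra. }
  assert (H2 : reflection_defect (1 / 2) = 0).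
  { unfold reflection_defect. replace (1 - 1 / 2) with (1 / 2) by field.
    replace (PI * (1 / 2)) with (PI / 2) by field. rewrite cos_PI2, sin_PI2. field. }
  intros Hx. cut (reflection_defect x - reflection_defect (1 / 2) = 0). rewrite H2; lra.
  apply Rabs_eq_0, Rle_antisym; [|apply Rabs_pos].
  assert (Lim : is_lim_seq (fun n => L * (/ 2) ^ n * Rabs (x - 1 / 2)) 0).
  { replace (Finite 0) with (Rbar_mult (L * 0) (Rabs (x - 1 / 2))) by (simpl; f_equal; ring).
    apply is_lim_seq_scal_r. simpl.
    apply (is_lim_seq_scal_l (fun n => (/ 2) ^ n) L 0).
    apply is_lim_seq_geom. rewrite Rabs_pos_eq; lra. }
  apply (is_lim_seq_le (fun _ => Rabs (reflection_defect x - reflection_defect (1 / 2)))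
    (fun n => L * (/ 2) ^ n * Rabs (x - 1 / 2))
    (Rabs (reflection_defect x - reflection_defect (1 / 2))) 0); auto.
  - intros n. apply Hn; lra.
  - apply is_lim_seq_const.
Qed.

Lemma ln_sinc_bound (s : R) : 0 < s <= 1 -> Rabs (ln (sin s / s)) <= s.
Proof.
  intros Hs.
  assert (HP := PI2_1).
  assert (H1 := sin_lower_cubic s ltac:(lra)).
  assert (H2 : sin s < s) by (apply sin_lt_x; lra).
  assert (H0 : 0 < sin s) by (apply sin_gt_0; lra).
  assert (Hq : 0 < sin s / s) by (apply Rdiv_lt_0_compat; lra).
  assert (sin s / s <= 1).
  { apply Rmult_le_reg_r with s. lra. unfold Rdiv. rewrite Rmult_assoc, Rinv_l; lra. }
  generalize (ln_le_sub1 _ Hq) (ln_ge_1_sub_inv _ Hq). intros L1 L2.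
  apply Rabs_le. split; [|lra].
  eapply Rle_trans; [|exact L2].
  replace (/ (sin s / s)) with (s / sin s) by (field; lra).
  cut (s / sin s <= 1 + s). lra.
  apply Rmult_le_reg_r with (sin s). lra.
  unfold Rdiv. rewrite Rmult_assoc, Rinv_l by lra.
  nra.
Qed.

(** The derivative of the left-hand side is the reflection defect, so it is constant, and it tends
    to 0 with x since Gamma 1 = 1 and sin s / s tends to 1. Using x + 1 in place of x keeps every
    term regular at 0. *)
Lemma lnGamma_reflection (x : R) :
  0 < x <= 1 / 2 ->
  lnGamma (x + 1) + lnGamma (1 - x) + ln (sin (PI * x) / (PI * x)) = 0.
Proof.
  set (g := fun t => lnGamma (t + 1) + lnGamma (1 - t) + ln (sin (PI * t) / (PI * t))).
  assert (HP := PI_RGT_0).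
  assert (Hd : forall t, 0 < t <= 1 / 2 -> is_derive g t 0).
  { intros t Ht. assert (0 < sin (PI * t)) by (apply sin_PI_pos; lra).
    assert (0 < PI * t) by nra.
    eapply is_derive_value.
    - apply (is_derive_plus (V := R_NormedModule)).
      + apply (is_derive_plus (V := R_NormedModule)).
        * apply (is_derive_comp (V := R_NormedModule) lnGamma (fun t => t + 1)).
          apply is_derive_lnGamma; lra. auto_derive; [auto | reflexivity].
        * apply (is_derive_comp (V := R_NormedModule) lnGamma (fun t => 1 - t)).
          apply is_derive_lnGamma; lra. auto_derive; [auto | reflexivity].
      + instantiate (1 := PI * (cos (PI * t) / sin (PI * t)) - / t).
        auto_derive. split; [nra|]. split; [|auto].
        apply Rmult_lt_0_compat; auto. now apply Rinv_0_lt_compat.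
        Rfield. lra.
    - unfold plus, scal; simpl; unfold mult; simpl.
      generalize (reflection_defect_0 t Ht). unfold reflection_defect.
      rewrite digamma_succ by lra. lra. }
  assert (Hc : forall s t, 0 < s <= t -> t <= 1 / 2 -> g s = g t).
  { intros s t Hs Ht. apply Rle_antisym.
    - apply (nondecreasing_of_derive g (fun _ => 0)); intros; try lra. apply Hd; lra.
    - cut (- g s <= - g t). lra.
      apply (nondecreasing_of_derive (fun t => - g t) (fun _ => 0)); intros; try lra.
      eapply is_derive_value. apply (is_derive_opp (V := R_NormedModule)), Hd; lra.
      unfold opp; simpl; ring. }
  intros Hx. change (g x = 0).
  apply Rabs_eq_0, Rle_antisym; [|apply Rabs_pos].
  assert (L1 : lnGamma 1 = 0) by (unfold lnGamma; rewrite EulerGamma_1; apply ln_1).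
  destruct (small_o_of_is_derive _ _ _ (is_derive_lnGamma 1 Rlt_0_1) 1 Rlt_0_1) as (d & Hd0 & Hs).
  rewrite L1 in Hs.
  set (K := 2 * (1 + Rabs (digamma 1)) + PI).
  assert (HK : 0 < K) by (unfold K; generalize (Rabs_pos (digamma 1)); lra).
  apply Rle_of_vanishing_error with (c := 0). intros n. rewrite Rmult_0_l, !Rplus_0_r.
  apply le_epsilon. intros eps He. rewrite Rplus_0_l.
  (* The four constraints: constancy between h and x, the linear estimate of [lnGamma] near 1, the
     range PI h <= 1 of [ln_sinc_bound], and smallness of the total K h. *)
  set (h := Rmin (Rmin x (d / 2)) (Rmin (/ PI) (eps / K))).
  assert (0 < / PI) by now apply Rinv_0_lt_compat.
  assert (0 < eps / K) by now apply Rdiv_lt_0_compat.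
  assert (Hh : 0 < h) by (unfold h; repeat apply Rmin_pos; lra).
  assert (h <= x /\ h <= d / 2 /\ h <= / PI /\ h <= eps / K) as (A1 & A2 & A3 & A4).
  { unfold h. generalize (Rmin_l (Rmin x (d / 2)) (Rmin (/ PI) (eps / K)))
     (Rmin_r (Rmin x (d / 2)) (Rmin (/ PI) (eps / K))) (Rmin_l x (d / 2)) (Rmin_r x (d / 2))
     (Rmin_l (/ PI) (eps / K)) (Rmin_r (/ PI) (eps / K)). lra. }
  rewrite <- (Hc h x) by lra.
  assert (B0 : forall k, Rabs k = h -> Rabs (lnGamma (1 + k)) <= (1 + Rabs (digamma 1)) * h).
  { intros k Hk. assert (B := Hs k ltac:(lra)). rewrite Hk in B.
    replace (lnGamma (1 + k)) with ((lnGamma (1 + k) - 0 - k * digamma 1) + k * digamma 1) by ring.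
    eapply Rle_trans; [apply Rabs_triang|]. rewrite Rabs_mult, Hk. lra. }
  assert (B1 := B0 h (Rabs_pos_eq _ (Rlt_le _ _ Hh))).
  assert (B2 := B0 (- h) ltac:(rewrite Rabs_Ropp; apply Rabs_pos_eq; lra)).
  assert (B3 : Rabs (ln (sin (PI * h) / (PI * h))) <= PI * h).
  { apply ln_sinc_bound. split. nra.
    apply (Rmult_le_compat_l PI) in A3; [|lra]. rewrite Rinv_r in A3; lra. }
  unfold g. rewrite (Rplus_comm h 1).
  eapply Rle_trans; [apply Rabs_triang|].
  eapply Rle_trans; [apply Rplus_le_compat_r, Rabs_triang|].
  apply Rle_trans with (K * h). unfold Rminus, K. lra.
  apply (Rmult_le_compat_l K) in A4; [|lra].
  replace (K * (eps / K)) with eps in A4 by (field; lra). auto.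
Qed.

Lemma EulerGamma_reflection (x : R) :
  0 < x < 1 -> EulerGamma x * EulerGamma (1 - x) * sin (PI * x) = PI.
Proof.
  assert (HP := PI_RGT_0).
  assert (H : forall x, 0 < x <= 1 / 2 -> EulerGamma x * EulerGamma (1 - x) * sin (PI * x) = PI).
  { intros y Hy.
    assert (E := lnGamma_reflection y Hy).
    assert (0 < sin (PI * y)) by (apply sin_PI_pos; lra).
    assert (0 < EulerGamma (y + 1)) by (apply EulerGamma_pos; lra).
    assert (0 < EulerGamma (1 - y)) by (apply EulerGamma_pos; lra).
    assert (0 < PI * y) by nra.
    unfold lnGamma in E. rewrite <- !ln_mult in E; auto.
    2: now apply Rmult_lt_0_compat. 2: now apply Rdiv_lt_0_compat.
    rewrite <- ln_1 in E. apply ln_inv in E; [| |lra].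
    2: { apply Rmult_lt_0_compat. now apply Rmult_lt_0_compat. now apply Rdiv_lt_0_compat. }
    rewrite EulerGamma_succ in E by lra.
    apply (Rmult_eq_compat_r PI) in E. rewrite Rmult_1_l in E. rewrite <- E at 2. field. lra. }
  intros Hx. destruct (Rle_dec x (1 / 2)). apply H; lra.
  assert (E := H (1 - x) ltac:(lra)).
  replace (1 - (1 - x)) with x in E by ring.
  replace (PI * (1 - x)) with (PI - PI * x) in E by ring.
  rewrite sin_PI_x in E. lra.
Qed.

(** * The reciprocal Gamma function *)

Lemma rising_succ_l (x : R) (n : nat) : rising x (S n) = x * rising (x + 1) n.
Proof.
  induction n as [|n IH]. simpl; ring.
  change (rising x (S (S n))) with (rising x (S n) * (x + INR (S n))).
  rewrite IH. simpl rising. rewrite S_INR. ring.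
Qed.

(** Any admissible shift may replace the least one: each further factor of [rising] cancels against
    the functional equation of Gamma. *)
Lemma rGamma_shift (x : R) (m : nat) :
  0 < x + INR m -> rGamma x = rising x m / EulerGamma (x + INR m).
Proof.
  intros Hm. unfold rGamma.
  destruct (archimed (- x)) as [U1 U2].
  set (n := Z.to_nat (up (- x))).
  assert (Hn : 0 < x + INR n).
  { unfold n. rewrite INR_IZR_INZ.
    assert (IZR (up (- x)) <= IZR (Z.of_nat (Z.to_nat (up (- x))))) by (apply IZR_le; lia). lra. }
  assert (Hnm : (n <= m)%nat).
  { unfold n. assert (up (- x) < Z.of_nat m + 1)%Z; [|lia].
    apply lt_IZR. rewrite plus_IZR, <- INR_IZR_INZ. lra. }
  clearbody n. clear U1 U2 Hm. induction Hnm as [|m Hnm IH]; auto.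
  apply le_INR in Hnm. rewrite IH. simpl rising. rewrite S_INR, <- Rplus_assoc, EulerGamma_succ by lra.
  assert (0 < EulerGamma (x + INR m)) by (apply EulerGamma_pos; lra).
  field. split; lra.
Qed.

Lemma rGamma_of_pos (x : R) : 0 < x -> rGamma x = / EulerGamma x.
Proof.
  intros Hx. rewrite (rGamma_shift x 0) by (simpl; lra). simpl. rewrite Rplus_0_r.
  unfold Rdiv. ring.
Qed.

Lemma rGamma_pos (x : R) : 0 < x -> 0 < rGamma x.
Proof. intros. rewrite rGamma_of_pos by auto. apply Rinv_0_lt_compat. now apply EulerGamma_pos. Qed.

Lemma rGamma_succ (x : R) : rGamma x = x * rGamma (x + 1).
Proof.
  destruct (INR_unbounded (- x)) as [m Hm].
  rewrite (rGamma_shift x (S m)) by (rewrite S_INR; lra).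
  rewrite (rGamma_shift (x + 1) m) by lra.
  rewrite rising_succ_l, S_INR.
  replace (x + (INR m + 1)) with (x + 1 + INR m) by ring. unfold Rdiv. ring.
Qed.

Lemma rGamma_0 : rGamma 0 = 0.
Proof. rewrite rGamma_succ. ring. Qed.

Lemma rGamma_nonpos_int (n : nat) : rGamma (- INR n) = 0.
Proof.
  induction n as [|n IH]. simpl. rewrite Ropp_0. apply rGamma_0.
  rewrite rGamma_succ, S_INR. replace (- (INR n + 1) + 1) with (- INR n) by ring.
  rewrite IH. ring.
Qed.

Lemma ex_derive_rGamma (x : R) : ex_derive rGamma x.
Proof.
  (* The extra 1 makes one shift m valid on a whole unit neighbourhood of x. *)
  destruct (INR_unbounded (- x + 1)) as [m Hm].
  apply (ex_derive_ext_loc (fun y => rising y m * exp (- lnGamma (y + INR m)))).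
  - exists (mkposreal 1 Rlt_0_1). intros y Hy. simpl in Hy.
    unfold_ball Hy.
    apply Rabs_def2 in Hy.
    rewrite (rGamma_shift y m) by lra. unfold Rdiv. f_equal.
    unfold lnGamma. rewrite exp_Ropp, exp_ln. auto. apply EulerGamma_pos. lra.
  - apply (ex_derive_mult (fun y => rising y m)).
    + clear Hm. induction m as [|m IH]; simpl. apply ex_derive_const.
      apply (ex_derive_mult (fun y => rising y m)); auto. auto_derive. auto.
    + apply (ex_derive_comp exp (fun y => - lnGamma (y + INR m))).
      eexists; apply is_derive_exp.
      apply (ex_derive_opp (V := R_NormedModule)).
      apply (ex_derive_comp lnGamma (fun y => y + INR m)).
      eexists; apply is_derive_lnGamma; lra. auto_derive. auto.
Qed.

Lemma is_derive_rGamma (x : R) : is_derive rGamma x (Derive rGamma x).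
Proof. apply Derive_correct, ex_derive_rGamma. Qed.

Lemma Derive_rGamma_of_pos (x : R) : 0 < x -> Derive rGamma x = - digamma x * rGamma x.
Proof.
  intros Hx. apply is_derive_unique.
  apply (is_derive_ext_loc (fun y => exp (- lnGamma y))).
  - exists (mkposreal x Hx). intros y Hy. simpl in Hy.
    unfold_ball Hy.
    apply Rabs_def2 in Hy.
    rewrite rGamma_of_pos by lra.
    unfold lnGamma. rewrite exp_Ropp, exp_ln. auto. apply EulerGamma_pos. lra.
  - eapply is_derive_value.
    + apply (is_derive_comp (V := R_NormedModule) exp (fun y => - lnGamma y)).
      apply is_derive_exp. apply (is_derive_opp (V := R_NormedModule)). now apply is_derive_lnGamma.
    + unfold scal, opp; simpl; unfold mult; simpl.
      rewrite rGamma_of_pos by lra. unfold lnGamma. rewrite exp_Ropp, exp_ln. auto.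
      now apply EulerGamma_pos.
Qed.

Lemma Derive_rGamma_succ (x : R) :
  Derive rGamma x = rGamma (x + 1) + x * Derive rGamma (x + 1).
Proof.
  apply is_derive_unique.
  apply (is_derive_ext (fun y => y * rGamma (y + 1))).
  intros; symmetry; apply rGamma_succ.
  eapply is_derive_value.
  - apply (Derive.is_derive_mult (fun y => y) (fun y => rGamma (y + 1))).
    apply (is_derive_id (K := R_AbsRing)).
    apply (is_derive_comp (V := R_NormedModule) rGamma (fun y => y + 1)).
    apply is_derive_rGamma. auto_derive; [auto | reflexivity].
  - unfold one, scal; simpl; unfold mult; simpl. ring.
Qed.

(** A convex function vanishing at 1 and 2 is nonnegative from 2 on. *)
Lemma EulerGamma_ge_1 (y : R) : 2 <= y -> 1 <= EulerGamma y.
Proof.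
  intros Hy.
  assert (L1 : lnGamma 1 = 0) by (unfold lnGamma; rewrite EulerGamma_1; apply ln_1).
  assert (L2 : lnGamma 2 = 0).
  { replace 2 with (1 + 1) by ring. rewrite lnGamma_succ, L1, ln_1; lra. }
  assert (G := lnGamma_three_points 1 2 y ltac:(lra) ltac:(lra) ltac:(lra)).
  rewrite L1, L2 in G. assert (0 <= lnGamma y) by lra.
  rewrite <- exp_0. rewrite <- (exp_ln (EulerGamma y)) by (apply EulerGamma_pos; lra).
  destruct H as [H|H]. left; now apply exp_increasing.
  right. unfold lnGamma in H. now rewrite <- H.
Qed.

(** The polynomial is (y + 2 / y) * y (y + 1), the product that bounds the derivative of 1/Gamma
    below. *)
Lemma cubic_le_exp (y : R) : 0 <= y -> y ^ 3 + y ^ 2 + 2 * y + 2 <= 6 * exp y.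
Proof.
  intros Hy. generalize (exp_ge_taylor y 3 Hy). unfold sum_f_R0. simpl. nra.
Qed.

Lemma rGamma_le_quadratic (y : R) : 0 < y -> rGamma y <= y * (y + 1).
Proof.
  intros Hy. rewrite (rGamma_shift y 2) by (simpl; lra).
  simpl. replace (y + (1 + 1)) with (y + 2) by ring.
  assert (1 <= EulerGamma (y + 2)) by (apply EulerGamma_ge_1; lra).
  assert (/ EulerGamma (y + 2) <= 1) by (rewrite <- Rinv_1; apply Rinv_le_contravar; lra).
  unfold Rdiv. replace (y * (y + 1)) with (1 * (y + 0) * (y + 1) * 1) by ring.
  apply Rmult_le_compat_l; auto. nra.
Qed.

(** The factor y (y + 1) absorbs the pole of digamma at 0, so the bound holds on the whole
    half-line; after division by k! exponential growth in k is harmless. *)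
Lemma rGamma_bounds (y : R) :
  0 < y -> Rabs (rGamma y) <= 6 * exp y /\ Rabs (Derive rGamma y) <= 6 * exp y.
Proof.
  intros Hy. assert (H := rGamma_le_quadratic y Hy). assert (H0 := rGamma_pos y Hy).
  assert (E := cubic_le_exp y ltac:(lra)).
  split. rewrite Rabs_pos_eq; nra.
  rewrite Derive_rGamma_of_pos by auto. rewrite Rabs_mult, Rabs_Ropp, (Rabs_pos_eq (rGamma y)) by lra.
  assert (Hi : 0 < / y) by now apply Rinv_0_lt_compat.
  assert (Rabs (digamma y) <= y + 2 * / y).
  { generalize (digamma_le_ln y Hy) (digamma_ge_ln y Hy) (ln_le_sub1 y Hy) (ln_le_sub1 (/ y) Hi).
    rewrite ln_Rinv by auto. intros. apply Rabs_le.
    assert (- / y <= ln y) by lra.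
    lra. }
  apply Rle_trans with ((y + 2 * / y) * (y * (y + 1))).
  - apply Rmult_le_compat; try lra. apply Rabs_pos.
  - replace ((y + 2 * / y) * (y * (y + 1))) with (y ^ 3 + y ^ 2 + 2 * y + 2) by (field; lra). auto.
Qed.

Lemma integer_periodic_induction (P : R -> Prop) :
  (forall x, P x <-> P (x + 1)) -> (forall x, 0 <= x < 1 -> P x) -> forall x, P x.
Proof.
  intros Hs H0 x.
  assert (Hz : forall k x, P x <-> P (x + IZR k)).
  { intros k. induction k as [|k IH|k IH] using Z.peano_ind; intros y.
    - rewrite Rplus_0_r. tauto.
    - rewrite succ_IZR, <- Rplus_assoc, <- Hs. apply IH.
    - rewrite IH, (Hs (y + IZR (Z.pred k))), Rplus_assoc, <- succ_IZR, Z.succ_pred. tauto. }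
  apply (Hz (- Int_part x)%Z). rewrite opp_IZR. apply H0.
  destruct (base_Int_part x). lra.
Qed.

(** Both sides change sign under x -> x + 1, which reduces the claim to [0, 1) and Euler's formula.
    This pole-free form is the one that the constant term of the Wronskian of I_mu and I_{-mu}
    produces. *)
Lemma rGamma_reflection (x : R) : PI * x * rGamma (x + 1) * rGamma (- x + 1) = sin (PI * x).
Proof.
  revert x. apply integer_periodic_induction.
  - intros x.
    replace (- (x + 1) + 1) with (- x) by ring.
    replace (PI * (x + 1)) with (PI * x + PI) by ring.
    rewrite neg_sin, (rGamma_succ (- x)), (rGamma_succ (x + 1)).
    split; intros; lra.
  - intros x Hx. destruct (Req_dec x 0) as [->|Hn].
    + rewrite Rmult_0_r, sin_0. ring.
    + assert (E := EulerGamma_reflection x ltac:(lra)).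
      assert (0 < EulerGamma x) by (apply EulerGamma_pos; lra).
      assert (0 < EulerGamma (1 - x)) by (apply EulerGamma_pos; lra).
      rewrite !rGamma_of_pos by lra.
      replace (- x + 1) with (1 - x) by ring.
      rewrite EulerGamma_succ by lra.
      replace (PI * x * / (x * EulerGamma x) * / EulerGamma (1 - x))
        with (PI * (/ EulerGamma x * / EulerGamma (1 - x))) by (field; lra).
      replace (sin (PI * x)) with ((EulerGamma x * EulerGamma (1 - x) * sin (PI * x)) * (/ EulerGamma x * / EulerGamma (1 - x)))
        by (field; lra).
      now rewrite E.
Qed.

(** * Termwise differentiation of series *)

Lemma ex_series_le_Rabs (a b : nat -> R) :
  (forall n, Rabs (a n) <= b n) -> ex_series b -> ex_series a.
Proof. apply (ex_series_le (V := R_CompleteNormedModule)). Qed.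

Lemma ex_series_Rmult_l (x : R) (a : nat -> R) : ex_series a -> ex_series (fun k => x * a k).
Proof. intros H. exact (ex_series_scal_l x a H). Qed.

Lemma series_tail_small (M : nat -> R) :
  ex_series M -> forall eps, 0 < eps ->
  exists N, Rabs (Series (fun k => M (S N + k)%nat)) < eps.
Proof.
  intros HM eps He.
  assert (H : is_lim_seq (sum_n M) (Series M)) by exact (Series_correct M HM).
  apply is_lim_seq_spec in H.
  destruct (H (mkposreal eps He)) as [N HN]. exists N.
  specialize (HN N (le_n _)). simpl in HN. rewrite sum_n_Reals in HN.
  rewrite (Series_incr_n M (S N)) in HN by (auto; lia). simpl pred in HN.
  rewrite <- Rabs_Ropp.
  replace (- Series (fun k => M (S N + k)%nat)) with
    (sum_f_R0 M N - (sum_f_R0 M N + Series (fun k => M (S N + k)%nat))) by ring. auto.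
Qed.

(** A Weierstrass test with summable Lipschitz constants at one point. These also bound the [l k];
    the finite head is differentiable, and the tail of the error is at most 2 |h| times the tail of
    [M]. *)
Lemma is_derive_Series_lipschitz (f : nat -> R -> R) (x : R) (l M : nat -> R) (d : R) :
  0 < d ->
  (forall k, is_derive (f k) x (l k)) ->
  (forall k h, Rabs h < d -> Rabs (f k (x + h) - f k x) <= M k * Rabs h) ->
  ex_series M -> ex_series (fun k => f k x) ->
  is_derive (fun y => Series (fun k => f k y)) x (Series l).
Proof.
  intros Hd Hf HL HM Hx.
  assert (Hl : forall k, Rabs (l k) <= M k).
  { intros k. apply le_epsilon. intros e He.
    destruct (small_o_of_is_derive _ _ _ (Hf k) e He) as (dk & Hdk & Hk).
    set (h := Rmin d dk / 2).
    assert (0 < Rmin d dk) by (apply Rmin_pos; auto).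
    assert (Hh : Rabs h = h) by (apply Rabs_pos_eq; unfold h; lra).
    assert (Rabs h < d) by (rewrite Hh; unfold h; generalize (Rmin_l d dk); lra).
    assert (Rabs h < dk) by (rewrite Hh; unfold h; generalize (Rmin_r d dk); lra).
    specialize (Hk h H1). specialize (HL k h H0).
    apply Rmult_le_reg_l with (Rabs h). rewrite Hh; unfold h; lra.
    rewrite <- Rabs_mult.
    replace (h * l k) with ((f k (x + h) - f k x) - (f k (x + h) - f k x - h * l k)) by ring.
    eapply Rle_trans; [apply Rabs_triang|]. rewrite Rabs_Ropp. lra. }
  assert (El : ex_series l) by (eapply ex_series_le_Rabs; eauto).
  apply is_derive_of_small_o. intros eps He.
  destruct (series_tail_small M HM (eps / 4)) as [N HN]. lra.
  assert (Hs : is_derive (fun y => sum_n (fun k => f k y) N) x (sum_n l N)).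
  { apply (is_derive_sum_n (V := R_NormedModule)). auto. }
  destruct (small_o_of_is_derive _ _ _ Hs (eps / 2)) as (d' & Hd' & Hh'). lra.
  exists (Rmin d d'). split. now apply Rmin_pos.
  intros h Hh.
  assert (H1 : Rabs h < d) by (generalize (Rmin_l d d'); lra).
  assert (H2 : Rabs h < d') by (generalize (Rmin_r d d'); lra).
  specialize (Hh' h H2). rewrite !sum_n_Reals in Hh'.
  set (e := fun k => f k (x + h) - f k x - h * l k).
  assert (He1 : forall k, Rabs (e k) <= 2 * Rabs h * M k).
  { intros k. unfold e. eapply Rle_trans; [apply Rabs_triang|].
    rewrite Rabs_Ropp, Rabs_mult. specialize (HL k h H1). specialize (Hl k).
    assert (0 <= Rabs h) by apply Rabs_pos. nra. }
  assert (Ed : ex_series (fun k => f k (x + h) - f k x)).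
  { apply (ex_series_le_Rabs _ (fun k => Rabs h * M k)). intros k. rewrite Rmult_comm. now apply HL.
    now apply ex_series_Rmult_l. }
  assert (Exh : ex_series (fun k => f k (x + h))).
  { eapply (ex_series_ext (fun k => plus (f k (x + h) - f k x) (f k x))).
    intros k. unfold plus; simpl. ring. now apply (ex_series_plus (V := R_NormedModule)). }
  assert (Ee : ex_series e).
  { apply (ex_series_le_Rabs _ (fun k => 2 * Rabs h * M k)); auto.
    now apply ex_series_Rmult_l. }
  replace (Series (fun k => f k (x + h)) - Series (fun k => f k x) - h * Series l)
    with (Series e).
  2:{ unfold e. rewrite Series_minus, Series_minus, Series_scal_l; auto.
      now apply ex_series_Rmult_l. }
  rewrite (Series_incr_n e (S N)) by (auto; lia). simpl pred.
  eapply Rle_trans; [apply Rabs_triang|].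
  replace (eps * Rabs h) with (eps / 2 * Rabs h + 2 * Rabs h * (eps / 4)) by field.
  apply Rplus_le_compat.
  - replace (sum_f_R0 e N) with
      (sum_f_R0 (fun k => f k (x + h)) N - sum_f_R0 (fun k => f k x) N - h * sum_f_R0 l N); auto.
    clear. induction N as [|N IH]; simpl; unfold e in *. ring. rewrite <- IH. ring.
  - assert (HMt : ex_series (fun k => M (S N + k)%nat)) by now apply (ex_series_incr_n M (S N)).
    eapply Rle_trans; [apply Series_Rabs|].
    + apply (ex_series_le_Rabs _ (fun k => 2 * Rabs h * M (S N + k)%nat)).
      intros k. rewrite Rabs_Rabsolu. apply He1.
      now apply ex_series_Rmult_l.
    + apply Rle_trans with (Series (fun k => 2 * Rabs h * M (S N + k)%nat)).
      * apply Series_le. intros k. split. apply Rabs_pos. apply He1.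
        now apply ex_series_Rmult_l.
      * rewrite Series_scal_l. apply Rmult_le_compat_l.
        generalize (Rabs_pos h); lra.
        generalize (Rle_abs (Series (fun k => M (S N + k)%nat))). lra.
Qed.

(** Finitely many terms are exempt from the common radius and majorant, being covered by their own
    differentiability. For negative orders the bounds on 1/Gamma hold only once the argument mu + k
    + 1 is positive. *)
Lemma is_derive_Series (f : nat -> R -> R) (x : R) (l M : nat -> R) (d : R) (K : nat) :
  0 < d ->
  (forall k, is_derive (f k) x (l k)) ->
  (forall k h, (K <= k)%nat -> Rabs h < d -> Rabs (f k (x + h) - f k x) <= M k * Rabs h) ->
  ex_series M -> ex_series (fun k => f k x) ->
  is_derive (fun y => Series (fun k => f k y)) x (Series l).
Proof.
  revert d M. induction K as [|K IH]; intros d M Hd Hf HL HM Hx.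
  - apply (is_derive_Series_lipschitz f x l M d); auto. intros; apply HL; auto; lia.
  - destruct (small_o_of_is_derive _ _ _ (Hf K) 1 Rlt_0_1) as (d' & Hd' & Hh').
    set (M' := fun k => if Nat.eq_dec k K then 1 + Rabs (l K) else M k).
    apply (IH (Rmin d d') M'); auto.
    + now apply Rmin_pos.
    + intros k h Hk Hh. unfold M'. destruct (Nat.eq_dec k K) as [->|Hn].
      * assert (H2 : Rabs h < d') by (generalize (Rmin_r d d'); lra).
        specialize (Hh' h H2).
        replace (f K (x + h) - f K x) with ((f K (x + h) - f K x - h * l K) + h * l K) by ring.
        eapply Rle_trans; [apply Rabs_triang|]. rewrite Rabs_mult. lra.
      * apply HL. lia. generalize (Rmin_l d d'); lra.
    + apply (ex_series_incr_n _ (S K)). apply (ex_series_incr_n _ (S K)) in HM.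
      eapply ex_series_ext; [|exact HM]. intros k. unfold M'.
      destruct (Nat.eq_dec (S K + k) K); [lia|auto].
Qed.

(** * Complex-valued functions of a real variable *)

(** The real parameter may be a path parameter or the order of a Bessel function. Quantifying over
    all curves inside a function replaces holomorphy. *)
Definition is_Cderive (f : R -> C) (s : R) (l : C) : Prop :=
  is_derive (fun t => Re (f t)) s (Re l) /\ is_derive (fun t => Im (f t)) s (Im l).

Lemma Cderive_value (f : R -> C) (s : R) (l l' : C) : is_Cderive f s l -> l = l' -> is_Cderive f s l'.
Proof. now intros H <-. Qed.

Lemma Cderive_ext_loc (f g : R -> C) (s : R) (l : C) :
  locally s (fun t => f t = g t) -> is_Cderive f s l -> is_Cderive g s l.
Proof.
  intros H [H1 H2]; split; [eapply is_derive_ext_loc; [|exact H1]|eapply is_derive_ext_loc; [|exact H2]];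
  eapply filter_imp; [|exact H| |exact H]; simpl; intros t ->; auto.
Qed.

Lemma Cderive_ext (f g : R -> C) (s : R) (l : C) :
  (forall t, f t = g t) -> is_Cderive f s l -> is_Cderive g s l.
Proof. intros H. apply Cderive_ext_loc. now apply filter_forall. Qed.

Lemma Cderive_const (c : C) (s : R) : is_Cderive (fun _ => c) s 0.
Proof. split; apply (is_derive_const (V := R_NormedModule)). Qed.

Lemma Cderive_plus (f g : R -> C) (s : R) (l m : C) :
  is_Cderive f s l -> is_Cderive g s m -> is_Cderive (fun t => (f t + g t)%C) s (l + m)%C.
Proof. intros [F1 F2] [G1 G2]; split; now apply (is_derive_plus (V := R_NormedModule)). Qed.

Lemma Cderive_opp (f : R -> C) (s : R) (l : C) :
  is_Cderive f s l -> is_Cderive (fun t => (- f t)%C) s (- l)%C.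
Proof. intros [F1 F2]; split; now apply (is_derive_opp (V := R_NormedModule)). Qed.

Lemma Cderive_minus (f g : R -> C) (s : R) (l m : C) :
  is_Cderive f s l -> is_Cderive g s m -> is_Cderive (fun t => (f t - g t)%C) s (l - m)%C.
Proof. intros F G. apply Cderive_plus; auto. now apply Cderive_opp. Qed.

Lemma Cderive_mult (f g : R -> C) (s : R) (l m : C) :
  is_Cderive f s l -> is_Cderive g s m -> is_Cderive (fun t => (f t * g t)%C) s (l * g s + f s * m)%C.
Proof.
  intros [F1 F2] [G1 G2]; split; simpl.
  - eapply is_derive_value.
    + apply (is_derive_minus (V := R_NormedModule));
        [exact (Derive.is_derive_mult _ _ _ _ _ F1 G1) | exact (Derive.is_derive_mult _ _ _ _ _ F2 G2)].
    + unfold minus, plus, opp; simpl. unfold Re, Im; ring.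
  - eapply is_derive_value.
    + apply (is_derive_plus (V := R_NormedModule));
        [exact (Derive.is_derive_mult _ _ _ _ _ F1 G2) | exact (Derive.is_derive_mult _ _ _ _ _ F2 G1)].
    + unfold plus; simpl. unfold Re, Im; ring.
Qed.

Lemma Cderive_scal (c : C) (f : R -> C) (s : R) (l : C) :
  is_Cderive f s l -> is_Cderive (fun t => (c * f t)%C) s (c * l)%C.
Proof.
  intros F. eapply Cderive_value. apply (Cderive_mult (fun _ => c) f); [apply Cderive_const|exact F]. ring.
Qed.

Lemma Cderive_RtoC (f : R -> R) (s l : R) : is_derive f s l -> is_Cderive (fun t => RtoC (f t)) s (RtoC l).
Proof. intros F; split; [exact F|exact (is_derive_const (V := R_NormedModule) 0 s)]. Qed.

Lemma Cderive_Cpow (f : R -> C) (s : R) (l : C) (n : nat) :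
  is_Cderive f s l -> is_Cderive (fun t => (f t ^ n)%C) s (INR n * (f s ^ pred n) * l)%C.
Proof.
  intros F. induction n as [|n IH].
  - apply (Cderive_value _ _ 0); [exact (Cderive_const 1 s)|]. simpl. ring.
  - eapply Cderive_value. apply (Cderive_mult f (fun t => (f t ^ n)%C)); eauto.
    rewrite S_INR, RtoC_plus. destruct n; simpl; ring.
Qed.

Definition cexp (z : C) : C := (exp (Re z) * cos (Im z), exp (Re z) * sin (Im z)).

Lemma cexp_plus (a b : C) : cexp (a + b) = (cexp a * cexp b)%C.
Proof.
  destruct a, b. unfold cexp, Cmult, Re, Im; simpl.
  rewrite exp_plus, cos_plus, sin_plus. f_equal; ring.
Qed.

Lemma cexp_RtoC (x : R) : cexp x = exp x.
Proof. unfold cexp, RtoC; simpl. now rewrite cos_0, sin_0, Rmult_1_r, Rmult_0_r. Qed.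

Lemma Cmod_cexp (z : C) : Cmod (cexp z) = exp (Re z).
Proof.
  unfold Cmod, cexp; simpl.
  replace (exp (Re z) * cos (Im z) * (exp (Re z) * cos (Im z) * 1) + exp (Re z) * sin (Im z) * (exp (Re z) * sin (Im z) * 1))
    with (Rsqr (exp (Re z)) * (Rsqr (sin (Im z)) + Rsqr (cos (Im z)))) by (unfold Rsqr; ring).
  rewrite sin2_cos2, Rmult_1_r. apply sqrt_Rsqr. left; apply exp_pos.
Qed.

Lemma cexp_nz (z : C) : cexp z <> 0.
Proof.
  intros H. apply (f_equal Cmod) in H. rewrite Cmod_cexp, Cmod_0 in H.
  generalize (exp_pos (Re z)); lra.
Qed.

Lemma Cderive_cexp (f : R -> C) (s : R) (l : C) :
  is_Cderive f s l -> is_Cderive (fun t => cexp (f t)) s (l * cexp (f s))%C.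
Proof.
  intros [F1 F2].
  assert (E : is_derive (fun t => exp (Re (f t))) s (Re l * exp (Re (f s)))).
  { exact (is_derive_comp (V := R_NormedModule) exp _ s _ _ (is_derive_exp _) F1). }
  split; simpl.
  - eapply is_derive_value.
    + exact (Derive.is_derive_mult _ _ _ _ _ E
        (is_derive_comp (V := R_NormedModule) cos _ s _ _ (is_derive_cos _) F2)).
    + unfold scal; simpl; unfold mult; simpl. unfold Re, Im; ring.
  - eapply is_derive_value.
    + exact (Derive.is_derive_mult _ _ _ _ _ E
        (is_derive_comp (V := R_NormedModule) sin _ s _ _ (is_derive_sin _) F2)).
    + unfold scal; simpl; unfold mult; simpl. unfold Re, Im; ring.
Qed.

Lemma Cmod_le_abs (z : C) : Cmod z <= Rabs (Re z) + Rabs (Im z).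
Proof.
  assert (E : z = (RtoC (Re z) + Ci * RtoC (Im z))%C).
  { destruct z; unfold Cplus, Cmult, Ci, RtoC; simpl; f_equal; ring. }
  rewrite E at 1.
  eapply Rle_trans; [apply Cmod_triangle|]. rewrite Cmod_mult, Cmod_Ci, !Cmod_R. lra.
Qed.

Lemma im_le_Cmod (z : C) : Rabs (Im z) <= Cmod z.
Proof. eapply Rle_trans; [apply Rmax_r|apply Rmax_Cmod]. Qed.

Lemma Cderive_lipschitz (f : R -> C) (s : R) (l : C) :
  is_Cderive f s l -> exists L d, 0 <= L /\ 0 < d /\ forall h, Rabs h < d -> Cmod (f (s + h) - f s) <= L * Rabs h.
Proof.
  intros [F1 F2].
  destruct (small_o_of_is_derive _ _ _ F1 1 Rlt_0_1) as (d1 & Hd1 & H1).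
  destruct (small_o_of_is_derive _ _ _ F2 1 Rlt_0_1) as (d2 & Hd2 & H2).
  exists (2 + Rabs (Re l) + Rabs (Im l)), (Rmin d1 d2).
  split. generalize (Rabs_pos (Re l)) (Rabs_pos (Im l)); lra.
  split. now apply Rmin_pos.
  intros h Hh. specialize (H1 h ltac:(generalize (Rmin_l d1 d2); lra)).
  specialize (H2 h ltac:(generalize (Rmin_r d1 d2); lra)).
  eapply Rle_trans; [apply Cmod_le_abs|]. simpl.
  assert (T : forall a b c, Rabs (a - b - h * c) <= 1 * Rabs h -> Rabs (a - b) <= (1 + Rabs c) * Rabs h).
  { intros a b c Hc. replace (a - b) with ((a - b - h * c) + h * c) by ring.
    eapply Rle_trans; [apply Rabs_triang|]. rewrite Rabs_mult. lra. }
  apply T in H1. apply T in H2. unfold Re, Im, Rminus in *. lra.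
Qed.

(** * Entire power series with real coefficients *)

Definition Phi (c : nat -> R) (w : C) : C := CSeries (fun k => (w ^ k * RtoC (c k))%C).

(** Infinite radius of convergence, stated absolutely so that it passes through termwise
    comparison. *)
Definition rapid (c : nat -> R) : Prop :=
  forall r, 0 <= r -> ex_series (fun k => Rabs (c k) * r ^ k).

Lemma CSeries_ext (a b : nat -> C) : (forall k, a k = b k) -> CSeries a = CSeries b.
Proof. intros H. unfold CSeries. f_equal; apply Series_ext; intros k; now rewrite H. Qed.

Lemma Phi_ext (c d : nat -> R) (w : C) : (forall k, c k = d k) -> Phi c w = Phi d w.
Proof. intros H. apply CSeries_ext. intros k. now rewrite H. Qed.

Lemma rapid_Cmod (c : nat -> R) (w : C) :
  rapid c -> ex_series (fun k => Cmod (w ^ k * RtoC (c k))).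
Proof.
  intros H. eapply ex_series_ext; [|apply (H (Cmod w) (Cmod_ge_0 w))].
  intros k. rewrite Cmod_mult, Cmod_pow, Cmod_R. apply Rmult_comm.
Qed.

Lemma rapid_Re (c : nat -> R) (w : C) : rapid c -> ex_series (fun k => Re (w ^ k * RtoC (c k))).
Proof. intros H. eapply ex_series_le_Rabs; [|apply (rapid_Cmod c w H)]. intros; apply re_le_Cmod. Qed.

Lemma rapid_Im (c : nat -> R) (w : C) : rapid c -> ex_series (fun k => Im (w ^ k * RtoC (c k))).
Proof. intros H. eapply ex_series_le_Rabs; [|apply (rapid_Cmod c w H)]. intros; apply im_le_Cmod. Qed.

Lemma Phi_plus (c d : nat -> R) (w : C) :
  rapid c -> rapid d -> Phi (fun k => c k + d k) w = (Phi c w + Phi d w)%C.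
Proof.
  intros Hc Hd. unfold Phi, CSeries, Cplus. cbn [fst snd]. f_equal.
  - rewrite <- Series_plus by now apply rapid_Re.
    apply Series_ext. intros k. unfold Re; simpl. ring.
  - rewrite <- Series_plus by now apply rapid_Im.
    apply Series_ext. intros k. unfold Im; simpl. ring.
Qed.

Lemma Phi_scal (x : R) (c : nat -> R) (w : C) :
  Phi (fun k => x * c k) w = (x * Phi c w)%C.
Proof.
  unfold Phi, CSeries, Cmult at 3, RtoC. cbn [fst snd].
  rewrite !Rmult_0_l, Rminus_0_r, Rplus_0_r, <- !Series_scal_l.
  f_equal; apply Series_ext; intros k; unfold Re, Im; simpl; ring.
Qed.

(** On power series in w these three operations are multiplication by w, w d/dw and d/dw. *)
Definition coef_shift (c : nat -> R) (k : nat) : R := match k with O => 0 | S j => c j end.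
Definition euler (c : nat -> R) (k : nat) : R := INR k * c k.
Definition pderiv (c : nat -> R) (k : nat) : R := INR (S k) * c (S k).

Lemma CSeries_scal (z : C) (a : nat -> C) :
  ex_series (fun k => Re (a k)) -> ex_series (fun k => Im (a k)) ->
  CSeries (fun k => (z * a k)%C) = (z * CSeries a)%C.
Proof.
  intros H1 H2. unfold CSeries. apply injective_projections; cbn [fst snd Cmult].
  - rewrite <- !Series_scal_l, <- Series_minus by now apply ex_series_Rmult_l.
    now apply Series_ext.
  - rewrite <- !Series_scal_l, <- Series_plus by now apply ex_series_Rmult_l.
    now apply Series_ext.
Qed.

Lemma CSeries_incr_1_aux (a : nat -> C) :
  a O = 0 -> CSeries a = CSeries (fun k => a (S k)).
Proof.
  intros H. unfold CSeries. f_equal; apply Series_incr_1_aux; now rewrite H.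
Qed.

Lemma Phi_coef_shift (c : nat -> R) (w : C) : rapid c -> Phi (coef_shift c) w = (w * Phi c w)%C.
Proof.
  intros Hc. unfold Phi. rewrite CSeries_incr_1_aux by (simpl; ring).
  rewrite <- CSeries_scal by (try apply rapid_Re; try apply rapid_Im; auto).
  apply CSeries_ext. intros k. simpl. ring.
Qed.

Lemma nat_le_pow2 (k : nat) : INR k <= 2 ^ k.
Proof.
  induction k as [|k IH]. simpl; lra. rewrite S_INR. simpl.
  assert (1 <= 2 ^ k) by (apply pow_R1_Rle; lra). lra.
Qed.

Lemma rapid_le (c d : nat -> R) : (forall k, Rabs (c k) <= Rabs (d k)) -> rapid d -> rapid c.
Proof.
  intros H Hd r Hr. eapply ex_series_le_Rabs; [|apply (Hd r Hr)].
  intros k. rewrite Rabs_mult, Rabs_Rabsolu, (Rabs_pos_eq (r ^ k)) by now apply pow_le.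
  apply Rmult_le_compat_r; auto. now apply pow_le.
Qed.

Lemma rapid_geom (c : nat -> R) (q : R) : 0 <= q -> rapid c -> rapid (fun k => q ^ k * c k).
Proof.
  intros Hq H r Hr. eapply ex_series_ext; [|apply (H (q * r)); now apply Rmult_le_pos].
  intros k. rewrite Rabs_mult, (Rabs_pos_eq (q ^ k)) by now apply pow_le.
  rewrite Rpow_mult_distr. Rring.
Qed.

Lemma rapid_euler (c : nat -> R) : rapid c -> rapid (euler c).
Proof.
  intros H. apply rapid_le with (fun k => 2 ^ k * c k); [|apply rapid_geom; auto; lra].
  intros k. unfold euler. rewrite !Rabs_mult. apply Rmult_le_compat_r. apply Rabs_pos.
  rewrite !Rabs_pos_eq. apply nat_le_pow2. apply pow_le; lra. apply pos_INR.
Qed.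

Lemma rapid_tail (c : nat -> R) : rapid c -> rapid (fun k => c (S k)).
Proof.
  intros H r Hr. 
  (* The larger radius gives (r + 1)^(k + 1) >= r^k for small r as well. *)
  assert (H1 := H (r + 1) ltac:(lra)). apply ex_series_incr_1 in H1.
  eapply ex_series_le_Rabs; [|exact H1].
  intros k. rewrite Rabs_mult, Rabs_Rabsolu, (Rabs_pos_eq (r ^ k)) by now apply pow_le.
  apply Rmult_le_compat_l. apply Rabs_pos.
  simpl. apply Rle_trans with ((r + 1) ^ k). apply pow_incr; lra.
  assert (0 <= (r + 1) ^ k) by (apply pow_le; lra). nra.
Qed.

Lemma Phi_incr (c : nat -> R) (w : C) :
  rapid c -> Phi c w = (c O + w * Phi (fun k => c (S k)) w)%C.
Proof.
  intros Hc. rewrite <- Phi_coef_shift by now apply rapid_tail.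
  unfold Phi, CSeries.
  rewrite (Series_incr_1 (fun k => Re (w ^ k * RtoC (c k)))) by now apply rapid_Re.
  rewrite (Series_incr_1 (fun k => Im (w ^ k * RtoC (c k)))) by now apply rapid_Im.
  rewrite (Series_incr_1_aux (fun k => Re (w ^ k * RtoC (coef_shift _ k)))) by (simpl; unfold Re, Im; simpl; ring).
  rewrite (Series_incr_1_aux (fun k => Im (w ^ k * RtoC (coef_shift _ k)))) by (simpl; unfold Re, Im; simpl; ring).
  unfold Cplus; simpl. f_equal; unfold Re, Im; simpl; ring.
Qed.

Lemma Phi_0 (c : nat -> R) : rapid c -> Phi c 0 = c O.
Proof. intros Hc. rewrite Phi_incr by auto. ring. Qed.

Lemma rapid_pderiv (c : nat -> R) : rapid c -> rapid (pderiv c).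
Proof. intros H. apply (rapid_tail (euler c)). now apply rapid_euler. Qed.

Lemma rapid_plus (c d : nat -> R) : rapid c -> rapid d -> rapid (fun k => c k + d k).
Proof.
  intros Hc Hd r Hr.
  apply (ex_series_le_Rabs _ (fun k => plus (Rabs (c k) * r ^ k) (Rabs (d k) * r ^ k))).
  - intros k. rewrite Rabs_mult, Rabs_Rabsolu, (Rabs_pos_eq (r ^ k)) by now apply pow_le.
    unfold plus; simpl. rewrite <- Rmult_plus_distr_r.
    apply Rmult_le_compat_r. now apply pow_le. apply Rabs_triang.
  - apply (ex_series_plus (V := R_NormedModule)); auto.
Qed.

Lemma rapid_scal (x : R) (c : nat -> R) : rapid c -> rapid (fun k => x * c k).
Proof.
  intros Hc r Hr. eapply ex_series_ext; [|apply (ex_series_Rmult_l (Rabs x) _ (Hc r Hr))].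
  intros k. simpl. rewrite Rabs_mult. symmetry. apply Rmult_assoc.
Qed.

Lemma rapid_coef_shift (c : nat -> R) : rapid c -> rapid (coef_shift c).
Proof.
  intros Hc r Hr. apply ex_series_incr_1.
  eapply ex_series_ext; [|apply (ex_series_Rmult_l r _ (Hc r Hr))].
  intros k. unfold scal; simpl; unfold mult; simpl. Rring.
Qed.

Lemma rapid_of_bound (c : nat -> R) (B q : R) (K : nat) :
  0 <= q -> (forall k, (K <= k)%nat -> Rabs (c k) <= B * (q ^ k / INR (fact k))) -> rapid c.
Proof.
  intros Hq H r Hr.
  assert (E : ex_series (fun k => B * ((q * r) ^ k / INR (fact k)))).
  { apply (ex_series_Rmult_l B).
    exists (exp (q * r)).
    eapply is_series_ext; [|exact (is_exp_Reals (q * r))].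
    intros k. simpl. rewrite pow_n_pow. unfold scal; simpl; unfold mult; simpl. reflexivity. }
  apply (ex_series_incr_n _ K). apply (ex_series_incr_n _ K) in E.
  eapply ex_series_le_Rabs; [|exact E].
  intros k. rewrite Rabs_mult, Rabs_Rabsolu, (Rabs_pos_eq (r ^ _)) by now apply pow_le.
  eapply Rle_trans. apply Rmult_le_compat_r. now apply pow_le. apply H. lia.
  right. rewrite Rpow_mult_distr. unfold Rdiv. ring.
Qed.

Lemma Cpow_diff_bound (a b : C) (r : R) (k : nat) :
  1 <= r -> Cmod a <= r -> Cmod b <= r ->
  Cmod (a ^ k - b ^ k) <= INR k * r ^ k * Cmod (a - b).
Proof.
  intros Hr Ha Hb. induction k as [|k IH].
  - simpl. replace (1 - 1)%C with (RtoC 0) by ring. rewrite Cmod_0. lra.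
  - replace (a ^ S k - b ^ S k)%C with (a * (a ^ k - b ^ k) + (a - b) * b ^ k)%C by (simpl; ring).
    eapply Rle_trans; [apply Cmod_triangle|]. rewrite !Cmod_mult, Cmod_pow, S_INR. simpl pow.
    assert (0 <= Cmod (a - b)) by apply Cmod_ge_0.
    assert (0 <= Cmod a) by apply Cmod_ge_0.
    assert (0 <= Cmod (a ^ k - b ^ k)) by apply Cmod_ge_0.
    assert (Cmod b ^ k <= r ^ k) by (apply pow_incr; split; auto; apply Cmod_ge_0).
    assert (1 <= r ^ k) by (apply pow_R1_Rle; auto).
    assert (Cmod a * Cmod (a ^ k - b ^ k) <= r * (INR k * r ^ k * Cmod (a - b)))
      by (apply Rmult_le_compat; auto).
    assert (Cmod (a - b) * Cmod b ^ k <= Cmod (a - b) * (r * r ^ k)).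
    { apply Rmult_le_compat_l; auto. nra. }
    lra.
Qed.

Lemma Cderive_Phi (c : nat -> R) (w : R -> C) (s : R) (d : C) :
  rapid c -> is_Cderive w s d -> is_Cderive (fun t => Phi c (w t)) s (d * Phi (pderiv c) (w s))%C.
Proof.
  intros Hc Hw.
  destruct (Cderive_lipschitz w s d Hw) as (L & e & HL & He & Hlip).
  (* [r] bounds |w| on the neighbourhood |h| < 1 and is at least 1, as [Cpow_diff_bound] requires.
     The factor k of the difference of k-th powers goes into 2^k, hence the radius 2 r in [M]. *)
  set (r := 1 + Cmod (w s) + L).
  assert (Hws := Cmod_ge_0 (w s)).
  assert (Hr : 1 <= r) by (unfold r; lra).
  set (M := fun k => L * (Rabs (c k) * (2 * r) ^ k)).
  assert (HM : ex_series M).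
  { apply (ex_series_Rmult_l L). apply Hc. lra. }
  assert (Hk : forall k h, Rabs h < Rmin e 1 ->
     Cmod (w (s + h)%R ^ k * RtoC (c k) - w s ^ k * RtoC (c k)) <= M k * Rabs h).
  { intros k h Hh.
    assert (Rabs h < e) by (generalize (Rmin_l e 1); lra).
    assert (Rabs h < 1) by (generalize (Rmin_r e 1); lra).
    specialize (Hlip h H).
    assert (Hb : Cmod (w (s + h)) <= r).
    { replace (w (s + h)) with (w s + (w (s + h)%R - w s))%C by ring.
      eapply Rle_trans; [apply Cmod_triangle|]. unfold r.
      assert (L * Rabs h <= L * 1) by (apply Rmult_le_compat_l; lra). lra. }
    replace (w (s + h)%R ^ k * RtoC (c k) - w s ^ k * RtoC (c k))%C
      with ((w (s + h)%R ^ k - w s ^ k) * RtoC (c k))%C by ring.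
    rewrite Cmod_mult, Cmod_R. unfold M.
    assert (B := Cpow_diff_bound (w (s + h)) (w s) r k Hr Hb ltac:(unfold r; lra)).
    assert (INR k * r ^ k <= (2 * r) ^ k).
    { rewrite Rpow_mult_distr. apply Rmult_le_compat_r. apply pow_le; lra. apply nat_le_pow2. }
    assert (INR k * r ^ k * Cmod (w (s + h)%R - w s) <= (2 * r) ^ k * (L * Rabs h)).
    { apply Rmult_le_compat; auto. apply Rmult_le_pos. apply pos_INR. apply pow_le; lra.
      apply Cmod_ge_0. }
    assert (0 <= Rabs (c k)) by apply Rabs_pos.
    assert (Cmod (w (s + h)%R ^ k - w s ^ k) * Rabs (c k) <= (2 * r) ^ k * (L * Rabs h) * Rabs (c k)).
    { apply Rmult_le_compat_r; lra. }
    lra. }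
  assert (Hd : forall k, is_Cderive (fun t => (w t ^ k * RtoC (c k))%C) s (RtoC (INR k * c k) * w s ^ pred k * d)%C).
  { intros k. eapply Cderive_value.
    apply (Cderive_mult (fun t => (w t ^ k)%C) (fun _ => RtoC (c k)));
      [apply Cderive_Cpow; exact Hw | apply Cderive_const].
    rewrite RtoC_mult. ring. }
  replace (d * Phi (pderiv c) (w s))%C with
    (CSeries (fun k => (RtoC (INR k * c k) * w s ^ pred k * d)%C)).
  - split; simpl.
    + apply (is_derive_Series_lipschitz (fun k t => Re (w t ^ k * RtoC (c k)))
        s (fun k => Re (RtoC (INR k * c k) * w s ^ pred k * d)) M (Rmin e 1)); auto.
      apply Rmin_pos; lra. intros k; apply Hd.
      intros k h Hh. eapply Rle_trans; [|apply Hk; auto].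
      eapply Rle_trans; [|apply re_le_Cmod]. right. f_equal. 
      now apply rapid_Re.
    + apply (is_derive_Series_lipschitz (fun k t => Im (w t ^ k * RtoC (c k)))
        s (fun k => Im (RtoC (INR k * c k) * w s ^ pred k * d)) M (Rmin e 1)); auto.
      apply Rmin_pos; lra. intros k; apply Hd.
      intros k h Hh. eapply Rle_trans; [|apply Hk; auto].
      eapply Rle_trans; [|apply im_le_Cmod]. right. f_equal. 
      now apply rapid_Im.
  - assert (Hp := rapid_pderiv c Hc).
    unfold Phi. rewrite <- CSeries_scal by (try apply rapid_Re; try apply rapid_Im; auto).
    rewrite CSeries_incr_1_aux by (simpl INR; rewrite Rmult_0_l; ring).
    apply CSeries_ext. intros k. unfold pderiv. simpl pred. ring.
Qed.

Lemma Phi_euler (c : nat -> R) (w : C) : rapid c -> Phi (euler c) w = (w * Phi (pderiv c) w)%C.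
Proof.
  intros Hc. rewrite <- Phi_coef_shift by now apply rapid_pderiv.
  apply Phi_ext. intros [|k]; unfold euler, pderiv; simpl; ring.
Qed.

Lemma Cderive_Phi_param (c : R -> nat -> R) (m : R) (l M : nat -> R) (K : nat) (w : C) :
  (forall k, is_derive (fun t => c t k) m (l k)) ->
  (forall k h, (K <= k)%nat -> Rabs h < 1 -> Rabs (c (m + h) k - c m k) <= M k * Rabs h) ->
  rapid M -> rapid (c m) ->
  is_Cderive (fun t => Phi (c t) w) m (Phi l w).
Proof.
  intros Hd HL HM Hc.
  assert (Ex : ex_series (fun k => Rabs (M k) * Cmod w ^ k)) by (apply HM, Cmod_ge_0).
  assert (B : forall (p : R) k h, (K <= k)%nat -> Rabs h < 1 -> Rabs p <= Cmod w ^ k ->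
     Rabs (p * c (m + h) k - p * c m k) <= (Rabs (M k) * Cmod w ^ k) * Rabs h).
  { intros p k h Hk Hh Hp. rewrite <- Rmult_minus_distr_l, Rabs_mult.
    specialize (HL k h Hk Hh).
    assert (M k * Rabs h <= Rabs (M k) * Rabs h).
    { apply Rmult_le_compat_r. apply Rabs_pos. apply Rle_abs. }
    apply Rle_trans with (Cmod w ^ k * (Rabs (M k) * Rabs h)); [|lra].
    apply Rmult_le_compat; auto using Rabs_pos. lra. }
  split; simpl.
  - apply (is_derive_Series (fun k t => Re (w ^ k * RtoC (c t k)))
      m (fun k => Re (w ^ k * RtoC (l k))) (fun k => Rabs (M k) * Cmod w ^ k) 1 K); auto.
    + lra.
    + intros k. apply (is_derive_ext (fun t => Re (w ^ k) * c t k)).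
      intros t; unfold Re; simpl; ring.
      eapply is_derive_value. apply is_derive_scal. apply Hd. unfold Re; simpl; ring.
    + intros k h Hk Hh.
      replace (Re (w ^ k * RtoC (c (m + h) k))) with (Re (w ^ k) * c (m + h) k) by (unfold Re; simpl; ring).
      replace (Re (w ^ k * RtoC (c m k))) with (Re (w ^ k) * c m k) by (unfold Re; simpl; ring).
      apply B; auto. rewrite <- Cmod_pow. apply re_le_Cmod.
    + now apply rapid_Re.
  - apply (is_derive_Series (fun k t => Im (w ^ k * RtoC (c t k)))
      m (fun k => Im (w ^ k * RtoC (l k))) (fun k => Rabs (M k) * Cmod w ^ k) 1 K); auto.
    + lra.
    + intros k. apply (is_derive_ext (fun t => Im (w ^ k) * c t k)).
      intros t; unfold Im; simpl; ring.
      eapply is_derive_value. apply is_derive_scal. apply Hd. unfold Im; simpl; ring.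
    + intros k h Hk Hh.
      replace (Im (w ^ k * RtoC (c (m + h) k))) with (Im (w ^ k) * c (m + h) k) by (unfold Im; simpl; ring).
      replace (Im (w ^ k * RtoC (c m k))) with (Im (w ^ k) * c m k) by (unfold Im; simpl; ring).
      apply B; auto. rewrite <- Cmod_pow. apply im_le_Cmod.
    + now apply rapid_Im.
Qed.

(** * Bessel functions in the variable [ln (z / 2)] *)

(* Functions of [zeta = ln (z / 2)]: [z] ranges over the whole Riemann surface of the logarithm,
   [theta] below is [d / dzeta = z d / dz], and [z / 2 = cexp zeta]. *)
Definition I_coef (mu : R) (k : nat) : R := rGamma (mu + INR k + 1) / INR (fact k).
Definition dI_coef (mu : R) (k : nat) : R := Derive rGamma (mu + INR k + 1) / INR (fact k).

(** With w = cexp (2 zeta), d/dzeta multiplies cexp (mu zeta) w^k by mu + 2 k. *)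
Definition theta (mu : R) (c : nat -> R) (k : nat) : R := mu * c k + 2 * euler c k.

(** A Frobenius series: (z/2)^mu times a power series in (z/2)^2. *)
Definition frob (c : nat -> R) (mu : R) (zeta : C) : C :=
  (cexp (mu * zeta) * Phi c (cexp (2 * zeta)))%C.

Lemma fact_pos (k : nat) : 0 < INR (fact k).
Proof. apply lt_0_INR, lt_O_fact. Qed.

Lemma rapid_of_exp_bound (g : R -> R) (mu : R) :
  (forall y, 0 < y -> Rabs (g y) <= 6 * exp y) ->
  rapid (fun k => g (mu + INR k + 1) / INR (fact k)).
Proof.
  intros Hg. destruct (INR_unbounded (- mu)) as [K HK].
  apply rapid_of_bound with (B := 6 * exp (mu + 1)) (q := exp 1) (K := K).
  left; apply exp_pos.
  intros k Hk. apply le_INR in Hk.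
  rewrite Rabs_div by (generalize (fact_pos k); lra).
  rewrite (Rabs_pos_eq (INR (fact k))) by (left; apply fact_pos).
  unfold Rdiv. rewrite <- Rmult_assoc. apply Rmult_le_compat_r.
  left; apply Rinv_0_lt_compat, fact_pos.
  eapply Rle_trans. apply Hg. lra.
  right. rewrite <- (Rpower_pow k (exp 1)) by apply exp_pos.
  unfold Rpower. rewrite ln_exp, Rmult_1_r, Rmult_assoc, <- exp_plus.
  do 2 f_equal. ring.
Qed.

Lemma rapid_I_coef (mu : R) : rapid (I_coef mu).
Proof. apply (rapid_of_exp_bound rGamma). intros y Hy. now apply rGamma_bounds. Qed.

Lemma rapid_dI_coef (mu : R) : rapid (dI_coef mu).
Proof. apply (rapid_of_exp_bound (Derive rGamma)). intros y Hy. now apply rGamma_bounds. Qed.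

Lemma rapid_theta (mu : R) (c : nat -> R) : rapid c -> rapid (theta mu c).
Proof.
  intros Hc. apply rapid_plus; apply rapid_scal; auto. now apply rapid_euler.
Qed.

Lemma Phi_theta (mu : R) (c : nat -> R) (w : C) :
  rapid c -> Phi (theta mu c) w = (mu * Phi c w + 2 * Phi (euler c) w)%C.
Proof.
  intros Hc. unfold theta.
  rewrite Phi_plus by (apply rapid_scal; auto; now apply rapid_euler).
  now rewrite !Phi_scal.
Qed.

Lemma Cderive_frob (c : nat -> R) (mu : R) (zeta : R -> C) (s : R) (d : C) :
  rapid c -> is_Cderive zeta s d ->
  is_Cderive (fun t => frob c mu (zeta t)) s (d * frob (theta mu c) mu (zeta s))%C.
Proof.
  intros Hc Hz. unfold frob. eapply Cderive_value.
  - apply (Cderive_mult (fun t => cexp (mu * zeta t)) (fun t => Phi c (cexp (2 * zeta t)))).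
    + apply (Cderive_cexp (fun t => (mu * zeta t)%C)). apply Cderive_scal, Hz.
    + apply (Cderive_Phi c (fun t => cexp (2 * zeta t))); auto.
      apply (Cderive_cexp (fun t => (2 * zeta t)%C)). apply Cderive_scal, Hz.
  - rewrite Phi_theta, Phi_euler by auto. ring.
Qed.

Lemma I_coef_rec (mu : R) (j : nat) :
  INR (S j) * (mu + INR (S j)) * I_coef mu (S j) = I_coef mu j.
Proof.
  unfold I_coef. rewrite fact_simpl, mult_INR.
  rewrite (rGamma_succ (mu + INR j + 1)), S_INR.
  replace (mu + (INR j + 1) + 1) with (mu + INR j + 1 + 1) by ring.
  generalize (fact_pos j) (pos_INR j). intros. field. lra.
Qed.

(** The derivative in mu of [I_coef_rec]. *)
Lemma dI_coef_rec (mu : R) (j : nat) :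
  INR (S j) * (I_coef mu (S j) + (mu + INR (S j)) * dI_coef mu (S j)) = dI_coef mu j.
Proof.
  unfold I_coef, dI_coef. rewrite fact_simpl, mult_INR.
  rewrite (Derive_rGamma_succ (mu + INR j + 1)), S_INR.
  replace (mu + (INR j + 1) + 1) with (mu + INR j + 1 + 1) by ring.
  generalize (fact_pos j) (pos_INR j). intros. field. lra.
Qed.

(** Bessel's equation coefficient by coefficient, from (mu + 2 k)^2 = mu^2 + 4 k (mu + k); the
    shifted term carries 4 w = z^2. *)
Lemma theta_theta_I_coef (mu : R) (k : nat) :
  theta mu (theta mu (I_coef mu)) k = mu ^ 2 * I_coef mu k + 4 * coef_shift (I_coef mu) k.
Proof.
  destruct k as [|j]; unfold theta, euler; simpl coef_shift.
  - simpl. ring.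
  - rewrite <- (I_coef_rec mu j). ring.
Qed.

(** The recurrence leaves the remainder - 4 k I_coef, split here as 2 mu - 2 (mu + 2 k): the part -
    2 theta I cancels against the product rule for zeta I in D, and 2 mu I survives as the source
    term of the equation for D. *)
Lemma theta_theta_dI_coef (mu : R) (k : nat) :
  theta mu (theta mu (dI_coef mu)) k =
  (mu ^ 2 * dI_coef mu k + 4 * coef_shift (dI_coef mu) k)
  + (2 * mu * I_coef mu k + (- 2) * theta mu (I_coef mu) k).
Proof.
  destruct k as [|j]; unfold theta, euler; simpl coef_shift.
  - simpl. ring.
  - rewrite <- (dI_coef_rec mu j). ring.
Qed.

Lemma Phi_theta_theta_I_coef (mu : R) (w : C) :
  Phi (theta mu (theta mu (I_coef mu))) w = ((mu ^ 2 + 4 * w) * Phi (I_coef mu) w)%C.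
Proof.
  assert (H := rapid_I_coef mu).
  rewrite (Phi_ext _ _ w (theta_theta_I_coef mu)).
  rewrite Phi_plus by (apply rapid_scal; auto; now apply rapid_coef_shift).
  rewrite !Phi_scal, Phi_coef_shift, RtoC_pow by auto. ring.
Qed.

Definition fI (mu : R) (zeta : C) : C := frob (I_coef mu) mu zeta.
Definition fI' (mu : R) (zeta : C) : C := frob (theta mu (I_coef mu)) mu zeta.
(** The derivative of [fI] in the order; the term with the factor [zeta] comes from
    [cexp (mu * zeta)]. *)
Definition fD (mu : R) (zeta : C) : C := (zeta * fI mu zeta + frob (dI_coef mu) mu zeta)%C.
Definition fD' (mu : R) (zeta : C) : C :=
  (fI mu zeta + zeta * fI' mu zeta + frob (theta mu (dI_coef mu)) mu zeta)%C.

(** This is mu^2 + z^2; Bessel's equation reads theta^2 f = (mu^2 + z^2) f. *)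
Definition potential (mu : R) (zeta : C) : C := (mu ^ 2 + 4 * cexp (2 * zeta))%C.

Lemma Cderive_fI (mu : R) (zeta : R -> C) (s : R) (d : C) :
  is_Cderive zeta s d -> is_Cderive (fun t => fI mu (zeta t)) s (d * fI' mu (zeta s))%C.
Proof. intros Hz. exact (Cderive_frob _ mu zeta s d (rapid_I_coef mu) Hz). Qed.

Lemma Cderive_fI' (mu : R) (zeta : R -> C) (s : R) (d : C) :
  is_Cderive zeta s d ->
  is_Cderive (fun t => fI' mu (zeta t)) s (d * (potential mu (zeta s) * fI mu (zeta s)))%C.
Proof.
  intros Hz. eapply Cderive_value.
  - exact (Cderive_frob _ mu zeta s d (rapid_theta mu _ (rapid_I_coef mu)) Hz).
  - unfold frob. rewrite Phi_theta_theta_I_coef. unfold potential, fI, frob. ring.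
Qed.

Lemma Cderive_fD (mu : R) (zeta : R -> C) (s : R) (d : C) :
  is_Cderive zeta s d -> is_Cderive (fun t => fD mu (zeta t)) s (d * fD' mu (zeta s))%C.
Proof.
  intros Hz. eapply Cderive_value.
  - exact (Cderive_plus _ _ _ _ _ (Cderive_mult _ _ _ _ _ Hz (Cderive_fI mu zeta s d Hz))
      (Cderive_frob _ mu zeta s d (rapid_dI_coef mu) Hz)).
  - unfold fD'. ring.
Qed.

Lemma Cderive_fD' (mu : R) (zeta : R -> C) (s : R) (d : C) :
  is_Cderive zeta s d ->
  is_Cderive (fun t => fD' mu (zeta t)) s
    (d * (potential mu (zeta s) * fD mu (zeta s) + 2 * mu * fI mu (zeta s)))%C.
Proof.
  intros Hz. assert (H := rapid_I_coef mu). assert (H' := rapid_dI_coef mu).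
  eapply Cderive_value.
  - exact (Cderive_plus _ _ _ _ _ (Cderive_plus _ _ _ _ _ (Cderive_fI mu zeta s d Hz)
      (Cderive_mult _ _ _ _ _ Hz (Cderive_fI' mu zeta s d Hz)))
      (Cderive_frob _ mu zeta s d (rapid_theta mu _ (rapid_dI_coef mu)) Hz)).
  - unfold fD, frob at 1.
    rewrite (Phi_ext _ _ _ (theta_theta_dI_coef mu)).
    rewrite Phi_plus, Phi_plus, Phi_plus, !Phi_scal, Phi_coef_shift;
      repeat first [assumption | apply rapid_plus | apply rapid_scal | apply rapid_coef_shift | apply rapid_euler].
    unfold potential, fI', fI, frob. rewrite !RtoC_mult, RtoC_pow. ring.
Qed.

(** * Differentiation with respect to the order *)

Lemma I_coef_lipschitz (mu : R) :
  exists M K, rapid M /\ forall k h, (K <= k)%nat -> Rabs h < 1 ->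
    Rabs (I_coef (mu + h) k - I_coef mu k) <= M k * Rabs h.
Proof.
  destruct (INR_unbounded (- mu)) as [K HK].
  (* Past [K] the argument of [rGamma] stays positive for all |h| < 1, so [rGamma_bounds] applies;
     [exp 1] pays for moving the argument by less than 1. *)
  exists (fun k => 6 * exp 1 * (exp (mu + INR k + 1) / INR (fact k))), K. split.
  - apply rapid_scal. apply (rapid_of_exp_bound exp).
    intros y Hy. assert (0 < exp y) by apply exp_pos. rewrite Rabs_pos_eq; lra.
  - intros k h Hk Hh. apply le_INR in Hk. unfold I_coef.
    replace (rGamma (mu + h + INR k + 1) / INR (fact k) - rGamma (mu + INR k + 1) / INR (fact k))
      with ((rGamma (mu + h + INR k + 1) - rGamma (mu + INR k + 1)) / INR (fact k))
      by (generalize (fact_pos k); intros; field; lra).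
    rewrite Rabs_div by (generalize (fact_pos k); lra).
    rewrite (Rabs_pos_eq (INR (fact k))) by (left; apply fact_pos).
    assert (B : Rabs (rGamma (mu + h + INR k + 1) - rGamma (mu + INR k + 1))
       <= 6 * exp 1 * exp (mu + INR k + 1) * Rabs h).
    { replace (Rabs h) with (Rabs (mu + h + INR k + 1 - (mu + INR k + 1))) by (f_equal; ring).
      apply (bounded_variation rGamma (Derive rGamma)).
      replace (mu + h + INR k + 1 - (mu + INR k + 1)) with h by ring.
      intros t Ht. split. apply is_derive_rGamma.
      assert (Hlt : Rabs (t - (mu + INR k + 1)) < 1) by lra. apply Rabs_def2 in Hlt.
      eapply Rle_trans; [apply rGamma_bounds; lra|].
      rewrite Rmult_assoc, <- exp_plus. apply Rmult_le_compat_l. lra.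
      left. apply exp_increasing. lra. }
    apply (Rmult_le_compat_r (/ INR (fact k))) in B.
    2: left; apply Rinv_0_lt_compat, fact_pos.
    unfold Rdiv. lra.
Qed.

Lemma is_derive_I_coef (mu : R) (k : nat) :
  is_derive (fun m => I_coef m k) mu (dI_coef mu k).
Proof.
  unfold I_coef, dI_coef, Rdiv.
  apply (is_derive_ext (fun m => / INR (fact k) * rGamma (m + INR k + 1))).
  intros t; apply Rmult_comm.
  eapply is_derive_value.
  - apply is_derive_scal.
    apply (is_derive_comp (V := R_NormedModule) rGamma (fun m => m + INR k + 1)).
    apply is_derive_rGamma. auto_derive; [auto | reflexivity].
  - unfold scal; simpl; unfold mult; simpl. ring.
Qed.

Lemma Cderive_Phi_I_coef (mu : R) (w : C) :
  is_Cderive (fun m => Phi (I_coef m) w) mu (Phi (dI_coef mu) w).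
Proof.
  destruct (I_coef_lipschitz mu) as (M & K & HM & HL).
  apply (Cderive_Phi_param I_coef mu (dI_coef mu) M K); auto using is_derive_I_coef, rapid_I_coef.
Qed.

Lemma Cderive_Phi_euler_I_coef (mu : R) (w : C) :
  is_Cderive (fun m => Phi (euler (I_coef m)) w) mu (Phi (euler (dI_coef mu)) w).
Proof.
  destruct (I_coef_lipschitz mu) as (M & K & HM & HL).
  apply (Cderive_Phi_param (fun m => euler (I_coef m)) mu (euler (dI_coef mu)) (euler M) K).
  - intros k. unfold euler. apply is_derive_scal, is_derive_I_coef.
  - intros k h Hk Hh. unfold euler. rewrite <- Rmult_minus_distr_l, Rabs_mult.
    rewrite Rabs_pos_eq, Rmult_assoc by apply pos_INR.
    apply Rmult_le_compat_l. apply pos_INR. auto.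
  - now apply rapid_euler.
  - apply rapid_euler, rapid_I_coef.
Qed.

Lemma Cderive_cexp_order (mu : R) (zeta : C) :
  is_Cderive (fun m => cexp (RtoC m * zeta)) mu (zeta * cexp (mu * zeta))%C.
Proof.
  apply (Cderive_cexp (fun m => (RtoC m * zeta)%C)). eapply Cderive_value.
  - apply (Cderive_mult (fun m => RtoC m) (fun _ => zeta)).
    + apply Cderive_RtoC. apply (is_derive_id (K := R_AbsRing)).
    + apply Cderive_const.
  - unfold one; simpl. ring.
Qed.

Lemma Cderive_fI_order (mu : R) (zeta : C) : is_Cderive (fun m => fI m zeta) mu (fD mu zeta).
Proof.
  unfold fI, frob. eapply Cderive_value.
  - apply (Cderive_mult (fun m => cexp (RtoC m * zeta)) (fun m => Phi (I_coef m) (cexp (2 * zeta)))).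
    apply Cderive_cexp_order. apply Cderive_Phi_I_coef.
  - unfold fD, fI, frob. ring.
Qed.

Lemma Cderive_fI'_order (mu : R) (zeta : C) : is_Cderive (fun m => fI' m zeta) mu (fD' mu zeta).
Proof.
  apply (Cderive_ext (fun m => cexp (RtoC m * zeta) *
     (RtoC m * Phi (I_coef m) (cexp (2 * zeta)) + 2 * Phi (euler (I_coef m)) (cexp (2 * zeta))))%C).
  { intros m. unfold fI', frob. rewrite Phi_theta; auto. apply rapid_I_coef. }
  eapply Cderive_value.
  - apply (Cderive_mult (fun m => cexp (RtoC m * zeta))). apply Cderive_cexp_order.
    apply Cderive_plus.
    + apply (Cderive_mult (fun m => RtoC m)).
      * apply Cderive_RtoC. apply (is_derive_id (K := R_AbsRing)).
      * apply Cderive_Phi_I_coef.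
    + apply Cderive_scal, Cderive_Phi_euler_I_coef.
  - unfold fD', fI', fI, frob. rewrite !Phi_theta by (apply rapid_I_coef || apply rapid_dI_coef).
    unfold one; simpl. ring.
Qed.

(** * The Wronskian of I_mu and I_{-mu} *)

Lemma Cderive_zero_constant (f : R -> C) :
  (forall s, 0 < s -> is_Cderive f s 0) -> (exists l, is_Cderive f 0 l) -> f 1 = f 0.
Proof.
  intros H [l [L1 L2]].
  assert (A : forall g : R -> R, (forall s, 0 < s -> is_derive g s 0) ->
     continuity_pt g 0 -> g 1 = g 0).
  { intros g Hg Hc. destruct (MVT_gen g 0 1 (fun _ => 0)) as (c & _ & E).
    - intros x Hx. rewrite Rmin_left in Hx by lra. apply Hg. lra.
    - intros x Hx. rewrite Rmin_left in Hx by lra.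
      destruct (Req_dec x 0) as [->|]; auto.
      apply (is_derive_continuity_pt g x 0), Hg. lra.
    - lra. }
  apply injective_projections.
  - apply (A (fun t => Re (f t))). intros s Hs; apply (H s Hs).
    now apply (is_derive_continuity_pt _ _ _ L1).
  - apply (A (fun t => Im (f t))). intros s Hs; apply (H s Hs).
    now apply (is_derive_continuity_pt _ _ _ L2).
Qed.

Lemma cexp_opp_mult (z : C) : (cexp z * cexp (- z) = 1)%C.
Proof.
  rewrite <- cexp_plus. replace (z + - z)%C with (RtoC 0) by ring.
  rewrite cexp_RtoC, exp_0. reflexivity.
Qed.

(** The exponentials cancel and leave an entire function [H] of w = (z/2)^2. It is constant along
    the segment from 0 to [w0], and at 0 only the leading coefficients remain, evaluated by the
    reflection formula. *)
Lemma I_wronskian (mu : R) (zeta : C) :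
  (fI mu zeta * fI' (- mu) zeta - fI (- mu) zeta * fI' mu zeta)%C
  = RtoC (- (2 / PI) * sin (PI * mu)).
Proof.
  set (a := I_coef mu). set (b := I_coef (- mu)).
  set (Ta := theta mu a). set (Tb := theta (- mu) b).
  assert (Ha : rapid a) by apply rapid_I_coef.
  assert (Hb : rapid b) by apply rapid_I_coef.
  assert (HTa : rapid Ta) by now apply rapid_theta.
  assert (HTb : rapid Tb) by now apply rapid_theta.
  set (H := fun w => (Phi a w * Phi Tb w - Phi b w * Phi Ta w)%C).
  set (w0 := cexp (2 * zeta)).
  assert (E1 : (fI mu zeta * fI' (- mu) zeta - fI (- mu) zeta * fI' mu zeta)%C = H w0).
  { unfold fI, fI', frob, H. fold a b. fold Ta Tb. fold w0.
    assert (E := cexp_opp_mult (mu * zeta)).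
    replace (RtoC (- mu) * zeta)%C with (- (mu * zeta))%C by (rewrite RtoC_opp; ring).
    set (p := cexp (mu * zeta)) in *. set (q := cexp (- (mu * zeta))) in *.
    transitivity ((p * q) * (Phi a w0 * Phi Tb w0 - Phi b w0 * Phi Ta w0))%C. ring.
    rewrite E. ring. }
  assert (D : forall s, is_Cderive (fun t => H (RtoC t * w0)%C) s
     (w0 * (Phi (pderiv a) (s * w0) * Phi Tb (s * w0) + Phi a (s * w0) * Phi (pderiv Tb) (s * w0)
       - Phi (pderiv b) (s * w0) * Phi Ta (s * w0) - Phi b (s * w0) * Phi (pderiv Ta) (s * w0)))%C).
  { intros s.
    assert (Dw : is_Cderive (fun t => (RtoC t * w0)%C) s w0).
    { eapply Cderive_value.
      - apply (Cderive_mult (fun t => RtoC t) (fun _ => w0)).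
        apply Cderive_RtoC. apply (is_derive_id (K := R_AbsRing)). apply Cderive_const.
      - unfold one; simpl. ring. }
    unfold H. eapply Cderive_value.
    - exact (Cderive_minus _ _ _ _ _
        (Cderive_mult _ _ _ _ _ (Cderive_Phi a _ s _ Ha Dw) (Cderive_Phi Tb _ s _ HTb Dw))
        (Cderive_mult _ _ _ _ _ (Cderive_Phi b _ s _ Hb Dw) (Cderive_Phi Ta _ s _ HTa Dw))).
    - cbv beta. ring. }
  assert (Z : forall s, 0 < s -> is_Cderive (fun t => H (RtoC t * w0)%C) s 0).
  { intros s Hs. eapply Cderive_value. apply D.
    assert (Hs' : RtoC s <> 0) by (intros E; apply RtoC_inj in E; lra).
    set (w := (s * w0)%C).
    assert (Na := Phi_euler a w Ha). assert (Nb := Phi_euler b w Hb).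
    assert (NTa := Phi_euler Ta w HTa). assert (NTb := Phi_euler Tb w HTb).
    assert (Ea := Phi_theta mu a w Ha). assert (Eb := Phi_theta (- mu) b w Hb).
    assert (ETa := Phi_theta mu Ta w HTa). assert (ETb := Phi_theta (- mu) Tb w HTb).
    fold Ta in Ea. fold Tb in Eb.
    assert (OA := Phi_theta_theta_I_coef mu w). assert (OB := Phi_theta_theta_I_coef (- mu) w).
    fold a in OA. fold b in OB. fold Ta in OA. fold Tb in OB.
    rewrite OA in ETa. rewrite OB in ETb.
    rewrite Na in Ea. rewrite Nb in Eb. rewrite NTa in ETa. rewrite NTb in ETb.
    rewrite RtoC_opp in Eb, ETb, OB.
    set (X := (Phi (pderiv a) w * Phi Tb w + Phi a w * Phi (pderiv Tb) w
       - Phi (pderiv b) w * Phi Ta w - Phi b w * Phi (pderiv Ta) w)%C).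
    (* The series identities control 2 w d/dw, not d/dw; dividing by w removes the point s = 0,
       where [Cderive_zero_constant] asks only for differentiability. *)
    assert (EX : (2 * (s * (w0 * X)) = 0)%C).
    { replace (2 * (s * (w0 * X)))%C with (2 * (w * X))%C by (unfold w; ring).
      unfold X.
      transitivity ((2 * (w * Phi (pderiv a) w)) * Phi Tb w + Phi a w * (2 * (w * Phi (pderiv Tb) w))
        - (2 * (w * Phi (pderiv b) w)) * Phi Ta w - Phi b w * (2 * (w * Phi (pderiv Ta) w)))%C. ring.
      replace (2 * (w * Phi (pderiv a) w))%C with (Phi Ta w - mu * Phi a w)%C by (rewrite Ea; ring).
      replace (2 * (w * Phi (pderiv b) w))%C with (Phi Tb w + mu * Phi b w)%C by (rewrite Eb; ring).
      replace (2 * (w * Phi (pderiv Ta) w))%C with ((mu ^ 2 + 4 * w) * Phi a w - mu * Phi Ta w)%C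
        by (rewrite ETa; ring).
      replace (2 * (w * Phi (pderiv Tb) w))%C with ((mu ^ 2 + 4 * w) * Phi b w + mu * Phi Tb w)%C
        by (transitivity ((((- mu) ^ 2 + 4 * w) * Phi b w) + mu * Phi Tb w)%C; [ring|rewrite ETb; ring]).
      ring. }
    replace (w0 * X)%C with (/ (2 * s) * (2 * (s * (w0 * X))))%C.
    rewrite EX. ring. field. auto. }
  rewrite E1.
  assert (E2 : H w0 = H 0).
  { assert (E := Cderive_zero_constant _ Z (ex_intro _ _ (D 0))). simpl in E.
    replace (RtoC 1 * w0)%C with w0 in E by ring.
    replace (RtoC 0 * w0)%C with (RtoC 0) in E by ring. exact E. }
  rewrite E2. unfold H. rewrite !Phi_0 by auto.
  rewrite <- !RtoC_mult, <- RtoC_minus. f_equal.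
  unfold Ta, Tb, theta, euler, a, b, I_coef. simpl.
  rewrite !Rplus_0_r, !Rmult_0_l, !Rmult_0_r, !Rplus_0_r.
  rewrite <- rGamma_reflection. field. apply PI_neq0.
Qed.

(** With 2 cexp zeta = z this and the next lemma are the classical contiguous relations. They carry
    estimates from positive orders down to negative ones. *)
Lemma fI_order_pred (mu : R) (zeta : C) :
  (2 * cexp zeta * fI (mu - 1) zeta = fI' mu zeta + mu * fI mu zeta)%C.
Proof.
  assert (Ha := rapid_I_coef mu).
  unfold fI, fI', frob.
  replace (RtoC mu * zeta)%C with (RtoC (mu - 1) * zeta + zeta)%C by (rewrite RtoC_minus; ring).
  rewrite cexp_plus.
  assert (E : forall k, 2 * I_coef (mu - 1) k = theta mu (I_coef mu) k + mu * I_coef mu k).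
  { intros k. unfold theta, euler, I_coef.
    replace (mu - 1 + INR k + 1) with (mu + INR k) by ring.
    rewrite (rGamma_succ (mu + INR k)). unfold Rdiv. ring. }
  assert (F := Phi_ext _ _ (cexp (2 * zeta)) E).
  rewrite Phi_plus, !Phi_scal in F by auto using rapid_theta, rapid_scal.
  transitivity (cexp (RtoC (mu - 1) * zeta) * cexp zeta * (2 * Phi (I_coef (mu - 1)) (cexp (2 * zeta))))%C.
  ring. rewrite F. ring.
Qed.

Lemma fI'_order_pred (mu : R) (zeta : C) :
  (fI' (mu - 1) zeta = 2 * cexp zeta * fI mu zeta + RtoC (mu - 1) * fI (mu - 1) zeta)%C.
Proof.
  assert (Ha := rapid_I_coef mu). assert (Hb := rapid_I_coef (mu - 1)).
  unfold fI, fI', frob. rewrite Phi_theta by auto.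
  assert (E : forall k, euler (I_coef (mu - 1)) k = coef_shift (I_coef mu) k).
  { intros [|k]; unfold euler, coef_shift, I_coef. simpl; ring.
    rewrite fact_simpl, mult_INR, !S_INR.
    replace (mu - 1 + (INR k + 1) + 1) with (mu + INR k + 1) by ring.
    generalize (fact_pos k) (pos_INR k). intros. field. lra. }
  rewrite (Phi_ext _ _ _ E), Phi_coef_shift by auto.
  replace (RtoC mu * zeta)%C with (RtoC (mu - 1) * zeta + zeta)%C by (rewrite RtoC_minus; ring).
  replace (cexp (2 * zeta)) with (cexp zeta * cexp zeta)%C
    by (rewrite <- cexp_plus; f_equal; ring).
  rewrite cexp_plus. ring.
Qed.

(** * Behaviour near the origin *)

Lemma Phi_bound (c : nat -> R) :
  rapid c -> exists A, 0 <= A /\ forall w, Cmod w <= 1 -> Cmod (Phi c w) <= A.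
Proof.
  intros Hc.
  assert (H1 : ex_series (fun k => Rabs (c k))).
  { eapply ex_series_ext; [|apply (Hc 1); lra]. intros k. simpl. rewrite pow1. Rring. }
  set (A := Series (fun k => Rabs (c k))).
  assert (B : forall p : nat -> R, (forall k, Rabs (p k) <= Rabs (c k)) -> Rabs (Series p) <= A).
  { intros p Hp. eapply Rle_trans; [apply Series_Rabs|].
    - apply (ex_series_le_Rabs _ (fun k => Rabs (c k))); auto.
      intros k. now rewrite Rabs_Rabsolu.
    - apply Series_le; auto. intros k. split; auto. apply Rabs_pos. }
  exists (2 * A). split.
  - assert (0 <= A); [|lra]. eapply Rle_trans; [apply (Rabs_pos (Series c))|]. apply B. intros; lra.
  - intros w Hw.
    assert (T : forall k, Cmod (w ^ k * RtoC (c k)) <= Rabs (c k)).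
    { intros k. rewrite Cmod_mult, Cmod_pow, Cmod_R.
      assert (Cmod w ^ k <= 1 ^ k) by (apply pow_incr; split; auto; apply Cmod_ge_0).
      rewrite pow1 in H. generalize (Rabs_pos (c k)). nra. }
    eapply Rle_trans; [apply Cmod_le_abs|].
    replace (2 * A) with (A + A) by ring. apply Rplus_le_compat; apply B; intros k;
      (eapply Rle_trans; [|apply T]). apply re_le_Cmod. apply im_le_Cmod.
Qed.

Lemma frob_bound (c : nat -> R) (mu : R) :
  rapid c -> exists A, 0 <= A /\ forall zeta, Re zeta <= 0 -> Cmod (frob c mu zeta) <= A * exp (mu * Re zeta).
Proof.
  intros Hc. destruct (Phi_bound c Hc) as (A & HA & H). exists A. split; auto.
  intros zeta Hz. unfold frob. rewrite Cmod_mult, Cmod_cexp.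
  replace (Re (mu * zeta)) with (mu * Re zeta) by (unfold Re; simpl; ring).
  rewrite Rmult_comm. apply Rmult_le_compat_r. left; apply exp_pos.
  apply H. rewrite Cmod_cexp, <- exp_0.
  replace (Re (2 * zeta)) with (2 * Re zeta) by (unfold Re; simpl; ring).
  destruct (Req_dec (Re zeta) 0) as [->|]. rewrite Rmult_0_r; lra.
  left; apply exp_increasing; lra.
Qed.

Definition wronskian_ID (nu : R) (zeta : C) : C :=
  (fI nu zeta * fD' nu zeta - fD nu zeta * fI' nu zeta)%C.

Lemma Cderive_wronskian_ID (nu : R) (zeta : R -> C) (s : R) (d : C) :
  is_Cderive zeta s d ->
  is_Cderive (fun t => wronskian_ID nu (zeta t)) s (d * (2 * nu * (fI nu (zeta s) * fI nu (zeta s))))%C.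
Proof.
  intros Hz. eapply Cderive_value.
  - exact (Cderive_minus _ _ _ _ _
      (Cderive_mult _ _ _ _ _ (Cderive_fI nu zeta s d Hz) (Cderive_fD' nu zeta s d Hz))
      (Cderive_mult _ _ _ _ _ (Cderive_fD nu zeta s d Hz) (Cderive_fI' nu zeta s d Hz))).
  - cbv beta. ring.
Qed.

(** The terms with the logarithmic factor [zeta] cancel in the Wronskian, so the bound is a pure
    power of |z| and uniform in the argument. *)
Lemma wronskian_ID_bound (nu : R) :
  exists A, 0 <= A /\
    forall zeta, Re zeta <= 0 -> Cmod (wronskian_ID nu zeta) <= A * exp (2 * nu * Re zeta).
Proof.
  destruct (frob_bound _ nu (rapid_I_coef nu)) as (A1 & P1 & H1).
  destruct (frob_bound _ nu (rapid_theta nu _ (rapid_I_coef nu))) as (A2 & P2 & H2).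
  destruct (frob_bound _ nu (rapid_dI_coef nu)) as (A3 & P3 & H3).
  destruct (frob_bound _ nu (rapid_theta nu _ (rapid_dI_coef nu))) as (A4 & P4 & H4).
  exists (A1 * A1 + A1 * A4 + A3 * A2). split.
  { assert (0 <= A1 * A1) by now apply Rmult_le_pos.
    assert (0 <= A1 * A4) by now apply Rmult_le_pos.
    assert (0 <= A3 * A2) by now apply Rmult_le_pos. lra. }
  intros zeta Hz. specialize (H1 zeta Hz). specialize (H2 zeta Hz).
  specialize (H3 zeta Hz). specialize (H4 zeta Hz).
  unfold wronskian_ID, fD, fD'. fold (fI nu zeta) in H1. fold (fI' nu zeta) in H2.
  set (p := frob (dI_coef nu) nu zeta) in *. set (q := frob (theta nu (dI_coef nu)) nu zeta) in *.
  replace (fI nu zeta * (fI nu zeta + zeta * fI' nu zeta + q) - (zeta * fI nu zeta + p) * fI' nu zeta)%C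
    with (fI nu zeta * fI nu zeta + fI nu zeta * q + - (p * fI' nu zeta))%C by ring.
  eapply Rle_trans; [apply Cmod_triangle|]. rewrite Cmod_opp.
  eapply Rle_trans; [apply Rplus_le_compat_r, Cmod_triangle|]. rewrite !Cmod_mult.
  replace (2 * nu * Re zeta) with (nu * Re zeta + nu * Re zeta) by ring. rewrite exp_plus.
  set (e := exp (nu * Re zeta)) in *.
  assert (Cmod (fI nu zeta) * Cmod (fI nu zeta) <= (A1 * e) * (A1 * e))
    by (apply Rmult_le_compat; auto using Cmod_ge_0).
  assert (Cmod (fI nu zeta) * Cmod q <= (A1 * e) * (A4 * e))
    by (apply Rmult_le_compat; auto using Cmod_ge_0).
  assert (Cmod p * Cmod (fI' nu zeta) <= (A3 * e) * (A2 * e))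
    by (apply Rmult_le_compat; auto using Cmod_ge_0).
  lra.
Qed.

(** * The real axis *)

Lemma rapid_ex_series (c : nat -> R) (x : R) : 0 <= x -> rapid c -> ex_series (fun k => c k * x ^ k).
Proof.
  intros Hx Hc. apply (ex_series_le_Rabs _ _) with (2 := Hc x Hx).
  intros k. rewrite Rabs_mult, (Rabs_pos_eq (x ^ k)). lra. now apply pow_le.
Qed.

Lemma Phi_real (c : nat -> R) (x : R) : Phi c (RtoC x) = RtoC (PSeries c x).
Proof.
  unfold Phi, CSeries, PSeries.
  assert (E : forall k, (RtoC x ^ k * RtoC (c k))%C = RtoC (c k * x ^ k)).
  { intros k. now rewrite <- RtoC_pow, <- RtoC_mult, Rmult_comm. }
  apply injective_projections.
  - apply Series_ext. intros k. now rewrite E.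
  - change (Series (fun k => Im (RtoC x ^ k * RtoC (c k))) = 0).
    rewrite (Series_ext _ (fun k => 0 * 0)), Series_scal_l. ring.
    intros k. rewrite E. simpl. ring.
Qed.

Lemma PSeries_ge_0 (c : nat -> R) (x : R) :
  0 <= x -> rapid c -> (forall k, 0 <= c k) -> 0 <= PSeries c x.
Proof.
  intros Hx Hc Hp. unfold PSeries.
  rewrite <- (Rmult_0_l (Series (fun k => c k * x ^ k))), <- Series_scal_l.
  apply Series_le; [|now apply rapid_ex_series].
  intros k. rewrite Rmult_0_l. split. lra. apply Rmult_le_pos; auto. now apply pow_le.
Qed.

Lemma PSeries_gt_0 (c : nat -> R) (x : R) :
  0 <= x -> rapid c -> (forall k, 0 < c k) -> 0 < PSeries c x.
Proof.
  intros Hx Hc Hp. unfold PSeries. rewrite Series_incr_1 by now apply rapid_ex_series.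
  assert (E := Series_scal_l x (fun k => c (S k) * x ^ k)).
  rewrite (Series_ext _ (fun k => c (S k) * x ^ S k)) in E by (intros; simpl; ring).
  rewrite E. simpl.
  assert (0 <= PSeries (fun k => c (S k)) x).
  { apply PSeries_ge_0; auto. now apply rapid_tail. intros; left; auto. }
  unfold PSeries in H. specialize (Hp O). nra.
Qed.

Definition rfrob (c : nat -> R) (mu u : R) : R := exp (mu * u) * PSeries c (exp (2 * u)).

Lemma frob_real (c : nat -> R) (mu u : R) : frob c mu (RtoC u) = RtoC (rfrob c mu u).
Proof.
  unfold frob, rfrob. rewrite <- !RtoC_mult, !cexp_RtoC, Phi_real. now rewrite RtoC_mult.
Qed.

Lemma rfrob_plus (c d : nat -> R) (mu u : R) :
  rapid c -> rapid d -> rfrob (fun k => c k + d k) mu u = rfrob c mu u + rfrob d mu u.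
Proof.
  intros Hc Hd. apply RtoC_inj. rewrite RtoC_plus, <- !frob_real.
  unfold frob. rewrite Phi_plus by auto. ring.
Qed.

Lemma rfrob_scal (x : R) (c : nat -> R) (mu u : R) :
  rfrob (fun k => x * c k) mu u = x * rfrob c mu u.
Proof.
  apply RtoC_inj. rewrite RtoC_mult, <- !frob_real. unfold frob. rewrite Phi_scal. ring.
Qed.

Lemma rfrob_ge_0 (c : nat -> R) (mu u : R) :
  rapid c -> (forall k, 0 <= c k) -> 0 <= rfrob c mu u.
Proof.
  intros Hc Hp. apply Rmult_le_pos. left; apply exp_pos.
  apply PSeries_ge_0; auto. left; apply exp_pos.
Qed.

Definition rI (mu u : R) : R := rfrob (I_coef mu) mu u.
Definition rI' (mu u : R) : R := rfrob (theta mu (I_coef mu)) mu u.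
Definition rD (mu u : R) : R := u * rI mu u + rfrob (dI_coef mu) mu u.
Definition rD' (mu u : R) : R := rI mu u + u * rI' mu u + rfrob (theta mu (dI_coef mu)) mu u.

Lemma fI_real (mu u : R) : fI mu (RtoC u) = RtoC (rI mu u).
Proof. exact (frob_real _ mu u). Qed.

Lemma fI'_real (mu u : R) : fI' mu (RtoC u) = RtoC (rI' mu u).
Proof. exact (frob_real _ mu u). Qed.

Lemma fD_real (mu u : R) : fD mu (RtoC u) = RtoC (rD mu u).
Proof. unfold fD, rD. now rewrite fI_real, frob_real, RtoC_plus, RtoC_mult. Qed.

Lemma fD'_real (mu u : R) : fD' mu (RtoC u) = RtoC (rD' mu u).
Proof. unfold fD', rD'. now rewrite fI_real, fI'_real, frob_real, !RtoC_plus, RtoC_mult. Qed.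

Lemma Cderive_real_line (u : R) : is_Cderive (fun t => RtoC t) u 1.
Proof. apply Cderive_RtoC. apply (is_derive_id (K := R_AbsRing)). Qed.

Lemma is_derive_of_Cderive (f : R -> C) (g : R -> R) (u : R) (l : C) (l' : R) :
  (forall t, f t = RtoC (g t)) -> is_Cderive f u l -> l = RtoC l' -> is_derive g u l'.
Proof.
  intros E [H _] ->. eapply is_derive_ext; [|exact H]. intros t. simpl. now rewrite E.
Qed.

Lemma is_derive_rI (mu u : R) : is_derive (rI mu) u (rI' mu u).
Proof.
  eapply is_derive_of_Cderive. apply fI_real. apply (Cderive_fI mu (fun t => RtoC t) u 1), Cderive_real_line.
  rewrite fI'_real. ring.
Qed.

Lemma potential_real (mu u : R) : potential mu (RtoC u) = RtoC (mu ^ 2 + (2 * exp u) ^ 2).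
Proof.
  unfold potential. rewrite <- RtoC_mult, cexp_RtoC, <- RtoC_pow, <- RtoC_mult, <- RtoC_plus.
  f_equal. replace (2 * u) with (u + u) by ring. rewrite exp_plus. ring.
Qed.

Lemma is_derive_rI' (mu u : R) : is_derive (rI' mu) u ((mu ^ 2 + (2 * exp u) ^ 2) * rI mu u).
Proof.
  eapply is_derive_of_Cderive. apply fI'_real. apply (Cderive_fI' mu (fun t => RtoC t) u 1), Cderive_real_line.
  rewrite potential_real, fI_real, RtoC_mult. ring.
Qed.

Definition rW (nu u : R) : R := rI nu u * rD' nu u - rD nu u * rI' nu u.

Lemma wronskian_ID_real (nu u : R) : wronskian_ID nu (RtoC u) = RtoC (rW nu u).
Proof.
  unfold wronskian_ID, rW. now rewrite fI_real, fI'_real, fD_real, fD'_real, RtoC_minus, !RtoC_mult.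
Qed.

Lemma is_derive_rW (nu u : R) : is_derive (rW nu) u (2 * nu * rI nu u ^ 2).
Proof.
  eapply is_derive_of_Cderive. apply wronskian_ID_real.
  apply (Cderive_wronskian_ID nu (fun t => RtoC t) u 1), Cderive_real_line.
  rewrite fI_real, !RtoC_mult, RtoC_pow. ring.
Qed.

Lemma I_coef_pos (mu : R) (k : nat) : -1 < mu -> 0 < I_coef mu k.
Proof.
  intros Hm. apply Rdiv_lt_0_compat; [|apply fact_pos].
  apply rGamma_pos. generalize (pos_INR k). lra.
Qed.

Lemma rI_pos (mu u : R) : -1 < mu -> 0 < rI mu u.
Proof.
  intros Hm. apply Rmult_lt_0_compat. apply exp_pos.
  apply PSeries_gt_0. left; apply exp_pos. apply rapid_I_coef. intros; now apply I_coef_pos.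
Qed.

Lemma rI'_eq (mu u : R) : rI' mu u = mu * rI mu u + 2 * rfrob (euler (I_coef mu)) mu u.
Proof.
  unfold rI', theta. rewrite rfrob_plus, !rfrob_scal. reflexivity.
  apply rapid_scal, rapid_I_coef. apply rapid_scal, rapid_euler, rapid_I_coef.
Qed.

Lemma rI'_ge (mu u : R) : -1 < mu -> mu * rI mu u <= rI' mu u.
Proof.
  intros Hm. rewrite rI'_eq.
  assert (0 <= rfrob (euler (I_coef mu)) mu u); [|lra].
  apply rfrob_ge_0. apply rapid_euler, rapid_I_coef.
  intros k. apply Rmult_le_pos. apply pos_INR. left; now apply I_coef_pos.
Qed.

Lemma rfrob_bound (c : nat -> R) (mu : R) :
  rapid c -> exists A, 0 <= A /\ forall u, u <= 0 -> Rabs (rfrob c mu u) <= A * exp (mu * u).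
Proof.
  intros Hc. destruct (frob_bound c mu Hc) as (A & HA & H). exists A. split; auto.
  intros u Hu. rewrite <- Cmod_R, <- frob_real. apply (H (RtoC u)). exact Hu.
Qed.

(** A nondecreasing function that tends to 0 at minus infinity is nonnegative. In the variable u =
    ln (z / 2) this end is z = 0, where Frobenius series decay exponentially. *)
Lemma nonneg_of_derive_from_minus_infinity (f df : R -> R) (A kappa : R) :
  0 < kappa ->
  (forall u, is_derive f u (df u)) -> (forall u, 0 <= df u) ->
  (forall u, u <= 0 -> Rabs (f u) <= A * exp (kappa * u)) ->
  forall u, 0 <= f u.
Proof.
  intros Hk Hd Hp Hb u. apply Rnot_lt_le. intros Hlt.
  assert (HA : 0 < Rabs A + 1) by (generalize (Rabs_pos A); lra).
  set (e := - f u / (Rabs A + 1)).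
  assert (He : 0 < e) by (apply Rdiv_lt_0_compat; lra).
  set (v := Rmin (Rmin u 0) (ln e / kappa)).
  assert (v <= u /\ v <= 0 /\ v <= ln e / kappa) as (V1 & V2 & V3).
  { unfold v. generalize (Rmin_l (Rmin u 0) (ln e / kappa)) (Rmin_r (Rmin u 0) (ln e / kappa))
      (Rmin_l u 0) (Rmin_r u 0). lra. }
  assert (Hm : f v <= f u) by (apply (nondecreasing_of_derive f df); auto).
  assert (Hv := Hb v V2).
  assert (exp (kappa * v) <= e).
  { rewrite <- (exp_ln e He).
    assert (kappa * v <= ln e).
    { apply (Rmult_le_compat_l kappa) in V3; [|lra].
      replace (kappa * (ln e / kappa)) with (ln e) in V3 by (field; lra). auto. }
    destruct H as [H|H]. left; now apply exp_increasing. right; now rewrite H. }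
  assert (A * exp (kappa * v) <= Rabs A * e).
  { apply Rle_trans with (Rabs A * exp (kappa * v)).
    apply Rmult_le_compat_r. left; apply exp_pos. apply Rle_abs.
    apply Rmult_le_compat_l; auto. apply Rabs_pos. }
  assert (Rabs A * e < - f u).
  { replace (- f u) with ((Rabs A + 1) * e) by (unfold e; field; lra). lra. }
  generalize (Rle_abs (- f v)). rewrite Rabs_Ropp. lra.
Qed.

Lemma exp_le_1 (u : R) : u <= 0 -> exp u <= 1.
Proof.
  intros Hu. rewrite <- exp_0. destruct Hu as [Hu| ->]; [left; now apply exp_increasing|lra].
Qed.

(** The derivative of (nu^2 + z^2) I^2 - (theta I)^2 is 2 z^2 I^2 by Bessel's equation, and nu^2 +
    z^2 <= (z + nu)^2. *)
Lemma rI'_le (nu u : R) : 0 < nu -> rI' nu u <= (2 * exp u + nu) * rI nu u.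
Proof.
  intros Hn.
  set (S := fun u => (nu ^ 2 + (2 * exp u) ^ 2) * rI nu u ^ 2 - rI' nu u ^ 2).
  assert (HS : 0 <= S u).
  { destruct (rfrob_bound _ nu (rapid_I_coef nu)) as (A & PA & HA).
    destruct (rfrob_bound _ nu (rapid_theta nu _ (rapid_I_coef nu))) as (B & PB & HB).
    apply (nonneg_of_derive_from_minus_infinity S (fun u => 2 * (2 * exp u) ^ 2 * rI nu u ^ 2)
       ((nu ^ 2 + 4) * A ^ 2 + B ^ 2) (2 * nu)).
    - lra.
    - intros v. unfold S.
      eapply is_derive_value.
      + apply (is_derive_minus (V := R_NormedModule)).
        * apply (Derive.is_derive_mult (fun u => nu ^ 2 + (2 * exp u) ^ 2) (fun u => rI nu u ^ 2)).
          auto_derive; [auto|reflexivity].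
          apply is_derive_pow, is_derive_rI.
        * apply is_derive_pow, is_derive_rI'.
      + unfold minus, plus, opp; simpl. ring.
    - intros v. apply Rmult_le_pos. generalize (pow2_ge_0 (2 * exp v)); lra. apply pow2_ge_0.
    - intros v Hv. specialize (HA v Hv). specialize (HB v Hv).
      fold (rI nu v) in HA. fold (rI' nu v) in HB.
      replace (2 * nu * v) with (nu * v + nu * v) by ring. rewrite exp_plus.
      set (e := exp (nu * v)) in *.
      assert (E1 : rI nu v ^ 2 <= (A * e) ^ 2) by (rewrite <- pow2_abs; apply pow_incr; split; auto; apply Rabs_pos).
      assert (E2 : rI' nu v ^ 2 <= (B * e) ^ 2) by (rewrite <- pow2_abs; apply pow_incr; split; auto; apply Rabs_pos).
      assert (P1 := pow2_ge_0 (rI nu v)). assert (P2 := pow2_ge_0 (rI' nu v)).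
      assert (X1 := exp_le_1 v Hv). assert (X0 := exp_pos v).
      assert (0 <= nu ^ 2 + (2 * exp v) ^ 2 <= nu ^ 2 + 4) by nra.
      assert (0 <= (nu ^ 2 + (2 * exp v) ^ 2) * rI nu v ^ 2 <= (nu ^ 2 + 4) * (A * e) ^ 2).
      { split. apply Rmult_le_pos; lra. apply Rmult_le_compat; lra. }
      unfold S. apply Rabs_le. split; nra. }
  unfold S in HS.
  assert (P := rI_pos nu u ltac:(lra)). assert (X0 := exp_pos u).
  apply Rnot_lt_le. intros Hlt.
  assert (0 <= (2 * exp u + nu) * rI nu u) by (apply Rmult_le_pos; lra).
  assert (((2 * exp u + nu) * rI nu u) ^ 2 < rI' nu u ^ 2) by nra.
  assert (0 <= 4 * exp u * nu * rI nu u ^ 2).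
  { apply Rmult_le_pos. apply Rmult_le_pos; lra. apply pow2_ge_0. }
  nra.
Qed.

(** With the integrating factor e^z, the derivative of (theta I - (z - 1) I) e^z reduces to (theta I
    + nu^2 I) e^z, which is nonnegative. *)
Lemma rI'_ge_linear (nu u : R) : 0 < nu -> (2 * exp u - 1) * rI nu u <= rI' nu u.
Proof.
  intros Hn.
  set (U := fun u => (rI' nu u - (2 * exp u - 1) * rI nu u) * exp (2 * exp u)).
  assert (HU : 0 <= U u).
  { destruct (rfrob_bound _ nu (rapid_I_coef nu)) as (A & PA & HA).
    destruct (rfrob_bound _ nu (rapid_theta nu _ (rapid_I_coef nu))) as (B & PB & HB).
    apply (nonneg_of_derive_from_minus_infinity U (fun u => (rI' nu u + nu ^ 2 * rI nu u) * exp (2 * exp u))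
       ((B + A) * exp 2) nu); auto.
    - intros v. unfold U.
      eapply is_derive_value.
      + apply (Derive.is_derive_mult (fun u => rI' nu u - (2 * exp u - 1) * rI nu u) (fun u => exp (2 * exp u))).
        * apply (is_derive_minus (V := R_NormedModule)).
          apply is_derive_rI'.
          apply (Derive.is_derive_mult (fun u => 2 * exp u - 1) (rI nu)).
          auto_derive; [auto|reflexivity]. apply is_derive_rI.
        * auto_derive; [auto|reflexivity].
      + unfold minus, plus, opp; simpl. ring.
    - intros v. apply Rmult_le_pos; [|left; apply exp_pos].
      assert (P := rI_pos nu v ltac:(lra)). generalize (rI'_ge nu v ltac:(lra)). nra.
    - intros v Hv. specialize (HA v Hv). specialize (HB v Hv).
      fold (rI nu v) in HA. fold (rI' nu v) in HB.
      set (e := exp (nu * v)) in *. assert (0 < e) by apply exp_pos.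
      assert (X1 := exp_le_1 v Hv). assert (X0 := exp_pos v).
      unfold U. rewrite Rabs_mult, (Rabs_pos_eq (exp _)) by (left; apply exp_pos).
      replace ((B + A) * exp 2 * e) with ((B * e + A * e) * exp 2) by ring.
      apply Rmult_le_compat; auto using Rabs_pos. left; apply exp_pos.
      + unfold Rminus at 1. eapply Rle_trans; [apply Rabs_triang|]. rewrite Rabs_Ropp, Rabs_mult.
        assert (Rabs (2 * exp v - 1) <= 1) by (apply Rabs_le; lra).
        assert (Rabs (2 * exp v - 1) * Rabs (rI nu v) <= 1 * (A * e))
          by (apply Rmult_le_compat; auto using Rabs_pos). lra.
      + destruct (Req_dec (2 * exp v) 2) as [->|]. lra. left; apply exp_increasing; lra. }
  unfold U in HU. assert (X := exp_pos (2 * exp u)).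
  apply Rnot_lt_le. intros Hlt. nra.
Qed.

(** Both w1 and I^2 - w1 vanish at z = 0; their derivatives 2 nu I^2 and 2 I (theta I - nu I) are
    nonnegative. *)
Lemma rW_bounds (nu u : R) : 0 < nu -> 0 <= rW nu u <= rI nu u ^ 2.
Proof.
  intros Hn. destruct (wronskian_ID_bound nu) as (B & PB & HB).
  assert (HB' : forall v, v <= 0 -> Rabs (rW nu v) <= B * exp (2 * nu * v)).
  { intros v Hv. rewrite <- Cmod_R, <- wronskian_ID_real. apply (HB (RtoC v)). exact Hv. }
  split.
  - apply (nonneg_of_derive_from_minus_infinity (rW nu) (fun u => 2 * nu * rI nu u ^ 2) B (2 * nu)); auto.
    lra. intros; apply is_derive_rW.
    intros v. apply Rmult_le_pos. lra. apply pow2_ge_0.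
  - cut (0 <= rI nu u ^ 2 - rW nu u). lra.
    destruct (rfrob_bound _ nu (rapid_I_coef nu)) as (A & PA & HA).
    apply (nonneg_of_derive_from_minus_infinity (fun u => rI nu u ^ 2 - rW nu u)
      (fun u => 2 * rI nu u * (rI' nu u - nu * rI nu u)) (A ^ 2 + B) (2 * nu)).
    + lra.
    + intros v. eapply is_derive_value.
      * apply (is_derive_minus (V := R_NormedModule)).
        apply is_derive_pow, is_derive_rI. apply is_derive_rW.
      * unfold minus, plus, opp; simpl. ring.
    + intros v. assert (P := rI_pos nu v ltac:(lra)). generalize (rI'_ge nu v ltac:(lra)). intros.
      apply Rmult_le_pos; lra.
    + intros v Hv. specialize (HA v Hv). fold (rI nu v) in HA. specialize (HB' v Hv).
      unfold Rminus. eapply Rle_trans; [apply Rabs_triang|]. rewrite Rabs_Ropp, <- RPow_abs.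
      assert (Rabs (rI nu v) ^ 2 <= (A * exp (nu * v)) ^ 2) by (apply pow_incr; split; auto; apply Rabs_pos).
      replace (2 * nu * v) with (nu * v + nu * v) in * by ring. rewrite exp_plus in *. nra.
Qed.

Lemma pderiv_I_coef (nu : R) (k : nat) :
  -1 < nu -> pderiv (I_coef nu) k = I_coef nu k / (nu + INR k + 1).
Proof.
  intros Hn. rewrite <- (I_coef_rec nu k). unfold pderiv. rewrite S_INR.
  generalize (pos_INR k). intros. field. lra.
Qed.

Lemma dI_coef_eq (nu : R) (k : nat) :
  -1 < nu -> dI_coef nu k = - digamma (nu + INR k + 1) * I_coef nu k.
Proof.
  intros Hn. unfold dI_coef, I_coef. rewrite Derive_rGamma_of_pos.
  unfold Rdiv. ring. generalize (pos_INR k). lra.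
Qed.

Lemma rfrob_pderiv (c : nat -> R) (mu u : R) :
  rapid c -> exp (2 * u) * rfrob (pderiv c) mu u = rfrob (euler c) mu u.
Proof.
  intros Hc. apply RtoC_inj. rewrite RtoC_mult, <- !frob_real. unfold frob.
  rewrite (Phi_euler c) by auto. rewrite <- (RtoC_mult 2 u), cexp_RtoC. ring.
Qed.

(* Termwise: [u - ln y] lies between [1 - y / exp u] and [exp u / y - 1], and the two resulting
   series are expressed by [rI] and [rI']. *)
Lemma rD_bound (nu u : R) : 0 < nu -> Rabs (rD nu u) <= (nu + 1) * exp (- u) * rI nu u.
Proof.
  intros Hn. set (a := I_coef nu). set (b := dI_coef nu).
  assert (Ra : rapid a) by apply rapid_I_coef. assert (Rb : rapid b) by apply rapid_dI_coef.
  assert (X0 := exp_pos u). assert (X1 := exp_pos (- u)).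
  assert (XX : exp u * exp (- u) = 1) by (rewrite <- exp_plus, Rplus_opp_r; apply exp_0).
  assert (HI := rI_pos nu u ltac:(lra)).
  assert (HI' := rI'_le nu u Hn). rewrite rI'_eq in HI'. fold a in HI'.
  assert (Hk : forall k, 0 < nu + INR k + 1) by (intros k; generalize (pos_INR k); lra).
  assert (Ha : forall k, 0 < a k) by (intros; apply I_coef_pos; lra).
  assert (Hb : forall k, b k = - digamma (nu + INR k + 1) * a k) by (intros; apply dI_coef_eq; lra).
  assert (U1 : 0 <= rfrob (fun k => ((exp u + 1) * pderiv a k + (- 1 - u) * a k) + -1 * b k) nu u).
  { apply rfrob_ge_0.
    - auto 6 using rapid_plus, rapid_scal, rapid_pderiv.
    - intros k. unfold a at 1. rewrite pderiv_I_coef, Hb by lra. fold a.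
      set (y := nu + INR k + 1). assert (Hy : 0 < y) by apply Hk.
      assert (G := digamma_ge_ln y Hy).
      assert (L := ln_le_sub1 (exp u / y) (Rdiv_lt_0_compat _ _ X0 Hy)).
      rewrite ln_div, ln_exp in L by auto.
      replace ((exp u + 1) * (a k / y) + (-1 - u) * a k + -1 * (- digamma y * a k))
        with (a k * ((exp u / y - 1) + / y - u + digamma y)) by (field; lra).
      apply Rmult_le_pos. left; auto. lra. }
  assert (L1 : 0 <= rfrob (fun k => ((u - 1 + exp (- u) * (nu + 1)) * a k + exp (- u) * euler a k) + b k) nu u).
  { apply rfrob_ge_0.
    - auto 6 using rapid_plus, rapid_scal, rapid_euler.
    - intros k. rewrite Hb. unfold euler.
      set (y := nu + INR k + 1). assert (Hy : 0 < y) by apply Hk.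
      assert (G := digamma_le_ln y Hy).
      assert (L := ln_le_sub1 (y * exp (- u)) (Rmult_lt_0_compat _ _ Hy X1)).
      rewrite ln_mult, ln_exp in L by auto.
      replace ((u - 1 + exp (- u) * (nu + 1)) * a k + exp (- u) * (INR k * a k) + - digamma y * a k)
        with (a k * (u - 1 + y * exp (- u) - digamma y)) by (unfold y; ring).
      apply Rmult_le_pos. left; auto. lra. }
  rewrite !rfrob_plus, !rfrob_scal in U1, L1 by auto using rapid_plus, rapid_scal, rapid_pderiv, rapid_euler.
  rewrite (rfrob_scal (-1) b) in U1.
  assert (E := rfrob_pderiv a nu u Ra).
  assert (E2 : rfrob (pderiv a) nu u = exp (- u) * exp (- u) * rfrob (euler a) nu u).
  { rewrite <- E. replace (2 * u) with (u + u) by ring. rewrite exp_plus.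
    transitivity ((exp u * exp (- u)) * (exp u * exp (- u)) * rfrob (pderiv a) nu u).
    rewrite XX; ring. ring. }
  unfold rD. fold b. change (rfrob a nu u) with (rI nu u) in *.
  set (i := rI nu u) in *. set (n := rfrob (euler a) nu u) in *. set (p := rfrob b nu u) in *.
  assert (Hn2 : n <= exp u * i) by lra.
  assert (Hn3 : exp (- u) * n <= i).
  { apply (Rmult_le_compat_l (exp (- u))) in Hn2; [|lra].
    replace (exp (- u) * (exp u * i)) with (i * (exp u * exp (- u))) in Hn2 by ring.
    rewrite XX in Hn2. lra. }
  assert (0 <= exp (- u) * i) by (apply Rmult_le_pos; lra).
  apply Rabs_le. split.
  - lra.
  - rewrite E2 in U1.
    replace ((exp u + 1) * (exp (- u) * exp (- u) * n))
      with (((exp u * exp (- u)) + exp (- u)) * (exp (- u) * n)) in U1 by ring.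
    rewrite XX in U1.
    assert ((1 + exp (- u)) * (exp (- u) * n) <= (1 + exp (- u)) * i) by (apply Rmult_le_compat_l; lra).
    assert (0 <= nu * (exp (- u) * i)) by (apply Rmult_le_pos; lra). lra.
Qed.

(** * The Macdonald function on the real axis *)

Lemma is_derive_rI_order (mu u : R) : is_derive (fun m => rI m u) mu (rD mu u).
Proof.
  eapply is_derive_of_Cderive. intros t; apply fI_real. apply Cderive_fI_order. now rewrite fD_real.
Qed.

(** The derivative of ln I in the order is D / I, which [rD_bound] makes O(e^(-u)). *)
Lemma ln_rI_order_lipschitz (mu nu u : R) :
  0 < nu <= mu -> Rabs (ln (rI nu u) - ln (rI mu u)) <= (2 * mu + 1) * exp (- u) * (mu - nu).
Proof.
  intros H.
  replace (mu - nu) with (Rabs (nu - mu)) by (rewrite Rabs_left1; lra).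
  apply (bounded_variation (fun m => ln (rI m u)) (fun m => rD m u / rI m u)).
  intros t Ht. rewrite (Rabs_left1 (nu - mu)) in Ht by lra.
  (* [bounded_variation] lets t range over both sides of mu, hence up to 2 mu - nu. *)
  assert (0 < t <= 2 * mu) by (generalize (Rle_abs (t - mu)) (Rle_abs (- (t - mu))); rewrite Rabs_Ropp; lra).
  assert (P := rI_pos t u ltac:(lra)).
  split.
  - eapply is_derive_value.
    + apply (is_derive_comp (V := R_NormedModule) ln (fun m => rI m u)).
      apply is_derive_ln; auto. apply is_derive_rI_order.
    + reflexivity.
  - rewrite Rabs_div, (Rabs_pos_eq (rI t u)) by lra.
    apply Rmult_le_reg_r with (rI t u); auto.
    unfold Rdiv. rewrite Rmult_assoc, Rinv_l, Rmult_1_r by lra.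
    eapply Rle_trans. apply rD_bound; lra.
    assert (0 < exp (- u)) by apply exp_pos.
    apply Rmult_le_compat_r. lra. apply Rmult_le_compat_r; lra.
Qed.

Lemma Rabs_exp_sub_1 (t : R) : Rabs (exp t - 1) <= Rabs t * exp (Rabs t).
Proof.
  assert (H1 := exp_ineq1_le t). assert (H2 := exp_ineq1_le (- t)).
  assert (E : exp t * exp (- t) = 1) by (rewrite <- exp_plus, Rplus_opp_r; apply exp_0).
  assert (P := exp_pos t).
  destruct (Rle_dec 0 t).
  - assert (1 <= exp t) by lra.
    rewrite (Rabs_pos_eq t), Rabs_pos_eq by lra.
    assert (exp t * (1 + - t) <= exp t * exp (- t)) by (apply Rmult_le_compat_l; lra). lra.
  - assert (1 <= exp (- t)) by lra.
    assert (exp t <= 1) by (apply exp_le_1; lra).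
    rewrite (Rabs_left1 t), Rabs_left1 by lra.
    assert (- t * 1 <= - t * exp (- t)) by (apply Rmult_le_compat_l; lra). lra.
Qed.

(** I_mu / I_nu = 1 + O(1/z) and theta I_mu / I_nu = z + O(1). The second estimate makes the pair
    stable under the contiguous relations, so the order can descend from positive values to - nu. *)
Definition same_asymptotics (nu mu B : R) : Prop :=
  forall u, 0 <= u ->
    Rabs (rI mu u - rI nu u) <= B * exp (- u) * rI nu u /\
    Rabs (rI' mu u - 2 * exp u * rI nu u) <= B * rI nu u.

Lemma exp_pm (u : R) : 0 <= u -> 0 < exp (- u) <= 1 /\ exp u * exp (- u) = 1 /\ 1 <= exp u.
Proof.
  intros Hu. split; [split; [apply exp_pos|apply exp_le_1; lra]|]. split.
  rewrite <- exp_plus, Rplus_opp_r; apply exp_0.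
  generalize (exp_ineq1_le u); lra.
Qed.

Lemma same_asymptotics_pos (nu mu : R) :
  0 < nu -> 0 < mu -> exists B, same_asymptotics nu mu B.
Proof.
  intros Hn Hm.
  (* [b] dominates the Lipschitz bound whichever of the two orders is larger. *)
  set (b := (2 * (mu + nu) + 1) * (mu + nu)).
  assert (Hb : 0 <= b) by (unfold b; nra).
  set (C := b * exp b).
  assert (HC : 0 <= C) by (apply Rmult_le_pos; auto; left; apply exp_pos).
  exists ((mu + 1) * (1 + C) + 2 * C). intros u Hu.
  destruct (exp_pm u Hu) as (E1 & E2 & E3).
  assert (Pn := rI_pos nu u ltac:(lra)). assert (Pm := rI_pos mu u ltac:(lra)).
  assert (L : Rabs (ln (rI mu u) - ln (rI nu u)) <= b * exp (- u)).
  { assert (T : forall p q, 0 <= p <= mu + nu -> 0 <= q <= mu + nu -> (2 * p + 1) * exp (- u) * q <= b * exp (- u)).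
    { intros p q Hp Hq. unfold b.
      assert ((2 * p + 1) * q <= (2 * (mu + nu) + 1) * (mu + nu)) by (apply Rmult_le_compat; lra).
      replace ((2 * p + 1) * exp (- u) * q) with ((2 * p + 1) * q * exp (- u)) by ring.
      apply Rmult_le_compat_r; lra. }
    destruct (Rle_dec nu mu).
    - rewrite Rabs_minus_sym. eapply Rle_trans; [apply ln_rI_order_lipschitz; lra|]. apply T; lra.
    - eapply Rle_trans; [apply ln_rI_order_lipschitz; lra|]. apply T; lra. }
  set (t := ln (rI mu u) - ln (rI nu u)) in *.
  assert (Et : rI mu u = exp t * rI nu u).
  { unfold t. rewrite exp_minus, !exp_ln by auto. field. lra. }
  assert (B1 : Rabs (exp t - 1) <= C * exp (- u)).
  { eapply Rle_trans; [apply Rabs_exp_sub_1|]. unfold C.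
    replace (b * exp b * exp (- u)) with (b * exp (- u) * exp b) by ring.
    apply Rmult_le_compat; auto using Rabs_pos. left; apply exp_pos.
    assert (Rabs t <= b) by nra.
    destruct H as [H|H]. left; now apply exp_increasing. right; now rewrite H. }
  assert (B2 : Rabs (rI mu u - rI nu u) <= C * exp (- u) * rI nu u).
  { rewrite Et. replace (exp t * rI nu u - rI nu u) with ((exp t - 1) * rI nu u) by ring.
    rewrite Rabs_mult, (Rabs_pos_eq (rI nu u)) by lra. apply Rmult_le_compat_r; lra. }
  assert (HB : C <= (mu + 1) * (1 + C) + 2 * C) by nra.
  split.
  - eapply Rle_trans; [exact B2|]. apply Rmult_le_compat_r. lra. apply Rmult_le_compat_r; lra.
  - assert (H1 := rI'_le mu u Hm). assert (H2 := rI'_ge_linear mu u Hm).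
    assert (B3 : rI mu u <= (1 + C) * rI nu u).
    { generalize (Rle_abs (rI mu u - rI nu u)). intros.
      assert (C * exp (- u) * rI nu u <= C * 1 * rI nu u)
        by (apply Rmult_le_compat_r; [lra|]; apply Rmult_le_compat_l; lra). lra. }
    replace (rI' mu u - 2 * exp u * rI nu u) with
      ((rI' mu u - 2 * exp u * rI mu u) + 2 * exp u * (rI mu u - rI nu u)) by ring.
    eapply Rle_trans; [apply Rabs_triang|].
    assert (Rabs (rI' mu u - 2 * exp u * rI mu u) <= (mu + 1) * rI mu u).
    { apply Rabs_le. split; nra. }
    rewrite Rabs_mult, (Rabs_pos_eq (2 * exp u)) by lra.
    assert (2 * exp u * Rabs (rI mu u - rI nu u) <= 2 * exp u * (C * exp (- u) * rI nu u))
      by (apply Rmult_le_compat_l; lra).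
    replace (2 * exp u * (C * exp (- u) * rI nu u)) with (2 * C * rI nu u * (exp u * exp (- u))) in H0 by ring.
    rewrite E2 in H0.
    assert ((mu + 1) * rI mu u <= (mu + 1) * ((1 + C) * rI nu u)) by (apply Rmult_le_compat_l; lra).
    lra.
Qed.

Lemma rI_order_pred (mu u : R) : 2 * exp u * rI (mu - 1) u = rI' mu u + mu * rI mu u.
Proof.
  apply RtoC_inj. rewrite RtoC_plus, !RtoC_mult, <- cexp_RtoC, <- !fI_real, <- fI'_real.
  apply fI_order_pred.
Qed.

Lemma rI'_order_pred (mu u : R) : rI' (mu - 1) u = 2 * exp u * rI mu u + (mu - 1) * rI (mu - 1) u.
Proof.
  apply RtoC_inj. rewrite RtoC_plus, !RtoC_mult, <- cexp_RtoC, <- !fI_real, <- fI'_real.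
  apply fI'_order_pred.
Qed.

Lemma same_asymptotics_pred (nu mu B : R) :
  0 < nu -> same_asymptotics nu mu B -> exists B', same_asymptotics nu (mu - 1) B'.
Proof.
  intros Hn H.
  assert (HB : 0 <= B).
  { destruct (H 0 (Rle_refl 0)) as [_ H2]. assert (P := rI_pos nu 0 ltac:(lra)).
    generalize (Rabs_pos (rI' mu 0 - 2 * exp 0 * rI nu 0)). nra. }
  set (B1 := B + Rabs mu * (1 + B)).
  assert (HB1 : 0 <= B1).
  { unfold B1. assert (0 <= Rabs mu * (1 + B)) by (apply Rmult_le_pos; [apply Rabs_pos|lra]). lra. }
  assert (HB2 : 0 <= Rabs (mu - 1) * (1 + B1)) by (apply Rmult_le_pos; [apply Rabs_pos|lra]).
  exists (B1 + 2 * B + Rabs (mu - 1) * (1 + B1)). intros u Hu.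
  destruct (exp_pm u Hu) as (E1 & E2 & E3).
  destruct (H u Hu) as [H1 H2].
  assert (Pn := rI_pos nu u ltac:(lra)).
  set (J := rI nu u) in *.
  assert (T : forall a b, 0 <= b -> Rabs (a - J) <= b * exp (- u) * J -> Rabs a <= (1 + b) * J).
  { intros a b Hb Ha. replace a with ((a - J) + J) by ring.
    eapply Rle_trans; [apply Rabs_triang|]. rewrite (Rabs_pos_eq J) by lra.
    assert (b * exp (- u) * J <= b * 1 * J)
      by (apply Rmult_le_compat_r; [lra|]; apply Rmult_le_compat_l; lra). lra. }
  assert (A1 := T _ _ HB H1).
  assert (P1 := rI_order_pred mu u). assert (P2 := rI'_order_pred mu u).
  assert (A2 : Rabs (rI (mu - 1) u - J) <= B1 * exp (- u) * J).
  { replace (rI (mu - 1) u - J) with (/ 2 * exp (- u) * ((rI' mu u - 2 * exp u * J) + mu * rI mu u)).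
    2:{ transitivity (/ 2 * exp (- u) * (2 * exp u * rI (mu - 1) u - 2 * exp u * J)). rewrite P1; ring.
        transitivity ((exp u * exp (- u)) * (rI (mu - 1) u - J)). field. rewrite E2; ring. }
    rewrite Rabs_mult, (Rabs_pos_eq (/ 2 * exp (- u))) by lra.
    replace (B1 * exp (- u) * J) with (exp (- u) * (B1 * J)) by ring.
    apply Rle_trans with (exp (- u) * Rabs (rI' mu u - 2 * exp u * J + mu * rI mu u)).
    apply Rmult_le_compat_r. apply Rabs_pos. lra.
    apply Rmult_le_compat_l. lra.
    eapply Rle_trans; [apply Rabs_triang|]. rewrite Rabs_mult.
    assert (Rabs mu * Rabs (rI mu u) <= Rabs mu * ((1 + B) * J))
      by (apply Rmult_le_compat_l; auto; apply Rabs_pos).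
    unfold B1. lra. }
  assert (A3 := T _ _ HB1 A2).
  split.
  - eapply Rle_trans; [exact A2|]. apply Rmult_le_compat_r. lra. apply Rmult_le_compat_r; lra.
  - rewrite P2.
    replace (2 * exp u * rI mu u + (mu - 1) * rI (mu - 1) u - 2 * exp u * J)
      with (2 * exp u * (rI mu u - J) + (mu - 1) * rI (mu - 1) u) by ring.
    eapply Rle_trans; [apply Rabs_triang|].
    rewrite !Rabs_mult, (Rabs_pos_eq 2), (Rabs_pos_eq (exp u)) by lra.
    assert (2 * exp u * Rabs (rI mu u - J) <= 2 * exp u * (B * exp (- u) * J))
      by (apply Rmult_le_compat_l; lra).
    replace (2 * exp u * (B * exp (- u) * J)) with (2 * B * J * (exp u * exp (- u))) in H0 by ring.
    rewrite E2 in H0.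
    assert (Rabs (mu - 1) * Rabs (rI (mu - 1) u) <= Rabs (mu - 1) * ((1 + B1) * J))
      by (apply Rmult_le_compat_l; auto; apply Rabs_pos).
    nra.
Qed.

Lemma same_asymptotics_all (nu mu : R) : 0 < nu -> exists B, same_asymptotics nu mu B.
Proof.
  intros Hn. destruct (INR_unbounded (- mu)) as [n H].
  assert (K : forall n mu, - mu < INR n -> exists B, same_asymptotics nu mu B).
  { clear - Hn. induction n as [|n IH]; intros mu H.
    - simpl in H. apply same_asymptotics_pos; lra.
    - rewrite S_INR in H. destruct (IH (mu + 1)) as [B HB]. lra.
      replace mu with (mu + 1 - 1) by ring. now apply same_asymptotics_pred with B. }
  now apply (K n).
Qed.

Lemma nonneg_of_derive_to_infinity (f df : R -> R) (u0 A : R) :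
  (forall u, u0 <= u -> is_derive f u (df u)) -> (forall u, u0 <= u -> df u <= 0) ->
  (forall u, u0 <= u -> 0 <= u -> - (A * exp (- u)) <= f u) ->
  0 <= f u0.
Proof.
  intros Hd Hn Hb. apply Rnot_lt_le. intros Hlt.
  assert (HA : 0 < Rabs A + 1) by (generalize (Rabs_pos A); lra).
  set (e := - f u0 / (Rabs A + 1)).
  assert (He : 0 < e) by (apply Rdiv_lt_0_compat; lra).
  set (v := Rmax (Rmax u0 0) (1 - ln e)).
  assert (u0 <= v /\ 0 <= v /\ - ln e < v) as (V1 & V2 & V3).
  { unfold v. generalize (Rmax_l (Rmax u0 0) (1 - ln e)) (Rmax_r (Rmax u0 0) (1 - ln e))
      (Rmax_l u0 0) (Rmax_r u0 0). lra. }
  assert (Hm : - f u0 <= - f v).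
  { apply (nondecreasing_of_derive (fun u => - f u) (fun u => - df u)); auto.
    - intros x Hx. apply (is_derive_opp (V := R_NormedModule)). apply Hd; lra.
    - intros x Hx. specialize (Hn x ltac:(lra)). lra. }
  assert (Hv := Hb v V1 V2).
  assert (Hex := exp_neg_lt e v He V3). assert (Hep := exp_pos (- v)).
  assert (A * exp (- v) <= Rabs A * exp (- v)) by (apply Rmult_le_compat_r; [lra|apply Rle_abs]).
  assert (Rabs A * exp (- v) <= Rabs A * e) by (apply Rmult_le_compat_l; [apply Rabs_pos|lra]).
  assert (Rabs A * e < - f u0).
  { replace (- f u0) with ((Rabs A + 1) * e) by (unfold e; field; lra). lra. }
  lra.
Qed.

Lemma rI_wronskian (mu u : R) :
  rI mu u * rI' (- mu) u - rI (- mu) u * rI' mu u = - (2 / PI) * sin (PI * mu).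
Proof.
  apply RtoC_inj. rewrite <- (I_wronskian mu (RtoC u)), !fI_real, !fI'_real.
  now rewrite RtoC_minus, !RtoC_mult.
Qed.

Definition rK (nu u : R) : R := PI / 2 * (/ sin (PI * nu) * (rI (- nu) u - rI nu u)).

(** The quotient q = K / I has derivative - 1 / I^2 by the Wronskian and tends to 0 because I_{-nu}
    ~ I_nu; so it is nonnegative. For the upper bound it is compared with 1 / (2 M I^2), where M = z
    - 1 is frozen at [u] and theta I >= M I from there on. The singular factor 1 / sin (pi nu)
    enters only the decay of q, not the final bound, which is therefore uniform in the order. *)
Lemma rK_rI_bounds (nu u : R) :
  0 < nu -> sin (PI * nu) <> 0 -> 1 < 2 * exp u ->
  0 <= rK nu u * rI nu u <= / (2 * (2 * exp u - 1)).
Proof.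
  intros Hn Hs Hu.
  destruct (same_asymptotics_all nu (- nu) Hn) as [B HB].
  assert (P : forall v, 0 < rI nu v) by (intros; apply rI_pos; lra).
  set (q := fun v => rK nu v / rI nu v).
  assert (Hq : forall v, is_derive q v (- / rI nu v ^ 2)).
  { intros v. unfold q. specialize (P v). eapply is_derive_value.
    - apply is_derive_div; [|apply is_derive_rI|lra].
      unfold rK. do 2 apply is_derive_scal. apply (is_derive_minus (V := R_NormedModule)); apply is_derive_rI.
    - assert (W := rI_wronskian nu v). assert (HP := PI_neq0).
      unfold rK, minus, plus, opp; simpl.
      replace ((PI / 2 * (/ sin (PI * nu) * (rI' (- nu) v + - rI' nu v)) * rI nu v -
         PI / 2 * (/ sin (PI * nu) * (rI (- nu) v - rI nu v)) * rI' nu v))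
       with (PI / 2 * / sin (PI * nu) * (rI nu v * rI' (- nu) v - rI (- nu) v * rI' nu v)) by ring.
      rewrite W. field. repeat split; auto; lra. }
  set (A := PI / 2 * Rabs (/ sin (PI * nu)) * B).
  assert (Hqb : forall v, 0 <= v -> Rabs (q v) <= A * exp (- v)).
  { intros v Hv. destruct (HB v Hv) as [H1 _]. specialize (P v).
    unfold q, rK, A. rewrite Rabs_div, !Rabs_mult, (Rabs_pos_eq (rI nu v)) by lra.
    assert (HP := PI_RGT_0). rewrite (Rabs_pos_eq (PI / 2)) by lra.
    apply Rmult_le_reg_r with (rI nu v); auto. unfold Rdiv at 1.
    rewrite Rmult_assoc, Rinv_l, Rmult_1_r by lra.
    replace (PI / 2 * Rabs (/ sin (PI * nu)) * B * exp (- v) * rI nu v)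
      with (PI / 2 * (Rabs (/ sin (PI * nu)) * (B * exp (- v) * rI nu v))) by ring.
    apply Rmult_le_compat_l. lra. apply Rmult_le_compat_l; auto. apply Rabs_pos. }
  assert (Q0 : 0 <= q u).
  { apply (nonneg_of_derive_to_infinity q (fun v => - / rI nu v ^ 2) u A); auto.
    - intros v _. specialize (P v). assert (0 < / rI nu v ^ 2) by (apply Rinv_0_lt_compat, pow_lt; auto). lra.
    - intros v _ Hv. specialize (Hqb v Hv). generalize (Rle_abs (- q v)). rewrite Rabs_Ropp. lra. }
  set (M := 2 * exp u - 1). assert (HM : 0 < M) by (unfold M; lra).
  assert (Q1 : 0 <= / (2 * M) * / rI nu u ^ 2 - q u).
  { apply (nonneg_of_derive_to_infinity (fun v => / (2 * M) * / rI nu v ^ 2 - q v)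
      (fun v => (M * rI nu v - rI' nu v) / (M * rI nu v ^ 3)) u A).
    - intros v _. specialize (P v). eapply is_derive_value.
      + apply (is_derive_minus (V := R_NormedModule)); [|apply Hq].
        apply is_derive_scal. apply is_derive_inv. apply is_derive_pow, is_derive_rI.
        apply pow_nonzero; lra.
      + unfold minus, plus, opp; simpl. field. lra.
    - intros v Hv. specialize (P v). assert (L := rI'_ge_linear nu v Hn).
      assert (exp u <= exp v) by (destruct Hv as [Hv| ->]; [left; now apply exp_increasing|lra]).
      assert (M * rI nu v <= (2 * exp v - 1) * rI nu v) by (apply Rmult_le_compat_r; unfold M; lra).
      assert (0 < M * rI nu v ^ 3) by (apply Rmult_lt_0_compat; auto; apply pow_lt; auto).
      assert (0 < / (M * rI nu v ^ 3)) by now apply Rinv_0_lt_compat.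
      unfold Rdiv. nra.
    - intros v _ Hv. specialize (Hqb v Hv). generalize (Rle_abs (q v)). intros.
      assert (0 < / rI nu v ^ 2) by (apply Rinv_0_lt_compat, pow_lt; auto).
      assert (0 < / (2 * M)) by (apply Rinv_0_lt_compat; lra). nra. }
  specialize (P u).
  assert (E : rK nu u * rI nu u = q u * rI nu u ^ 2) by (unfold q; field; lra).
  assert (0 < rI nu u ^ 2) by now apply pow_lt.
  rewrite E. split. apply Rmult_le_pos; lra.
  replace (/ (2 * M)) with (/ (2 * M) * / rI nu u ^ 2 * rI nu u ^ 2) by (field; lra).
  apply Rmult_le_compat_r; lra.
Qed.

(** * The Macdonald function as a solution of Bessel's equation *)

Lemma Cderive_unique (f : R -> C) (s : R) (l m : C) : is_Cderive f s l -> is_Cderive f s m -> l = m.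
Proof.
  intros [A1 A2] [B1 B2].
  apply is_derive_unique in A1, A2, B1, B2.
  apply injective_projections; unfold Re, Im in *; congruence.
Qed.

Lemma Cderive_comp_opp (f : R -> C) (s : R) (l : C) : is_Cderive f (- s) l -> is_Cderive (fun t => f (- t)) s (- l)%C.
Proof.
  intros [A1 A2].
  assert (H : is_derive Ropp s (-1)).
  { auto_derive; auto. }
  split; eapply is_derive_value.
  - exact (is_derive_comp (V := R_NormedModule) (fun t => Re (f t)) Ropp s _ _ A1 H).
  - unfold scal; simpl; unfold mult; simpl. unfold Re; ring.
  - exact (is_derive_comp (V := R_NormedModule) (fun t => Im (f t)) Ropp s _ _ A2 H).
  - unfold scal; simpl; unfold mult; simpl. unfold Im; ring.
Qed.

Lemma Phi_skip (n : nat) (c : nat -> R) (w : C) :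
  rapid c -> (forall k, (k < n)%nat -> c k = 0) ->
  Phi c w = (w ^ n * Phi (fun k => c (n + k)%nat) w)%C.
Proof.
  revert c. induction n as [|n IH]; intros c Hc Hz.
  - simpl. now rewrite Cmult_1_l.
  - rewrite Phi_incr, (Hz O) by (auto; lia).
    rewrite (IH (fun k => c (S k))).
    + simpl. ring.
    + now apply rapid_tail.
    + intros k Hk. apply Hz. lia.
Qed.

Lemma cexp_pow (z : C) (n : nat) : (cexp z ^ n)%C = cexp (INR n * z).
Proof.
  induction n as [|n IH].
  - simpl. rewrite Cmult_0_l, cexp_RtoC, exp_0. reflexivity.
  - rewrite Cpow_S, IH, <- cexp_plus, S_INR, RtoC_plus. f_equal. ring.
Qed.

Lemma rGamma_fact (n : nat) : rGamma (INR n + 1) = / INR (fact n).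
Proof.
  induction n as [|n IH].
  - simpl. rewrite Rplus_0_l, rGamma_of_pos, EulerGamma_1 by lra. reflexivity.
  - rewrite fact_simpl, mult_INR, S_INR, Rinv_mult, <- IH.
    rewrite (rGamma_succ (INR n + 1)). field. generalize (pos_INR n). lra.
Qed.

(** The first n coefficients of order - n vanish at the poles of Gamma; the remaining ones, 1 / (k!
    (n + k)!), are those of order n. *)
Lemma fI_opp_nat (n : nat) (zeta : C) : fI (- INR n) zeta = fI (INR n) zeta.
Proof.
  unfold fI, frob.
  rewrite (Phi_skip n (I_coef (- INR n))).
  - rewrite (Phi_ext (fun k => I_coef (- INR n) (n + k)) (I_coef (INR n))).
    + rewrite cexp_pow, Cmult_assoc, <- cexp_plus. do 2 f_equal.
      rewrite RtoC_opp. ring.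
    + intros k. unfold I_coef. rewrite plus_INR.
      replace (- INR n + (INR n + INR k) + 1) with (INR k + 1) by ring.
      rewrite <- plus_INR, !rGamma_fact. unfold Rdiv. apply Rmult_comm.
  - apply rapid_I_coef.
  - intros k Hk. unfold I_coef.
    replace (- INR n + INR k + 1) with (- INR (n - S k)).
    + rewrite rGamma_nonpos_int. unfold Rdiv. ring.
    + rewrite minus_INR, S_INR by lia. ring.
Qed.

Lemma Cderive_line (zeta : C) (s : R) : is_Cderive (fun t => (zeta + RtoC t)%C) s 1.
Proof.
  eapply Cderive_value. exact (Cderive_plus _ _ _ _ _ (Cderive_const zeta s) (Cderive_real_line s)). ring.
Qed.

Lemma fI'_opp_nat (n : nat) (zeta : C) : fI' (- INR n) zeta = fI' (INR n) zeta.
Proof.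
  assert (A := Cderive_fI (- INR n) _ 0 _ (Cderive_line zeta 0)).
  assert (B := Cderive_fI (INR n) _ 0 _ (Cderive_line zeta 0)).
  apply (Cderive_ext _ (fun t => fI (INR n) (zeta + RtoC t)%C)) in A.
  2: intros; apply fI_opp_nat.
  assert (E := Cderive_unique _ _ _ _ A B). cbv beta in E.
  replace (zeta + RtoC 0)%C with zeta in E by ring.
  rewrite !Cmult_1_l in E. exact E.
Qed.

Lemma is_lim_quotient_of_derive (f g : R -> R) (a f' g' : R) :
  f a = 0 -> g a = 0 -> is_derive f a f' -> is_derive g a g' -> g' <> 0 ->
  is_lim (fun x => f x * / g x) a (f' / g').
Proof.
  intros Hf Hg Df Dg Hn.
  assert (Q : forall (h : R -> R) l, is_derive h a l -> h a = 0 -> is_lim (fun x => h x / (x - a)) a l).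
  { intros h l D H0. apply is_lim_spec. intros eps.
    apply is_derive_Reals in D. destruct (D eps (cond_pos eps)) as [d Hd].
    exists d. intros y Hy Hya.
    specialize (Hd (y - a)). rewrite Rplus_minus in Hd.
    rewrite H0, Rminus_0_r in Hd. apply Hd. lra. exact Hy. }
  apply (is_lim_ext_loc (fun x => (f x / (x - a)) / (g x / (x - a)))).
  - exists (mkposreal 1 Rlt_0_1). intros y _ Hy. unfold Rdiv.
    rewrite Rinv_mult, Rinv_inv.
    replace (f y * / (y - a) * (/ g y * (y - a))) with (f y * / g y * ((y - a) * / (y - a))) by ring.
    rewrite Rinv_r by lra. ring.
  - apply (is_lim_div _ _ a f' g'); auto.
    + intros E. injection E. auto.
    + simpl. unfold Rdiv. auto.
Qed.

(** At s = 0 both sides are 0 by the convention / 0 = 0, so [K_quotient] can be rewritten at every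
    order. *)
Lemma Cdiv_RtoC (z : C) (s : R) : (z / RtoC s)%C = (RtoC (/ s) * z)%C.
Proof.
  destruct (Req_dec s 0) as [->|H].
  - rewrite Rinv_0. apply injective_projections; simpl; unfold Rdiv; ring.
  - rewrite RtoC_inv by auto. unfold Cdiv. ring.
Qed.

Definition K_quotient (nu : R) (zeta : C) : C :=
  (RtoC (PI / 2) * ((fI (- nu) zeta - fI nu zeta) / RtoC (sin (PI * nu))))%C.

Lemma K_quotient_real (nu u : R) : K_quotient nu (RtoC u) = RtoC (rK nu u).
Proof.
  unfold K_quotient, rK. rewrite Cdiv_RtoC, !fI_real. now rewrite !RtoC_mult, RtoC_minus.
Qed.

(** The facts about K on which the main argument rests, with K' in the role of theta K. They hide
    whether K is a quotient or a limit, so that integral and non-integral orders are treated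
    alike. *)
Record Macdonald (nu : R) (K K' : C -> C) : Prop := {
  Macdonald_derive : forall zeta s d, is_Cderive zeta s d -> is_Cderive (fun t => K (zeta t)) s (d * K' (zeta s))%C;
  Macdonald_ode : forall zeta s d, is_Cderive zeta s d ->
    is_Cderive (fun t => K' (zeta t)) s (d * (potential nu (zeta s) * K (zeta s)))%C;
  Macdonald_wronskian : forall zeta, (K zeta * fI' nu zeta - fI nu zeta * K' zeta = 1)%C;
  Macdonald_bound : forall u, 1 < 2 * exp u ->
    Cmod (K (RtoC u) * fI nu (RtoC u)) <= / (2 * (2 * exp u - 1))
}.

Lemma potential_opp (nu : R) (zeta : C) : potential (- nu) zeta = potential nu zeta.
Proof. unfold potential. rewrite RtoC_opp. ring. Qed.

Lemma Macdonald_noninteger (nu : R) :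
  0 < nu -> sin (PI * nu) <> 0 -> exists K', Macdonald nu (K_quotient nu) K'.
Proof.
  intros Hn Hs. set (x := PI / 2 * / sin (PI * nu)).
  assert (E : forall zeta, K_quotient nu zeta = (RtoC x * (fI (- nu) zeta - fI nu zeta))%C).
  { intros zeta. unfold K_quotient, x. rewrite Cdiv_RtoC, RtoC_mult. ring. }
  exists (fun zeta => (RtoC x * (fI' (- nu) zeta - fI' nu zeta))%C). split.
  - intros zeta s d Hz. apply (Cderive_ext (fun t => RtoC x * (fI (- nu) (zeta t) - fI nu (zeta t)))%C).
    intros; symmetry; apply E. eapply Cderive_value.
    exact (Cderive_scal (RtoC x) _ _ _ (Cderive_minus _ _ _ _ _ (Cderive_fI (- nu) _ _ _ Hz) (Cderive_fI nu _ _ _ Hz))).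
    ring.
  - intros zeta s d Hz. eapply Cderive_value.
    exact (Cderive_scal (RtoC x) _ _ _ (Cderive_minus _ _ _ _ _ (Cderive_fI' (- nu) _ _ _ Hz) (Cderive_fI' nu _ _ _ Hz))).
    rewrite E, potential_opp. ring.
  - intros zeta. rewrite E.
    transitivity (- RtoC x * (fI nu zeta * fI' (- nu) zeta - fI (- nu) zeta * fI' nu zeta))%C. ring.
    rewrite I_wronskian, <- RtoC_opp, <- RtoC_mult. f_equal. unfold x. field.
    split; auto. apply PI_neq0.
  - intros u Hu. rewrite K_quotient_real, fI_real, <- RtoC_mult, Cmod_R.
    destruct (rK_rI_bounds nu u Hn Hs Hu). rewrite Rabs_pos_eq; auto.
Qed.

(** * The Macdonald function of integral order *)

Lemma sin_PI_INR (n : nat) : sin (PI * INR n) = 0 /\ cos (PI * INR n) * cos (PI * INR n) = 1.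
Proof.
  assert (S : sin (PI * INR n) = 0).
  { apply sin_eq_0_1. exists (Z.of_nat n). rewrite <- INR_IZR_INZ. ring. }
  split; auto. generalize (sin2_cos2 (PI * INR n)). rewrite S. unfold Rsqr. lra.
Qed.

Lemma is_derive_sin_PI (m : R) : is_derive (fun m => sin (PI * m)) m (PI * cos (PI * m)).
Proof. auto_derive; auto. Rring. Qed.

Lemma Cderive_fI_opp_sub (n : nat) (zeta : C) :
  is_Cderive (fun m => (fI (- m) zeta - fI m zeta)%C) (INR n) (- (fD (INR n) zeta + fD (- INR n) zeta))%C.
Proof.
  eapply Cderive_value.
  - exact (Cderive_minus _ _ _ _ _
      (Cderive_comp_opp (fun m => fI m zeta) _ _ (Cderive_fI_order (- INR n) zeta)) (Cderive_fI_order (INR n) zeta)).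
  - ring.
Qed.

(** The value of the limit by l'Hospital's rule. Here cos (pi n) stands for the sign (-1)^n, and
    [fD (- INR n)] is the derivative of I_mu in mu taken at mu = - n. *)
Definition K_integer (n : nat) (zeta : C) : C :=
  (RtoC (- / (2 * cos (PI * INR n))) * (fD (INR n) zeta + fD (- INR n) zeta))%C.

Lemma is_lim_K_quotient (n : nat) (zeta : C) :
  is_lim (fun m => Re (K_quotient m zeta)) (INR n) (Re (K_integer n zeta)) /\
  is_lim (fun m => Im (K_quotient m zeta)) (INR n) (Im (K_integer n zeta)).
Proof.
  destruct (Cderive_fI_opp_sub n zeta) as [D1 D2].
  destruct (sin_PI_INR n) as [S1 S2].
  assert (Hc : cos (PI * INR n) <> 0) by (intros E; rewrite E in S2; lra).
  assert (HP := PI_neq0).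
  assert (Z : (fI (- INR n) zeta - fI (INR n) zeta = 0)%C) by (rewrite fI_opp_nat; ring).
  assert (T : forall (p : C -> R) l, (p = Re \/ p = Im) ->
    is_derive (fun m => p (fI (- m) zeta - fI m zeta)%C) (INR n) (p (- l)%C) ->
    is_lim (fun m => p (K_quotient m zeta)) (INR n) (p (RtoC (- / (2 * cos (PI * INR n))) * l)%C)).
  { intros p l Hp D.
    assert (Pm : forall (a : R) z, p (RtoC a * z)%C = a * p z).
    { intros a z. destruct Hp as [-> | ->]; unfold Re, Im; simpl; ring. }
    apply (is_lim_ext (fun m => PI / 2 * (p (fI (- m) zeta - fI m zeta)%C * / sin (PI * m)))).
    { intros m. unfold K_quotient. rewrite Cdiv_RtoC, !Pm. ring. }
    assert (L : is_lim (fun m => p (fI (- m) zeta - fI m zeta)%C * / sin (PI * m)) (INR n)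
       (p (- l)%C / (PI * cos (PI * INR n)))).
    { apply is_lim_quotient_of_derive; [rewrite Z; destruct Hp as [-> | ->]; reflexivity|exact S1|exact D|apply is_derive_sin_PI|].
      now apply Rmult_integral_contrapositive_currified. }
    apply (is_lim_scal_l _ (PI / 2)) in L.
    replace (p (RtoC (- / (2 * cos (PI * INR n))) * l)%C)
      with (PI / 2 * (p (- l)%C / (PI * cos (PI * INR n)))).
    + exact L.
    + rewrite Pm. replace (- l)%C with (RtoC (-1) * l)%C by ring. rewrite Pm. field. auto. }
  split; apply T; auto.
Qed.

(** [I_wronskian] differentiated in the order at n. Since I_{-n} = I_n, the left-hand side becomes
    the Wronskian of D_n + D_{-n} with I_n, which normalises [K_integer]. *)
Lemma I_wronskian_order_derivative (n : nat) (zeta : C) :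
  (fD (INR n) zeta * fI' (- INR n) zeta - fI (INR n) zeta * fD' (- INR n) zeta
   - (- fD (- INR n) zeta * fI' (INR n) zeta + fI (- INR n) zeta * fD' (INR n) zeta)
   = RtoC (- 2 * cos (PI * INR n)))%C.
Proof.
  assert (A := Cderive_minus _ _ _ _ _
     (Cderive_mult _ _ _ _ _ (Cderive_fI_order (INR n) zeta)
        (Cderive_comp_opp (fun m => fI' m zeta) _ _ (Cderive_fI'_order (- INR n) zeta)))
     (Cderive_mult _ _ _ _ _ (Cderive_comp_opp (fun m => fI m zeta) _ _ (Cderive_fI_order (- INR n) zeta))
        (Cderive_fI'_order (INR n) zeta))).
  cbv beta in A.
  assert (B : is_Cderive (fun m => RtoC (- (2 / PI) * sin (PI * m))) (INR n) (RtoC (- 2 * cos (PI * INR n)))).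
  { apply Cderive_RtoC. eapply is_derive_value. apply is_derive_scal, is_derive_sin_PI.
    field. apply PI_neq0. }
  apply (Cderive_ext _ (fun m => RtoC (- (2 / PI) * sin (PI * m)))) in A.
  2: intros m; apply I_wronskian.
  rewrite <- (Cderive_unique _ _ _ _ A B). ring.
Qed.

Lemma sin_PI_nonzero_near_INR (n : nat) :
  Rbar_locally' (INR n) (fun m => 0 < m -> sin (PI * m) <> 0).
Proof.
  exists (mkposreal 1 Rlt_0_1). intros m Hm Hne _ Hs. simpl in Hm.
  unfold_ball Hm.
  apply sin_eq_0_0 in Hs. destruct Hs as [k Hk].
  assert (E : m = IZR k).
  { apply Rmult_eq_reg_l with PI. rewrite Hk; ring. apply PI_neq0. }
  subst m. rewrite INR_IZR_INZ in Hm, Hne. apply Rabs_def2 in Hm.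
  assert (k = Z.of_nat n).
  { assert (k < Z.of_nat n + 1)%Z by (apply lt_IZR; rewrite plus_IZR; lra).
    assert (Z.of_nat n - 1 < k)%Z by (apply lt_IZR; rewrite minus_IZR; lra). lia. }
  subst k. now apply Hne.
Qed.

Lemma Macdonald_integer (n : nat) :
  0 < INR n -> exists K', Macdonald (INR n) (K_integer n) K'.
Proof.
  intros Hn. destruct (sin_PI_INR n) as [S1 S2].
  set (c := cos (PI * INR n)) in *.
  assert (Hc : c <> 0) by (intros E; rewrite E in S2; lra).
  set (x := - / (2 * c)).
  exists (fun zeta => (RtoC x * (fD' (INR n) zeta + fD' (- INR n) zeta))%C). split.
  - intros zeta s d Hz. eapply Cderive_value.
    exact (Cderive_scal (RtoC x) _ _ _ (Cderive_plus _ _ _ _ _ (Cderive_fD (INR n) _ _ _ Hz) (Cderive_fD (- INR n) _ _ _ Hz))).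
    ring.
  (* The source terms 2 n I_n and - 2 n I_{-n} of the two equations cancel, so D_n + D_{-n} solves
     the homogeneous equation. *)
  - intros zeta s d Hz. eapply Cderive_value.
    exact (Cderive_scal (RtoC x) _ _ _ (Cderive_plus _ _ _ _ _ (Cderive_fD' (INR n) _ _ _ Hz) (Cderive_fD' (- INR n) _ _ _ Hz))).
    unfold K_integer. fold c. fold x. rewrite potential_opp, fI_opp_nat, RtoC_opp. ring.
  - intros zeta. assert (W := I_wronskian_order_derivative n zeta). fold c in W.
    rewrite fI_opp_nat, fI'_opp_nat in W.
    unfold K_integer. fold c. fold x.
    transitivity (RtoC x * (fD (INR n) zeta * fI' (INR n) zeta - fI (INR n) zeta * fD' (- INR n) zeta
       - (- fD (- INR n) zeta * fI' (INR n) zeta + fI (INR n) zeta * fD' (INR n) zeta)))%C. ring.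
    rewrite W, <- RtoC_mult. f_equal. unfold x. field. auto.
  - intros u Hu.
    assert (R : exists k, K_integer n (RtoC u) = RtoC k).
    { unfold K_integer. rewrite !fD_real, <- RtoC_plus, <- RtoC_mult. eauto. }
    destruct R as [k Hk]. rewrite Hk, fI_real, <- RtoC_mult, Cmod_R.
    destruct (is_lim_K_quotient n (RtoC u)) as [L _]. rewrite Hk in L. change (Re (RtoC k)) with k in L.
    apply (is_lim_ext _ (fun m => rK m u)) in L.
    2: intros m; now rewrite K_quotient_real.
    (* The bound at neighbouring non-integral orders does not depend on the order, so it passes to
       the limit. *)
    assert (Lm : is_lim (fun m => rK m u * rI m u) (INR n) (k * rI (INR n) u)).
    { apply (is_lim_mult (fun m => rK m u) (fun m => rI m u) _ k (rI (INR n) u)); auto.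
      - apply (is_lim_continuity (fun m => rI m u) (INR n)). apply (is_derive_continuity_pt _ _ _ (is_derive_rI_order (INR n) u)).
      - simpl. auto. }
    assert (Loc : Rbar_locally' (INR n) (fun m => 0 <= rK m u * rI m u <= / (2 * (2 * exp u - 1)))).
    { assert (P : Rbar_locally' (INR n) (fun m => 0 < m)).
      { exists (mkposreal _ Hn). intros m Hm _. simpl in Hm.
        unfold_ball Hm.
        apply Rabs_def2 in Hm. lra. }
      generalize (filter_and _ _ P (sin_PI_nonzero_near_INR n)). apply filter_imp.
      intros m [H1 H2]. apply rK_rI_bounds; auto. }
    assert (B1 : Rbar_le 0 (k * rI (INR n) u)).
    { apply (is_lim_le_loc (fun _ => 0) (fun m => rK m u * rI m u) (INR n)); auto.
      - eapply filter_imp; [|exact Loc]. intros m Hm. apply Hm.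
      - apply is_lim_const. }
    assert (B2 : Rbar_le (k * rI (INR n) u) (/ (2 * (2 * exp u - 1)))).
    { apply (is_lim_le_loc (fun m => rK m u * rI m u) (fun _ => / (2 * (2 * exp u - 1))) (INR n)); auto.
      - eapply filter_imp; [|exact Loc]. intros m Hm. apply Hm.
      - apply is_lim_const. }
    simpl in B1, B2. rewrite Rabs_pos_eq; auto.
Qed.

(** * Translation to points of the cut plane *)

Definition log_half (z : point) : C := (ln (modulus z / 2), argument z).

Lemma power_half (z : point) (nu : R) : power (half z) nu = cexp (RtoC nu * log_half z).
Proof.
  assert (E1 : Re (RtoC nu * log_half z) = nu * ln (modulus z / 2)) by (unfold Re; simpl; ring).
  assert (E2 : Im (RtoC nu * log_half z) = nu * argument z) by (unfold Im; simpl; ring).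
  unfold cexp. rewrite E1, E2. reflexivity.
Qed.

Lemma to_C_half (z : point) : 0 < modulus z -> to_C (half z) = cexp (log_half z).
Proof.
  intros Hz. unfold to_C, half, cexp, log_half, Re, Im; simpl.
  rewrite exp_ln by lra. reflexivity.
Qed.

Lemma BesselI_eq (nu : R) (z : point) : 0 < modulus z -> BesselI nu z = fI nu (log_half z).
Proof.
  intros Hz. unfold BesselI, fI, frob, Phi. rewrite power_half. f_equal.
  apply CSeries_ext. intros k. rewrite to_C_half, Cpow_mult_r by auto.
  rewrite cexp_pow. replace (INR 2) with 2 by (simpl; ring). reflexivity.
Qed.

Lemma BesselK_quotient_eq (nu : R) (z : point) :
  0 < modulus z -> BesselK_quotient nu z = K_quotient nu (log_half z).
Proof.
  intros Hz. unfold BesselK_quotient, K_quotient. now rewrite !BesselI_eq by auto.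
Qed.

Lemma BesselK_Macdonald (nu : R) :
  0 < nu -> exists K K', Macdonald nu K K' /\
    forall z, 0 < modulus z -> BesselK nu z = K (log_half z).
Proof.
  intros Hn. unfold BesselK. destruct (Req_EM_T (frac_part nu) 0) as [Hf|Hf].
  - destruct (fp_nat nu Hf) as [k Hk].
    assert (E : nu = INR (Z.to_nat k)).
    { rewrite INR_IZR_INZ, Z2Nat.id; auto. apply le_IZR. lra. }
    revert Hn. rewrite E. generalize (Z.to_nat k). intros n Hn.
    destruct (Macdonald_integer n Hn) as [K' HK].
    exists (K_integer n), K'. split; auto.
    intros z Hz. destruct (is_lim_K_quotient n (log_half z)) as [L1 L2].
    apply (is_lim_ext _ (fun m => Re (BesselK_quotient m z))) in L1.
    2: intros m; now rewrite BesselK_quotient_eq.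
    apply (is_lim_ext _ (fun m => Im (BesselK_quotient m z))) in L2.
    2: intros m; now rewrite BesselK_quotient_eq.
    rewrite (is_lim_unique _ _ _ L1), (is_lim_unique _ _ _ L2). simpl.
    symmetry. apply surjective_pairing.
  - assert (Hs : sin (PI * nu) <> 0).
    { intros Hs. apply sin_eq_0_0 in Hs. destruct Hs as [k Hk]. apply Hf.
      assert (E : nu = IZR k + 0).
      { apply Rmult_eq_reg_l with PI. rewrite Hk; ring. apply PI_neq0. }
      symmetry. apply (Int_part_frac_part_spec nu k 0); auto. lra. }
    destruct (Macdonald_noninteger nu Hn Hs) as [K' HK].
    exists (K_quotient nu), K'. split; auto. intros z Hz. now apply BesselK_quotient_eq.
Qed.

(** * Contour integrals of exact integrands *)

Lemma is_derive_C_of_Cderive (f : R -> C) (s : R) (l : C) :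
  is_Cderive f s l -> is_derive (K := R_AbsRing) (V := C_R_NormedModule) f s l.
Proof.
  intros [H1 H2].
  assert (P : filterdiff (fun t : prod_NormedModule R_AbsRing R_NormedModule R_NormedModule => ((fst t, snd t) : C_R_NormedModule))
     (locally (Re (f s), Im (f s)))
     (fun t : prod_NormedModule R_AbsRing R_NormedModule R_NormedModule => ((fst t, snd t) : C_R_NormedModule))).
  { apply (filterdiff_ext_lin _ (fun t => t)).
    - apply (filterdiff_ext (fun t => t)).
      + now intros [x y].
      + apply filterdiff_id.
    - now intros [x y]. }
  assert (Q := filterdiff_comp'_2 (fun t => Re (f t)) (fun t => Im (f t))
    (fun x y => ((x, y) : C_R_NormedModule)) s _ _ (fun x y => ((x, y) : C_R_NormedModule)) H1 H2 P).
  unfold is_derive. eapply filterdiff_ext_lin.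
  - eapply filterdiff_ext; [|exact Q]. intros t. simpl. symmetry. apply surjective_pairing.
  - intros y. reflexivity.
Qed.

Lemma piecewise_C1_le (f : R -> R) (a b : R) : piecewise_C1 f a b -> a <= b.
Proof. induction 1; lra. Qed.

Lemma C1_on_sub (f : R -> R) (a b c d : R) : C1_on f a b -> a <= c -> d <= b -> C1_on f c d.
Proof. intros (g & Hg & E) H1 H2. exists g. split; auto. intros s Hs. apply E; lra. Qed.

Lemma piecewise_C1_sub (f : R -> R) (a b : R) :
  piecewise_C1 f a b -> forall c d, a <= c -> c <= d -> d <= b -> piecewise_C1 f c d.
Proof.
  induction 1 as [a b Hab H|a b e H1 IH1 H2 IH2]; intros c d Hc Hcd Hd.
  - apply piecewise_C1_piece; auto. now apply (C1_on_sub f a b).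
  - destruct (Rle_dec d b). now apply IH1.
    destruct (Rle_dec b c). now apply IH2.
    apply piecewise_C1_concat with b; [apply IH1|apply IH2]; lra.
Qed.

(** The second clause supplies, along every differentiable curve, the continuity of the integrand
    that the fundamental theorem of calculus requires. *)
Definition primitive (F f : C -> C) : Prop :=
  (forall zeta s d, is_Cderive zeta s d -> is_Cderive (fun t => F (zeta t)) s (d * f (zeta s))%C) /\
  (forall zeta s d, is_Cderive zeta s d -> exists l, is_Cderive (fun t => f (zeta t)) s l).

(** As dt / t = d zeta, the form g(t) dt is f(zeta) d zeta. *)
Definition log_integrand (f : C -> C) (g : point -> C) : Prop :=
  forall t, 0 < modulus t -> g t = (f (log_half t) / to_C t)%C.

Definition has_primitive_integral (F : C -> C) (g : point -> C) (gamma : R -> point) (a b : R) : Prop :=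
  is_RInt (V := C_R_NormedModule) (pullback g gamma) a b
    (F (log_half (gamma b)) - F (log_half (gamma a)))%C.

Lemma has_primitive_integral_Chasles F g gamma a b c :
  has_primitive_integral F g gamma a b -> has_primitive_integral F g gamma b c ->
  has_primitive_integral F g gamma a c.
Proof.
  intros H1 H2. unfold has_primitive_integral.
  replace (F (log_half (gamma c)) - F (log_half (gamma a)))%C with
    ((F (log_half (gamma b)) - F (log_half (gamma a))) + (F (log_half (gamma c)) - F (log_half (gamma b))))%C
    by ring.
  exact (is_RInt_Chasles (V := C_R_NormedModule) _ _ _ _ _ _ H1 H2).
Qed.

Lemma to_C_nz (t : point) : 0 < modulus t -> to_C t <> 0.
Proof.
  intros Ht E. apply (cexp_nz (log_half t)).
  rewrite <- to_C_half by auto. unfold to_C, half in *; simpl.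
  apply (f_equal fst) in E as E1. apply (f_equal snd) in E as E2. simpl in E1, E2.
  unfold RtoC. f_equal; lra.
Qed.

Lemma has_primitive_integral_C1 F f g gamma a b :
  primitive F f -> log_integrand f g -> a <= b ->
  C1_on (fun s => modulus (gamma s)) a b -> C1_on (fun s => argument (gamma s)) a b ->
  (forall s, a <= s <= b -> 0 < modulus (gamma s)) ->
  has_primitive_integral F g gamma a b.
Proof.
  intros [HF Hf] Hg Hab (m & Dm & Em) (p & Dp & Ep) Hpos.
  (* Computations use the extensions [m] and [p], differentiable on both sides of every point of
     [a, b]. The velocity of the path itself is compared with them only in the open interval, which
     does not affect the integral. *)
  set (zeta := fun s => ((ln (m s / 2), p s) : C)).
  set (d := fun s => ((Derive m s / m s, Derive p s) : C)).
  assert (Mpos : forall s, a <= s <= b -> 0 < m s) by (intros s Hs; rewrite <- Em by auto; auto).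
  assert (Dz : forall s, a <= s <= b -> is_Cderive zeta s (d s)).
  { intros s Hs. specialize (Mpos s Hs). split; simpl.
    - eapply is_derive_value.
      + apply (is_derive_comp (V := R_NormedModule) ln (fun t => m t / 2)).
        apply is_derive_ln. lra.
        apply (is_derive_ext (fun t => / 2 * m t)). intros; simpl; unfold Rdiv; apply Rmult_comm.
        apply is_derive_scal, Derive_correct, Dm.
      + unfold scal; simpl; unfold mult; simpl. unfold Re; simpl. field. lra.
    - apply Derive_correct, Dp. }
  assert (Ez : forall s, a <= s <= b -> log_half (gamma s) = zeta s).
  { intros s Hs. unfold log_half, zeta. now rewrite Em, Ep. }
  set (H := fun s => (d s * f (zeta s))%C).
  assert (Cc : forall (q : R -> R) s l, is_derive q s l -> continuous q s).
  { intros q s l Hq. apply (ex_derive_continuous q). now exists l. }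
  assert (CH : forall s, a <= s <= b -> continuous (fun t => Re (H t)) s /\ continuous (fun t => Im (H t)) s).
  { intros s Hs. destruct (Hf zeta s _ (Dz s Hs)) as [l [L1 L2]].
    apply Cc in L1. apply Cc in L2.
    assert (C1 : continuous (fun t => Derive m t / m t) s).
    { apply (continuous_mult (K := R_AbsRing)). apply Dm.
      specialize (Mpos s Hs).
      apply (Cc _ _ (- Derive m s / m s ^ 2)). apply is_derive_inv. apply Derive_correct, Dm. lra. }
    assert (C2 : continuous (Derive p) s) by apply Dp.
    split; unfold H; simpl.
    - apply (continuous_minus (V := R_NormedModule)); apply (continuous_mult (K := R_AbsRing)); auto.
    - apply (continuous_plus (V := R_NormedModule)); apply (continuous_mult (K := R_AbsRing)); auto. }
  assert (IH : is_RInt (V := C_R_NormedModule) H a b (F (zeta b) - F (zeta a))%C).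
  { assert (I1 : is_RInt (fun t => Re (H t)) a b (Re (F (zeta b)) - Re (F (zeta a)))).
    { apply (is_RInt_derive (V := R_CompleteNormedModule) (fun t => Re (F (zeta t))) (fun t => Re (H t)));
        intros s Hs; rewrite Rmin_left, Rmax_right in Hs by lra.
      - exact (proj1 (HF zeta s (d s) (Dz s Hs))).
      - exact (proj1 (CH s Hs)). }
    assert (I2 : is_RInt (fun t => Im (H t)) a b (Im (F (zeta b)) - Im (F (zeta a)))).
    { apply (is_RInt_derive (V := R_CompleteNormedModule) (fun t => Im (F (zeta t))) (fun t => Im (H t)));
        intros s Hs; rewrite Rmin_left, Rmax_right in Hs by lra.
      - exact (proj2 (HF zeta s (d s) (Dz s Hs))).
      - exact (proj2 (CH s Hs)). }
    exact (is_RInt_fct_extend_pair H a b _ _ I1 I2). }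
  unfold has_primitive_integral. rewrite !Ez by lra.
  apply (is_RInt_ext (V := C_R_NormedModule) H); [|exact IH].
  intros s Hs. rewrite Rmin_left, Rmax_right in Hs by lra.
  assert (Hs' : a <= s <= b) by lra.
  assert (Loc : locally s (fun t => modulus (gamma t) = m t /\ argument (gamma t) = p t)).
  { assert (He : 0 < Rmin (s - a) (b - s)) by (apply Rmin_pos; lra).
    exists (mkposreal _ He). intros t Ht. simpl in Ht.
    unfold_ball Ht.
    apply Rabs_def2 in Ht. generalize (Rmin_l (s - a) (b - s)) (Rmin_r (s - a) (b - s)). intros.
    split; [apply Em|apply Ep]; lra. }
  assert (DM := Derive_correct _ _ (proj1 (Dm s))). assert (DP := Derive_correct _ _ (proj1 (Dp s))).
  assert (V : velocity gamma s = (to_C (gamma s) * d s)%C).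
  { specialize (Mpos s Hs').
    unfold velocity, to_C, d. rewrite (Em s Hs'), (Ep s Hs'). simpl.
    apply injective_projections; simpl.
    - rewrite (Derive_ext_loc _ (fun t => m t * cos (p t))).
      2:{ eapply filter_imp; [|exact Loc]. intros t [-> ->]. reflexivity. }
      apply is_derive_unique. eapply is_derive_value.
      + apply (Derive.is_derive_mult m (fun t => cos (p t))); [exact DM|].
        apply (is_derive_comp (V := R_NormedModule) cos p); [apply is_derive_cos|exact DP].
      + unfold scal; simpl; unfold mult; simpl. field. lra.
    - rewrite (Derive_ext_loc _ (fun t => m t * sin (p t))).
      2:{ eapply filter_imp; [|exact Loc]. intros t [-> ->]. reflexivity. }
      apply is_derive_unique. eapply is_derive_value.
      + apply (Derive.is_derive_mult m (fun t => sin (p t))); [exact DM|].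
        apply (is_derive_comp (V := R_NormedModule) sin p); [apply is_derive_sin|exact DP].
      + unfold scal; simpl; unfold mult; simpl. field. lra. }
  unfold pullback, H. rewrite V, Hg, Ez by auto.
  assert (Nz := to_C_nz (gamma s) (Hpos s Hs')).
  match goal with |- ?x = ?y => change (@eq C x y) end. field. exact Nz.
Qed.

(** Modulus and argument may be subdivided at different points: the induction on the pieces of the
    argument is nested in the one on the pieces of the modulus. *)
Lemma has_primitive_integral_path F f g gamma a b :
  primitive F f -> log_integrand f g -> piecewise_C1_path gamma a b ->
  has_primitive_integral F g gamma a b.
Proof.
  intros HF Hg (Hc & Hm & Hp).
  assert (Hpos : forall s, a <= s <= b -> 0 < modulus (gamma s)) by (intros s Hs; apply Hc; auto).
  clear Hc. induction Hm as [a b Hab Hm|a b c H1 IH1 H2 IH2].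
  - induction Hp as [a b _ Hp|a b c H1 IH1 H2 IH2].
    + now apply has_primitive_integral_C1 with f.
    + assert (L1 := piecewise_C1_le _ _ _ H1). assert (L2 := piecewise_C1_le _ _ _ H2).
      apply has_primitive_integral_Chasles with b.
      * apply IH1; auto. apply (C1_on_sub _ a c); auto; lra. intros; apply Hpos; lra.
      * apply IH2; auto. apply (C1_on_sub _ a c); auto; lra. intros; apply Hpos; lra.
  - assert (L1 := piecewise_C1_le _ _ _ H1). assert (L2 := piecewise_C1_le _ _ _ H2).
    apply has_primitive_integral_Chasles with b.
    + apply IH1. apply (piecewise_C1_sub _ a c); auto; lra. intros; apply Hpos; lra.
    + apply IH2. apply (piecewise_C1_sub _ a c); auto; lra. intros; apply Hpos; lra.
Qed.

Lemma ball_of_Cmod (l e : C) (eps : posreal) :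
  Cmod e < eps -> ball (M := C_R_NormedModule) l eps (l + e)%C.
Proof.
  intros H. assert (H1 := re_le_Cmod e). assert (H2 := im_le_Cmod e).
  split; unfold_ball_goal.
  - replace (fst l + fst e + - fst l) with (Re e) by (unfold Re; ring). lra.
  - replace (snd l + snd e + - snd l) with (Im e) by (unfold Im; ring). lra.
Qed.

(** The path may approach 0 with a varying argument, so the decay of [F] is required uniformly in
    the argument. *)
Lemma is_integral_from_zero_primitive F f g gamma z :
  primitive F f -> log_integrand f g -> path_from_zero z gamma ->
  (forall eps, 0 < eps -> exists d, 0 < d /\ forall t, 0 < modulus t < d -> Cmod (F (log_half t)) < eps) ->
  is_integral_from_zero g gamma (F (log_half z)).
Proof.
  intros HF Hg (E & Hp & Hl) HL P [eps HP].
  destruct (HL eps (cond_pos eps)) as (d & Hd & Hs).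
  destruct (proj1 (filterlim_locally _ _) Hl (mkposreal d Hd)) as [e He]. simpl in He.
  assert (He1 : 0 < Rmin e 1) by (apply Rmin_pos; [apply cond_pos|lra]).
  apply (Filter_prod _ _ _ (fun a => 0 < a < Rmin e 1) (fun b => b = 1)).
  - exists (mkposreal _ He1). intros a Ha Ha0. simpl in Ha.
    unfold_ball Ha.
    apply Rabs_def2 in Ha. lra.
  - reflexivity.
  - intros a b Ha ->. simpl.
    generalize (Rmin_l e 1) (Rmin_r e 1). intros M1 M2.
    assert (Hpath := Hp a ltac:(lra)).
    exists (F (log_half z) - F (log_half (gamma a)))%C. split.
    + rewrite <- E. now apply has_primitive_integral_path with f.
    + apply HP. apply (ball_of_Cmod (F (log_half z)) (- F (log_half (gamma a)))%C).
      rewrite Cmod_opp. apply Hs.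
      assert (Hm : 0 < modulus (gamma a)) by (apply Hpath; lra).
      split; auto.
      assert (B : ball 0 e a).
      { unfold_ball_goal.
        rewrite Ropp_0, Rplus_0_r, Rabs_pos_eq; lra. }
      specialize (He a B ltac:(lra)).
      unfold_ball He.
      apply Rabs_def2 in He. lra.
Qed.

(** The path ends on the positive reals, so decay of [F] is required at argument 0; the primitive
    vanishes at the upper end, hence the minus sign. *)
Lemma is_integral_to_infinity_primitive F f g gamma z :
  primitive F f -> log_integrand f g -> path_to_infinity z gamma ->
  (forall eps, 0 < eps -> exists m, forall t, m < modulus t -> argument t = 0 -> Cmod (F (log_half t)) < eps) ->
  is_integral_to_infinity g gamma (- F (log_half z))%C.
Proof.
  intros HF Hg (E & Hp & [b0 Hb0] & Hl) HL P [eps HP].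
  destruct (HL eps (cond_pos eps)) as (m & Hs).
  apply is_lim_spec in Hl. destruct (Hl m) as [b1 Hb1].
  apply (Filter_prod _ _ _ (fun a => a = 0) (fun b => Rmax 0 (Rmax b0 b1) < b)).
  - reflexivity.
  - exists (Rmax 0 (Rmax b0 b1)). auto.
  - intros a b -> Hb. simpl.
    assert (0 < b /\ b0 < b /\ b1 < b) as (B1 & B2 & B3).
    { generalize (Rmax_l 0 (Rmax b0 b1)) (Rmax_r 0 (Rmax b0 b1)) (Rmax_l b0 b1) (Rmax_r b0 b1). lra. }
    exists (F (log_half (gamma b)) - F (log_half z))%C. split.
    + rewrite <- E. apply has_primitive_integral_path with f; auto.
    + apply HP. replace (F (log_half (gamma b)) - F (log_half z))%C
        with (- F (log_half z) + F (log_half (gamma b)))%C by ring.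
      apply ball_of_Cmod, Hs. apply Hb1; auto. apply Hb0; lra.
Qed.

Lemma primitive_scal (x : C) (F f : C -> C) :
  primitive F f -> primitive (fun z => x * F z)%C (fun z => x * f z)%C.
Proof.
  intros [H1 H2]. split.
  - intros zeta s d Hz. eapply Cderive_value. exact (Cderive_scal x _ _ _ (H1 _ _ _ Hz)). ring.
  - intros zeta s d Hz. destruct (H2 _ _ _ Hz) as [l Hl]. eexists. exact (Cderive_scal x _ _ _ Hl).
Qed.

(** * The two Wronskians *)

Lemma primitive_wronskian_ID (nu : R) :
  primitive (wronskian_ID nu) (fun zeta => 2 * nu * (fI nu zeta * fI nu zeta))%C.
Proof.
  split.
  - intros zeta s d Hz. now apply Cderive_wronskian_ID.
  - intros zeta s d Hz. eexists.
    exact (Cderive_scal (2 * nu) _ _ _ (Cderive_mult _ _ _ _ _ (Cderive_fI nu _ _ _ Hz) (Cderive_fI nu _ _ _ Hz))).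
Qed.

Definition wronskian_KD (nu : R) (K K' : C -> C) (zeta : C) : C :=
  (K zeta * fD' nu zeta - fD nu zeta * K' zeta)%C.

Lemma primitive_wronskian_KD (nu : R) (K K' : C -> C) :
  Macdonald nu K K' ->
  primitive (wronskian_KD nu K K') (fun zeta => 2 * nu * (K zeta * fI nu zeta))%C.
Proof.
  intros [M1 M2 _ _]. split.
  - intros zeta s d Hz. eapply Cderive_value.
    exact (Cderive_minus _ _ _ _ _
      (Cderive_mult _ _ _ _ _ (M1 _ _ _ Hz) (Cderive_fD' nu _ _ _ Hz))
      (Cderive_mult _ _ _ _ _ (Cderive_fD nu _ _ _ Hz) (M2 _ _ _ Hz))).
    cbv beta. ring.
  - intros zeta s d Hz. eexists.
    exact (Cderive_scal (2 * nu) _ _ _ (Cderive_mult _ _ _ _ _ (M1 _ _ _ Hz) (Cderive_fI nu _ _ _ Hz))).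
Qed.

Lemma wronskian_ID_at_zero (nu : R) :
  0 < nu -> forall eps, 0 < eps -> exists d, 0 < d /\
    forall t, 0 < modulus t < d -> Cmod (wronskian_ID nu (log_half t)) < eps.
Proof.
  intros Hn eps He. destruct (wronskian_ID_bound nu) as (A & HA & H).
  set (e := ln (eps / (A + 1)) / (2 * nu)).
  (* The factor 2 matches the halving in [log_half]; the 1 keeps Re zeta negative, as the bound
     requires. *)
  exists (2 * Rmin 1 (exp e)). split.
  { assert (0 < Rmin 1 (exp e)) by (apply Rmin_pos; [lra|apply exp_pos]). lra. }
  intros t Ht. generalize (Rmin_l 1 (exp e)) (Rmin_r 1 (exp e)). intros M1 M2.
  assert (L0 : Re (log_half t) < 0).
  { unfold log_half, Re; simpl. rewrite <- ln_1. apply ln_increasing; lra. }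
  assert (L1 : Re (log_half t) < e).
  { unfold log_half, Re; simpl. rewrite <- (ln_exp e). apply ln_increasing; lra. }
  eapply Rle_lt_trans; [apply H; lra|].
  assert (Hq : 0 < eps / (A + 1)) by (apply Rdiv_lt_0_compat; lra).
  assert (exp (2 * nu * Re (log_half t)) < eps / (A + 1)).
  { rewrite <- (exp_ln _ Hq). apply exp_increasing.
    replace (ln (eps / (A + 1))) with (2 * nu * e) by (unfold e; field; lra).
    apply Rmult_lt_compat_l; lra. }
  assert (0 < exp (2 * nu * Re (log_half t))) by apply exp_pos.
  apply Rle_lt_trans with (A * (eps / (A + 1))). apply Rmult_le_compat_l; lra.
  replace eps with ((A + 1) * (eps / (A + 1))) at 2 by (field; lra). lra.
Qed.

Lemma wronskian_KD_at_infinity (nu : R) (K K' : C -> C) :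
  0 < nu -> Macdonald nu K K' -> forall eps, 0 < eps -> exists m,
    forall t, m < modulus t -> argument t = 0 -> Cmod (wronskian_KD nu K K' (log_half t)) < eps.
Proof.
  intros Hn [_ _ M3 M4] eps He.
  (* The two summands are at most 2 (nu + 1) / |t| and 1 / |t|; the second uses |t| >= 2, which
     gives 2 (|t| - 1) >= |t|. *)
  exists (Rmax 2 ((2 * nu + 3) / eps)). intros t Ht Harg.
  generalize (Rmax_l 2 ((2 * nu + 3) / eps)) (Rmax_r 2 ((2 * nu + 3) / eps)). intros X1 X2.
  set (u := ln (modulus t / 2)).
  assert (Eu : 2 * exp u = modulus t) by (unfold u; rewrite exp_ln; lra).
  replace (log_half t) with (RtoC u) by (unfold log_half; rewrite Harg; reflexivity).
  assert (P := rI_pos nu u ltac:(lra)).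
  assert (Nz : RtoC (rI nu u) <> 0) by (intros E; apply RtoC_inj in E; lra).
  specialize (M3 (RtoC u)). specialize (M4 u ltac:(lra)).
  assert (E : wronskian_KD nu K K' (RtoC u) =
     (RtoC (rD nu u / rI nu u) + (K (RtoC u) * fI nu (RtoC u)) * RtoC (rW nu u / rI nu u ^ 2))%C).
  { rewrite !RtoC_div, RtoC_pow by (try apply pow_nonzero; lra).
    rewrite <- wronskian_ID_real, <- fD_real. unfold wronskian_KD, wronskian_ID.
    rewrite <- fI_real in *.
    set (i := fI nu (RtoC u)) in *. set (k := K (RtoC u)) in *.
    (* One occurrence of D is multiplied by the Wronskian of K and I, which equals 1; the rest is an
       identity of rational functions. *)
    replace (fD nu (RtoC u)) with (fD nu (RtoC u) * (k * fI' nu (RtoC u) - i * K' (RtoC u)))%C at 2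
      by (rewrite M3; ring).
    field. exact Nz. }
  rewrite E. eapply Rle_lt_trans; [apply Cmod_triangle|]. rewrite Cmod_mult, !Cmod_R.
  assert (Ee : exp (- u) = 2 * / modulus t).
  { rewrite exp_Ropp, <- Eu. field. generalize (exp_pos u); lra. }
  assert (Hi : 0 < / modulus t) by (apply Rinv_0_lt_compat; lra).
  assert (B1 : Rabs (rD nu u / rI nu u) <= (nu + 1) * (2 * / modulus t)).
  { rewrite Rabs_div, (Rabs_pos_eq (rI nu u)) by lra.
    apply Rmult_le_reg_r with (rI nu u); auto. unfold Rdiv.
    rewrite Rmult_assoc, Rinv_l, Rmult_1_r, <- Ee by lra. now apply rD_bound. }
  assert (B2 : Rabs (rW nu u / rI nu u ^ 2) <= 1).
  { destruct (rW_bounds nu u Hn). assert (0 < rI nu u ^ 2) by now apply pow_lt.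
    assert (0 < / rI nu u ^ 2) by now apply Rinv_0_lt_compat.
    rewrite Rabs_pos_eq by (apply Rmult_le_pos; lra).
    apply Rmult_le_reg_r with (rI nu u ^ 2); auto. unfold Rdiv.
    rewrite Rmult_assoc, Rinv_l by lra. lra. }
  assert (B3 : Cmod (K (RtoC u) * fI nu (RtoC u)) <= / modulus t).
  { eapply Rle_trans; [exact M4|]. rewrite Eu. apply Rinv_le_contravar; lra. }
  assert (B4 : Cmod (K (RtoC u) * fI nu (RtoC u)) * Rabs (rW nu u / rI nu u ^ 2) <= / modulus t * 1)
    by (apply Rmult_le_compat; auto using Cmod_ge_0, Rabs_pos).
  apply Rle_lt_trans with ((2 * nu + 3) * / modulus t). lra.
  assert (X3 : (2 * nu + 3) / eps < modulus t) by lra.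
  apply (Rmult_lt_compat_r eps) in X3; auto.
  unfold Rdiv in X3. rewrite Rmult_assoc, Rinv_l, Rmult_1_r in X3 by lra.
  apply Rmult_lt_reg_r with (modulus t). lra.
  rewrite Rmult_assoc, Rinv_l by lra. lra.
Qed.

Theorem theorem7 :
  forall (nu : R) (z : point),
    (0 < nu)%R ->
    in_cut_plane z ->
    forall gamma_inf gamma_0 : R -> point,
      path_to_infinity z gamma_inf ->
      path_from_zero z gamma_0 ->
      exists A B : C,
        is_integral_to_infinity
          (fun t => (BesselK nu t * BesselI nu t / to_C t)%C) gamma_inf A /\
        is_integral_from_zero
          (fun t => (BesselI nu t * BesselI nu t / to_C t)%C) gamma_0 B /\
        is_derive (K := R_AbsRing) (V := C_R_NormedModule)
          (fun mu : R => BesselI mu z) nu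
          (- RtoC (2 * nu) * (BesselI nu z * A + BesselK nu z * B))%C.
Proof.
  intros nu z Hn [Hz _] gamma_inf gamma_0 Hinf H0.
  destruct (BesselK_Macdonald nu Hn) as (K & K' & HM & HK).
  assert (Hx : 0 < / (2 * nu)) by (apply Rinv_0_lt_compat; lra).
  set (x := / (2 * nu)) in *.
  assert (Ex : (RtoC x * (2 * nu) = 1)%C).
  { rewrite <- !RtoC_mult. f_equal. unfold x. field. lra. }
  (* The factor x = 1 / (2 nu) normalises both primitives. The signs differ because one primitive
     vanishes at the upper limit and the other at the lower limit. *)
  exists (- (RtoC x * wronskian_KD nu K K' (log_half z)))%C, (RtoC x * wronskian_ID nu (log_half z))%C.
  split; [|split].
  - apply (is_integral_to_infinity_primitive (fun zeta => RtoC x * wronskian_KD nu K K' zeta)%C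
      (fun zeta => RtoC x * (2 * nu * (K zeta * fI nu zeta)))%C _ gamma_inf z); auto.
    + apply primitive_scal. now apply primitive_wronskian_KD.
    + intros t Ht. rewrite HK, BesselI_eq by auto.
      rewrite Cmult_assoc, Ex, Cmult_1_l. reflexivity.
    + intros eps He. destruct (wronskian_KD_at_infinity nu K K' Hn HM (eps / x)) as [m Hm].
      now apply Rdiv_lt_0_compat.
      exists m. intros t H1 H2. rewrite Cmod_mult, Cmod_R, Rabs_pos_eq by lra.
      replace eps with (x * (eps / x)) by (field; lra). apply Rmult_lt_compat_l; auto.
  - apply (is_integral_from_zero_primitive (fun zeta => RtoC x * wronskian_ID nu zeta)%C
      (fun zeta => RtoC x * (2 * nu * (fI nu zeta * fI nu zeta)))%C _ gamma_0 z); auto.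
    + apply primitive_scal, primitive_wronskian_ID.
    + intros t Ht. rewrite !BesselI_eq by auto.
      rewrite Cmult_assoc, Ex, Cmult_1_l. reflexivity.
    + intros eps He. destruct (wronskian_ID_at_zero nu Hn (eps / x)) as (d & Hd & Hm).
      now apply Rdiv_lt_0_compat.
      exists d. split; auto. intros t Ht. rewrite Cmod_mult, Cmod_R, Rabs_pos_eq by lra.
      replace eps with (x * (eps / x)) by (field; lra). apply Rmult_lt_compat_l; auto.
  - apply is_derive_C_of_Cderive.
    apply (Cderive_ext (fun mu => fI mu (log_half z))).
    { intros mu. now rewrite BesselI_eq. }
    eapply Cderive_value; [apply Cderive_fI_order|].
    rewrite HK, BesselI_eq by auto.
    set (zeta := log_half z).
    assert (W := Macdonald_wronskian _ _ _ HM zeta).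
    transitivity ((RtoC x * (2 * nu)) * (fD nu zeta * (K zeta * fI' nu zeta - fI nu zeta * K' zeta)))%C.
    rewrite W, Ex. ring.
    unfold wronskian_KD, wronskian_ID. rewrite RtoC_mult. ring.
Qed.
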